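(* Let $A=(a_{ij})$ be an $m\times n$ matrix with every entry $a_{ij}\in[0,1]$, and let $\mathbf p\in[0,1]^n$. There is a deterministic parallel algorithm with depth $\operatorname{poly}(\log(mn))$ and work $\tilde O(n+m+\mathrm{nnz}(A))$ that computes a vector $\mathbf q\in\{0,1\}^n$ such that for each $i\in[m]$, $$\Big|\sum_{j=1}^n a_{ij}q_j-\sum_{j=1}^n a_{ij}p_j\Big|\le O\big(\sqrt{\mu_i\log m}+\log m\big),\qquad \mu_i=\sum_{j=1}^n a_{ij}p_j,$$ where the $O(\cdot)$ hides an absolute constant.
   Context: Work-depth model of parallel computation: work is the total number of computational steps, depth is the longest chain of sequentially dependent steps. $\mathrm{nnz}(A)$ is the number of nonzero entries of $A$. $\tilde O(x)$ denotes $x\cdot\operatorname{poly}(\log(nm))$.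
   Formalization: In the error bound log m is read as log max(m,2), because for m = 1 the stated bound is 0 and the claim fails (A = (1), p = (1/2)); m and n are taken to be at least 1. *)

(* Defs.v *)
From HB Require Import structures.
From mathcomp Require Import all_boot all_order all_algebra.
From mathcomp Require Import all_reals all_analysis.

Set Implicit Arguments.
Unset Strict Implicit.
Unset Printing Implicit Defensive.

Import Order.TTheory GRing.Theory Num.Theory.
Local Open Scope ring_scope.

(** * The work-depth model

    A program is a term of a first-order functional language in the style of
    NESL (Blelloch and Greiner): immutable arrays with constant-time indexing,
    whose only source of parallelism is the array comprehension [Tab]; work and
    depth are given by the evaluation rules.  Numbers are machine words (naturals
    at most [W], exceeding which is a fault) and reals with exact unit-cost
    arithmetic (real-RAM convention).  There is no real constant other than the
    image of a word, and no map from reals to words other than comparison (in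
    particular, no floor). *)

Inductive word_op := WAdd | WSub | WMul | WDiv | WMod | WLe.
Inductive real_op := RAdd | RSub | RMul | RDiv.

(* Variables are de Bruijn indices. *)
Inductive term :=
| Var of nat
| Let of term & term        (* the second term is under one binder *)
| Word of nat
| WordOp of word_op & term & term
| ToReal of term
| RealOp of real_op & term & term
| RealLe of term & term
| If of term & term & term
| Pair of term & term
| Fst of term
| Snd of term
| Tab of term & term        (* [Tab k b] = [| b(i) : i < k |], b under one binder *)
| Len of term
| Get of term & term
| While of term & term.     (* [While c b]: state = variable 0, updated by b while c *)

(* [WSub] truncates at 0; division by zero returns 0 ([WDiv]) or the dividend
   ([WMod]). *)
Definition word_op_sem (o : word_op) : nat -> nat -> nat :=
  match o with
  | WAdd => addn
  | WSub => subn
  | WMul => muln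
  | WDiv => divn
  | WMod => modn
  | WLe => fun x y => (x <= y)%N
  end.

(* Division by zero returns 0. *)
Definition real_op_sem (R : realType) (o : real_op) : R -> R -> R :=
  match o with
  | RAdd => fun x y => x + y
  | RSub => fun x y => x - y
  | RMul => fun x y => x * y
  | RDiv => fun x y => x / y
  end.

Inductive value (R : realType) :=
| VWord of nat
| VReal of R
| VPair of value R & value R
| VVec of seq (value R).

Arguments VWord {R} _.
Arguments VReal {R} _.
Arguments VPair {R} _ _.
Arguments VVec {R} _.

(* [eval_wd W env t v w d]: with words bounded by [W], the term [t] evaluates in the
   environment [env] to [v] with work [w] and depth [d].  Each rule costs one
   step on top of its subcomputations, whose works and depths add up, except
   that the depths of the branches of [Tab] are combined by maximum.  Faults
   (ill-typed operands, index out of bounds, word overflow) and divergence have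
   no derivation. *)
Inductive eval_wd (R : realType) (W : nat) :
  seq (value R) -> term -> value R -> nat -> nat -> Prop :=
| EvVar env i v :
    onth env i = Some v ->
    eval_wd W env (Var i) v 1 1
| EvLet env e b u v w1 d1 w2 d2 :
    eval_wd W env e u w1 d1 -> eval_wd W (u :: env) b v w2 d2 ->
    eval_wd W env (Let e b) v (w1 + w2).+1 (d1 + d2).+1
| EvWord env k :
    (k <= W)%N ->
    eval_wd W env (Word k) (VWord k) 1 1
| EvWordOp env o e1 e2 x y w1 d1 w2 d2 :
    eval_wd W env e1 (VWord x) w1 d1 -> eval_wd W env e2 (VWord y) w2 d2 ->
    (word_op_sem o x y <= W)%N ->
    eval_wd W env (WordOp o e1 e2) (VWord (word_op_sem o x y))
      (w1 + w2).+1 (d1 + d2).+1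
| EvToReal env e x w d :
    eval_wd W env e (VWord x) w d ->
    eval_wd W env (ToReal e) (VReal x%:R) w.+1 d.+1
| EvRealOp env o e1 e2 x y w1 d1 w2 d2 :
    eval_wd W env e1 (VReal x) w1 d1 -> eval_wd W env e2 (VReal y) w2 d2 ->
    eval_wd W env (RealOp o e1 e2) (VReal (real_op_sem o x y))
      (w1 + w2).+1 (d1 + d2).+1
| EvRealLe env e1 e2 x y w1 d1 w2 d2 :
    eval_wd W env e1 (VReal x) w1 d1 -> eval_wd W env e2 (VReal y) w2 d2 ->
    eval_wd W env (RealLe e1 e2) (VWord (x <= y)%R) (w1 + w2).+1 (d1 + d2).+1
| EvIf env c e1 e2 x v w1 d1 w2 d2 :
    eval_wd W env c (VWord x) w1 d1 ->
    eval_wd W env (if x != 0%N then e1 else e2) v w2 d2 ->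
    eval_wd W env (If c e1 e2) v (w1 + w2).+1 (d1 + d2).+1
| EvPair env e1 e2 v1 v2 w1 d1 w2 d2 :
    eval_wd W env e1 v1 w1 d1 -> eval_wd W env e2 v2 w2 d2 ->
    eval_wd W env (Pair e1 e2) (VPair v1 v2) (w1 + w2).+1 (d1 + d2).+1
| EvFst env e v1 v2 w d :
    eval_wd W env e (VPair v1 v2) w d ->
    eval_wd W env (Fst e) v1 w.+1 d.+1
| EvSnd env e v1 v2 w d :
    eval_wd W env e (VPair v1 v2) w d ->
    eval_wd W env (Snd e) v2 w.+1 d.+1
| EvTab env e b k (v : nat -> value R) w d (ws ds : nat -> nat) :
    eval_wd W env e (VWord k) w d ->
    (forall i, (i < k)%N -> eval_wd W (VWord i :: env) b (v i) (ws i) (ds i)) ->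
    eval_wd W env (Tab e b) (VVec (mkseq v k))
      (w + \sum_(i < k) ws i).+1 (d + \max_(i < k) ds i).+1
| EvLen env e s w d :
    eval_wd W env e (VVec s) w d -> (size s <= W)%N ->
    eval_wd W env (Len e) (VWord (size s)) w.+1 d.+1
| EvGet env e1 e2 s i v w1 d1 w2 d2 :
    eval_wd W env e1 (VVec s) w1 d1 -> eval_wd W env e2 (VWord i) w2 d2 ->
    onth s i = Some v ->
    eval_wd W env (Get e1 e2) v (w1 + w2).+1 (d1 + d2).+1
| EvWhileStop env c b u w d :
    eval_wd W (u :: env) c (VWord 0) w d ->
    eval_wd W (u :: env) (While c b) u w.+1 d.+1
| EvWhileStep env c b u u' v x w1 d1 w2 d2 w3 d3 :
    eval_wd W (u :: env) c (VWord x) w1 d1 -> x != 0%N ->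
    eval_wd W (u :: env) b u' w2 d2 ->
    eval_wd W (u' :: env) (While c b) v w3 d3 ->
    eval_wd W (u :: env) (While c b) v (w1 + w2 + w3).+1 (d1 + d2 + d3).+1.

Lemma eval_wd_det (R : realType) (W : nat) (env : seq (value R)) (t : term)
    (v v' : value R) (w w' d d' : nat) :
  eval_wd W env t v w d -> eval_wd W env t v' w' d' -> [/\ v = v', w = w' & d = d'].
Proof.
move=> ev; move: v' w' d'; elim: {env t v w d}ev.
- by move=> env i v e v' w' d' ev; inversion ev; split; congruence.
- move=> env e b u v w1 d1 w2 d2 _ IH1 _ IH2 v' w' d' ev; inversion ev; subst.
  have [? ? ?] := IH1 _ _ _ ltac:(eassumption); subst.
  by have [? ? ?] := IH2 _ _ _ ltac:(eassumption); subst.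
- by move=> env k _ v' w' d' ev; inversion ev.
- move=> env o e1 e2 x y w1 d1 w2 d2 _ IH1 _ IH2 _ v' w' d' ev; inversion ev; subst.
  have [[?] ? ?] := IH1 _ _ _ ltac:(eassumption); subst.
  by have [[?] ? ?] := IH2 _ _ _ ltac:(eassumption); subst.
- move=> env e x w d _ IH v' w' d' ev; inversion ev; subst.
  by have [[?] ? ?] := IH _ _ _ ltac:(eassumption); subst.
- move=> env o e1 e2 x y w1 d1 w2 d2 _ IH1 _ IH2 v' w' d' ev; inversion ev; subst.
  have [[?] ? ?] := IH1 _ _ _ ltac:(eassumption); subst.
  by have [[?] ? ?] := IH2 _ _ _ ltac:(eassumption); subst.
- move=> env e1 e2 x y w1 d1 w2 d2 _ IH1 _ IH2 v' w' d' ev; inversion ev; subst.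
  have [[?] ? ?] := IH1 _ _ _ ltac:(eassumption); subst.
  by have [[?] ? ?] := IH2 _ _ _ ltac:(eassumption); subst.
- move=> env c e1 e2 x v w1 d1 w2 d2 _ IH1 _ IH2 v' w' d' ev; inversion ev; subst.
  have [[?] ? ?] := IH1 _ _ _ ltac:(eassumption); subst.
  by have [? ? ?] := IH2 _ _ _ ltac:(eassumption); subst.
- move=> env e1 e2 v1 v2 w1 d1 w2 d2 _ IH1 _ IH2 v' w' d' ev; inversion ev; subst.
  have [? ? ?] := IH1 _ _ _ ltac:(eassumption); subst.
  by have [? ? ?] := IH2 _ _ _ ltac:(eassumption); subst.
- move=> env e v1 v2 w d _ IH v' w' d' ev; inversion ev; subst.
  by have [[? ?] ? ?] := IH _ _ _ ltac:(eassumption); subst.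
- move=> env e v1 v2 w d _ IH v' w' d' ev; inversion ev; subst.
  by have [[? ?] ? ?] := IH _ _ _ ltac:(eassumption); subst.
- move=> env e b k v w d ws ds _ IH1 _ IH2 v' w' d' ev; inversion ev; subst.
  have [[?] ? ?] := IH1 _ _ _ ltac:(eassumption); subst.
  match goal with H : forall i, _ -> eval_wd _ _ _ _ _ _ |- _ =>
    have E i (ik : (i < _)%N) := IH2 i ik _ _ _ (H i ik) end.
  split.
  + by congr VVec; apply/eq_in_map => i; rewrite mem_iota => /E[].
  + by congr (_ + _).+1; apply: eq_bigr => i _; have [] := E i (ltn_ord i).
  + by congr (_ + _).+1; apply: eq_bigr => i _; have [] := E i (ltn_ord i).
- move=> env e s w d _ IH _ v' w' d' ev; inversion ev; subst.
  by have [[?] ? ?] := IH _ _ _ ltac:(eassumption); subst.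
- move=> env e1 e2 s i v w1 d1 w2 d2 _ IH1 _ IH2 sv v' w' d' ev; inversion ev; subst.
  have [[?] ? ?] := IH1 _ _ _ ltac:(eassumption); subst.
  have [[?] ? ?] := IH2 _ _ _ ltac:(eassumption); subst.
  by split; congruence.
- move=> env c b u w d _ IH v' w' d' ev; inversion ev; subst.
  + by have [? ? ?] := IH _ _ _ ltac:(eassumption); subst.
  + by have [[?] ? ?] := IH _ _ _ ltac:(eassumption); subst.
- move=> env c b u u' v x w1 d1 w2 d2 w3 d3 _ IH1 x0 _ IH2 _ IH3 v' w' d' ev.
  inversion ev; subst.
  + by have [[?] ? ?] := IH1 _ _ _ ltac:(eassumption); subst.
  + have [? ? ?] := IH1 _ _ _ ltac:(eassumption); subst.
    have [? ? ?] := IH2 _ _ _ ltac:(eassumption); subst.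
    by have [? ? ?] := IH3 _ _ _ ltac:(eassumption); subst.
Qed.

(** * Inputs and outputs *)

Definition nnz (R : realType) (m n : nat) (A : 'M[R]_(m, n)) : nat :=
  #|[set ij : 'I_m * 'I_n | A ij.1 ij.2 != 0]|.

Definition lists_support (R : realType) (m n : nat) (A : 'M[R]_(m, n))
    (s : seq ('I_m * 'I_n)) : Prop :=
  uniq s /\ (forall ij, (ij \in s) = (A ij.1 ij.2 != 0)).

(* Sparse coordinate format: the triples (i, (j, a_ij)), in the order of s. *)
Definition encode_matrix (R : realType) (m n : nat) (A : 'M[R]_(m, n))
    (s : seq ('I_m * 'I_n)) : value R :=
  VVec [seq VPair (VWord (ij.1 : nat))
                  (VPair (VWord (ij.2 : nat)) (VReal (A ij.1 ij.2)))
       | ij : 'I_m * 'I_n <- s].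

Definition encode_reals (R : realType) (n : nat) (p : 'rV[R]_n) : value R :=
  VVec [seq VReal (p 0 j) | j <- enum 'I_n].

Definition encode_bits (R : realType) (n : nat) (q : 'rV[bool]_n) : value R :=
  VVec [seq VWord (q ord0 j : nat) | j <- enum 'I_n].

Definition encode_input (R : realType) (m n : nat) (A : 'M[R]_(m, n))
    (s : seq ('I_m * 'I_n)) (p : 'rV[R]_n) : seq (value R) :=
  [:: VWord m; VWord n; encode_matrix A s; encode_reals p].

(* Words of c log2(mn + 1) bits. *)
Definition word_bound (c m n : nat) : nat := ((m * n).+1 ^ c)%N.

(* The factor log m of the error bound.  At m = 1 the literal bound would vanish,
   and no q can match it (A = (1), p = (1/2)); log 2 is used there instead. *)
Definition log_rows (R : realType) (m : nat) : R := ln (maxn m 2)%:R.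

(* Main.v *)
(* The vector [p] is rounded one binary digit at a time, from the last of its first
   K = O(log n) digits to the first.  A digit is removed by moving the coordinates with an odd
   last digit up or down by one unit: if row i has total mass s_i on these coordinates, signs
   for which row i moves by O(l + sqrt (s_i l)), l = O(log m), suffice, because the
   contributions of the digits add up as a geometric series.

   For the signs, the exponential potential \prod_j (1 + lam_i b_ij) ^ (+-1) is derandomized
   along a binary tree over the columns.  A node with factor X contributes cosh (ln X) to the
   mean of the potential, and merging X and Y with relative sign y multiplies the product of
   their two contributions by 1 + y tanh (ln X) tanh (ln Y).  At each level the relative signs
   of all pairs are found simultaneously by a walk in [-1, 1] with steps 1 / (4 l), which
   starts at 0 and stops at the ends.  The directions of a step are determined bit by bit
   (bit k of the index of the pair contributes a sign), so that the second moment of the drift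
   is at most that of independent directions; a final global sign controls the first moment.
   The walk takes a polylogarithmic number of steps.

   With the entries sorted by row and column, the entries of a node form a segment, and their
   sum or product is a difference or a quotient of two prefix values. *)

(* Giving all pairs of a level their final signs at once could move the logarithm of a row potential
   by an amount of order l, a range in which [1 + Z + Z^2] does not majorize [exp Z]. With steps 1 /
   (4 l) the drift [Z] of a row is at most 1/3; then the quadratic does majorize, and control of two
   moments of the directions is enough. The second-order cost of a step is paid by the slack in
   [ln (1 + x) <= x - x^2 / 8]. To make the variance small against this slack, the potential is
   tracked through weights whose 18th powers bound it up to a fixed factor.

   Pairs of a row and a node can number m n, beyond the allowed work, so node quantities are carried
   by entries: a product of sibling sums by the entries of the left sibling, a node value by the
   first entry of its segment.

   The language has no exponential, logarithm or square root: factors [1 + lam b] replace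
   exponentials, cosh and tanh of a logarithm are rational functions, and the scale [lam] is found
   by halving. *)
Require Import Defs.
From mathcomp Require Import all_boot all_order all_algebra.
From mathcomp Require Import all_reals all_analysis.
From mathcomp Require Import zify ring lra.

Set Implicit Arguments.
Unset Strict Implicit.
Unset Printing Implicit Defensive.

Import Order.TTheory GRing.Theory Num.Theory.

(* Terms with variables named by level: the argument is the size of the environment in
   which the term is placed, and level [l] is the [l]-th binding counted from the bottom
   of the environment, so that names survive the addition of binders. *)
Definition lterm := nat -> term.

Definition cvar (l : nat) : lterm := fun d => Var (d - l.+1).
Definition clet (e : lterm) (f : nat -> lterm) : lterm := fun d => Let (e d) (f d d.+1).
Definition cword k : lterm := fun _ => Word k.
Definition cwop o (e1 e2 : lterm) : lterm := fun d => WordOp o (e1 d) (e2 d).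
Definition creal (e : lterm) : lterm := fun d => ToReal (e d).
Definition crop o (e1 e2 : lterm) : lterm := fun d => RealOp o (e1 d) (e2 d).
Definition crle (e1 e2 : lterm) : lterm := fun d => RealLe (e1 d) (e2 d).
Definition cif (c e1 e2 : lterm) : lterm := fun d => If (c d) (e1 d) (e2 d).
Definition cpair (e1 e2 : lterm) : lterm := fun d => Pair (e1 d) (e2 d).
Definition cfst (e : lterm) : lterm := fun d => Fst (e d).
Definition csnd (e : lterm) : lterm := fun d => Snd (e d).
Definition ctab (e : lterm) (f : nat -> lterm) : lterm := fun d => Tab (e d) (f d d.+1).
Definition clen (e : lterm) : lterm := fun d => Len (e d).
Definition cget (e1 e2 : lterm) : lterm := fun d => Get (e1 d) (e2 d).
(** Level [d] is the pair of counter and state; [body] receives the levels [d.+1] of the counter and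
    [d.+2] of the state. The bound [c] is evaluated again at each test. *)
Definition cfor (c init : lterm) (body : nat -> nat -> lterm) : lterm := fun d =>
  Let (Pair (Word 0) (init d))
    (Snd (While (WordOp WLe (WordOp WAdd (Fst (Var 0)) (Word 1)) (c d.+1))
       (Let (Fst (Var 0)) (Let (Snd (Var 1))
          (Pair (WordOp WAdd (Var 1) (Word 1)) (body d.+1 d.+2 d.+3)))))).

(** * Cost judgement: values together with width and depth *)

Section Judgement.
Variables (R : realType) (W : nat).
Implicit Types (E : seq (value R)) (v : value R) (t : lterm).

Definition lookup E l v := (l < size E)%N /\ onth E (size E - l.+1) = Some v.

Definition extends E E' := exists D, E' = D ++ E.

Lemma extends_refl E : extends E E. Proof. by exists [::]. Qed.

Lemma extends_cons E E' u : extends E E' -> extends E (u :: E').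
Proof. by case=> D ->; exists (u :: D). Qed.

Lemma extends_trans E1 E2 E3 : extends E1 E2 -> extends E2 E3 -> extends E1 E3.
Proof. by case=> D -> [D' ->]; exists (D' ++ D); rewrite catA. Qed.

Lemma lookup_ext E E' l v : extends E E' -> lookup E l v -> lookup E' l v.
Proof.
case=> D -> [lE EE]; split; first by rewrite size_cat ltn_addl.
by rewrite size_cat -addnBA // onth_cat ltnNge leq_addr addKn.
Qed.

Lemma lookup_top E v : lookup (v :: E) (size E) v.
Proof. by split => //=; rewrite subnn. Qed.

Definition runs s E t v q := exists w d,
  [/\ eval_wd W E (t (size E)) v w d, (w <= s.+1 * q)%N & (d <= q)%N].

(* [s.+1] is the width of the computation: [q] bounds the depth and [s.+1 * q] the work.
   The quantification over extensions lets the judgement be used under further binders. *)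
Definition evals s E t v q := forall E', extends E E' -> runs s E' t v q.

(** For results of which only a specification is tracked, such as chosen signs or a sorting
    permutation. *)
Definition evalsP s E t (Q : value R -> Prop) q :=
  forall E', extends E E' -> exists2 v, Q v & runs s E' t v q.

Lemma ev_ext s E E' t v q : extends E E' -> evals s E t v q -> evals s E' t v q.
Proof. by move=> EE H E2 E'E2; apply: H; apply: extends_trans E'E2. Qed.

Lemma ev_le s E t v q q' : evals s E t v q -> (q <= q')%N -> evals s E t v q'.
Proof.
move=> H qq E' /H[w [d [ev ws ds]]]; exists w, d; split => //.
  by rewrite (leq_trans ws)// leq_mul2l qq.
exact: leq_trans qq.
Qed.

Lemma ev_eq s E t v v' q q' :
  evals s E t v q -> v = v' -> (q <= q')%N -> evals s E t v' q'.
Proof. by move=> H <-; apply: ev_le. Qed.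

Lemma ev_scale s E t v q : evals 0 E t v q -> evals s E t v q.
Proof.
move=> H E' /H[w [d [ev ws ds]]]; exists w, d; split => //.
by rewrite (leq_trans ws)// mul1n leq_pmull.
Qed.

Section Rules.
Variable s : nat.

Ltac size_tac := first [by [] | lia | nia].

Lemma ev_var E l v : lookup E l v -> evals s E (cvar l) v 1.
Proof.
move=> h E' /lookup_ext /(_ h)[_ H]; exists 1, 1; split => //.
exact: EvVar.
Qed.

Lemma ev_word E k : (k <= W)%N -> evals s E (cword k) (VWord k) 1.
Proof.
move=> h E' _; exists 1, 1; split => //.
exact: EvWord.
Qed.

Lemma ev_let E e f u v q1 q2 : evals s E e u q1 ->
  (forall E1 l, extends E E1 -> lookup E1 l u -> evals s E1 (f l) v q2) ->
  evals s E (clet e f) v (q1 + q2).+1.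
Proof.
move=> H1 H2 E' EE'; have [w1 [d1 [e1 ws1 ds1]]] := H1 _ EE'.
have [w2 [d2 [e2 ws2 ds2]]] := H2 (u :: E') (size E') (extends_cons u EE') (lookup_top _ _) _ (extends_refl _).
exists (w1 + w2).+1, (d1 + d2).+1; split; try by size_tac.
exact: EvLet e1 e2.
Qed.

Lemma ev_wop E o e1 e2 x y q1 q2 : evals s E e1 (VWord x) q1 -> evals s E e2 (VWord y) q2 ->
  (word_op_sem o x y <= W)%N ->
  evals s E (cwop o e1 e2) (VWord (word_op_sem o x y)) (q1 + q2).+1.
Proof.
move=> H1 H2 h E' EE'; have [w1 [d1 [? ? ?]]] := H1 _ EE'.
have [w2 [d2 [? ? ?]]] := H2 _ EE'.
exists (w1 + w2).+1, (d1 + d2).+1; split; try by size_tac.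
exact: EvWordOp.
Qed.

Lemma ev_real E e x q : evals s E e (VWord x) q -> evals s E (creal e) (VReal x%:R) q.+1.
Proof.
move=> H1 E' EE'; have [w1 [d1 [? ? ?]]] := H1 _ EE'.
exists w1.+1, d1.+1; split; try by size_tac.
exact: EvToReal.
Qed.

Lemma ev_rop E o e1 e2 x y q1 q2 : evals s E e1 (VReal x) q1 -> evals s E e2 (VReal y) q2 ->
  evals s E (crop o e1 e2) (VReal (real_op_sem o x y)) (q1 + q2).+1.
Proof.
move=> H1 H2 E' EE'; have [w1 [d1 [? ? ?]]] := H1 _ EE'.
have [w2 [d2 [? ? ?]]] := H2 _ EE'.
exists (w1 + w2).+1, (d1 + d2).+1; split; try by size_tac.
exact: EvRealOp.
Qed.

Lemma ev_rle E e1 e2 x y q1 q2 : evals s E e1 (VReal x) q1 -> evals s E e2 (VReal y) q2 ->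
  evals s E (crle e1 e2) (VWord (x <= y)%R) (q1 + q2).+1.
Proof.
move=> H1 H2 E' EE'; have [w1 [d1 [? ? ?]]] := H1 _ EE'.
have [w2 [d2 [? ? ?]]] := H2 _ EE'.
exists (w1 + w2).+1, (d1 + d2).+1; split; try by size_tac.
exact: EvRealLe.
Qed.

(* Both branches are charged, so that the bound does not depend on the test. *)
Lemma ev_if E c e1 e2 (b : bool) v1 v2 q q1 q2 : evals s E c (VWord b) q ->
  (b -> evals s E e1 v1 q1) -> (~~ b -> evals s E e2 v2 q2) ->
  evals s E (cif c e1 e2) (if b then v1 else v2) (q + q1 + q2).+1.
Proof.
move=> H H1 H2 E' EE'; have [w [d [? ? ?]]] := H _ EE'.
destruct b.
  have [w1 [d1 [? ? ?]]] := H1 isT _ EE'.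
  exists (w + w1).+1, (d + d1).+1; split; try by size_tac.
  by apply: (EvIf (x := 1)); eassumption.
have [w1 [d1 [? ? ?]]] := H2 isT _ EE'.
exists (w + w1).+1, (d + d1).+1; split; try by size_tac.
by apply: (EvIf (x := 0)); eassumption.
Qed.

Lemma ev_ifR E c e1 e2 (b : bool) x1 x2 q q1 q2 : evals s E c (VWord b) q ->
  (b -> evals s E e1 (VReal x1) q1) -> (~~ b -> evals s E e2 (VReal x2) q2) ->
  evals s E (cif c e1 e2) (VReal (if b then x1 else x2)) (q + q1 + q2).+1.
Proof. by move=> H H1 H2; apply: ev_eq (ev_if H H1 H2) _ _ => //; case: b {H H1 H2}. Qed.

Lemma ev_ifW E c e1 e2 (b : bool) x1 x2 q q1 q2 : evals s E c (VWord b) q ->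
  (b -> evals s E e1 (VWord x1) q1) -> (~~ b -> evals s E e2 (VWord x2) q2) ->
  evals s E (cif c e1 e2) (VWord (if b then x1 else x2)) (q + q1 + q2).+1.
Proof. by move=> H H1 H2; apply: ev_eq (ev_if H H1 H2) _ _ => //; case: b {H H1 H2}. Qed.

Lemma ev_pair E e1 e2 v1 v2 q1 q2 : evals s E e1 v1 q1 -> evals s E e2 v2 q2 ->
  evals s E (cpair e1 e2) (VPair v1 v2) (q1 + q2).+1.
Proof.
move=> H1 H2 E' EE'; have [w1 [d1 [? ? ?]]] := H1 _ EE'.
have [w2 [d2 [? ? ?]]] := H2 _ EE'.
exists (w1 + w2).+1, (d1 + d2).+1; split; try by size_tac.
exact: EvPair.
Qed.

Lemma ev_fst E e v1 v2 q : evals s E e (VPair v1 v2) q -> evals s E (cfst e) v1 q.+1.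
Proof.
move=> H1 E' EE'; have [w1 [d1 [? ? ?]]] := H1 _ EE'.
exists w1.+1, d1.+1; split; try by size_tac.
by apply: EvFst; eassumption.
Qed.

Lemma ev_snd E e v1 v2 q : evals s E e (VPair v1 v2) q -> evals s E (csnd e) v2 q.+1.
Proof.
move=> H1 E' EE'; have [w1 [d1 [? ? ?]]] := H1 _ EE'.
exists w1.+1, d1.+1; split; try by size_tac.
by apply: EvSnd; eassumption.
Qed.

Lemma ev_len E e vs q : evals s E e (VVec vs) q -> (size vs <= W)%N ->
  evals s E (clen e) (VWord (size vs)) q.+1.
Proof.
move=> H1 h E' EE'; have [w1 [d1 [? ? ?]]] := H1 _ EE'.
exists w1.+1, d1.+1; split; try by size_tac.
exact: EvLen.
Qed.

Lemma ev_get E e1 e2 k (f : nat -> value R) i q1 q2 :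
  evals s E e1 (VVec (mkseq f k)) q1 -> evals s E e2 (VWord i) q2 -> (i < k)%N ->
  evals s E (cget e1 e2) (f i) (q1 + q2).+1.
Proof.
move=> H1 H2 h E' EE'; have [w1 [d1 [? ? ?]]] := H1 _ EE'.
have [w2 [d2 [? ? ?]]] := H2 _ EE'.
exists (w1 + w2).+1, (d1 + d2).+1; split; try by size_tac.
apply: EvGet; [eassumption..|].
by rewrite onthE (nth_map (f 0)) ?size_mkseq// nth_mkseq.
Qed.

(** The body is costed at width 1: at most [s.+1] branches of work [q2] fit into the work
    [s.+1 * q2]. *)
Lemma ev_tab E e f k (g : nat -> value R) q1 q2 : evals s E e (VWord k) q1 ->
  (k <= s.+1)%N ->
  (forall i E1 l, (i < k)%N -> extends E E1 -> lookup E1 l (VWord i) ->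
     evals 0 E1 (f l) (g i) q2) ->
  evals s E (ctab e f) (VVec (mkseq g k)) (q1 + q2).+1.
Proof.
move=> H1 ks H2 E' EE'; have [w1 [d1 [e1 ws1 ds1]]] := H1 _ EE'.
(* The rule for [Tab] takes work and depth as functions of the index; they are obtained by choice
   from the existential judgements of the branches. *)
have H i : exists wd : nat * nat, (i < k)%N ->
    [/\ eval_wd W (VWord i :: E') (f (size E') (size E').+1) (g i) wd.1 wd.2,
        (wd.1 <= q2)%N & (wd.2 <= q2)%N].
  case: (boolP (i < k)%N) => ik; last by exists (0, 0).
  have [w2 [d2 [e2 ws2 ds2]]] :=
    H2 i (VWord i :: E') (size E') ik (extends_cons _ EE') (lookup_top _ _) _ (extends_refl _).
  by exists (w2, d2); rewrite mul1n in ws2.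
pose wd i := projT1 (boolp.cid (H i)).
have Hwd i : (i < k)%N ->
    [/\ eval_wd W (VWord i :: E') (f (size E') (size E').+1) (g i) (wd i).1 (wd i).2,
        ((wd i).1 <= q2)%N & ((wd i).2 <= q2)%N] := projT2 (boolp.cid (H i)).
exists (w1 + \sum_(i < k) (wd i).1).+1, (d1 + \max_(i < k) (wd i).2).+1; split.
- apply: (EvTab (v := g) (ws := fun i => (wd i).1) (ds := fun i => (wd i).2) e1) => i ik.
  by case: (Hwd i ik).
- have : (\sum_(i < k) (wd i).1 <= \sum_(i < k) q2)%N.
    by apply: leq_sum => i _; case: (Hwd i (ltn_ord i)).
  rewrite sum_nat_const card_ord; size_tac.
- rewrite ltnS leq_add//; apply/bigmax_leqP => i _.
  by case: (Hwd i (ltn_ord i)).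
Qed.

Lemma ev_evP E t v (Q : value R -> Prop) q : evals s E t v q -> Q v -> evalsP s E t Q q.
Proof. by move=> H Qv E' /H; exists v. Qed.

Lemma evP_le E t (Q Q' : value R -> Prop) q q' :
  evalsP s E t Q q -> (forall v, Q v -> Q' v) -> (q <= q')%N -> evalsP s E t Q' q'.
Proof.
move=> H QQ qq E' /H[v Qv [w [d [ev ws ds]]]]; exists v; first exact: QQ.
by exists w, d; split => //; nia.
Qed.

Lemma evP_cost E t (Q : value R -> Prop) q q' :
  evalsP s E t Q q -> (q <= q')%N -> evalsP s E t Q q'.
Proof. by move=> H; apply: evP_le H _. Qed.

Lemma evP_let E e f (P Q : value R -> Prop) q1 q2 : evalsP s E e P q1 ->
  (forall u E1 l, P u -> extends E E1 -> lookup E1 l u -> evalsP s E1 (f l) Q q2) ->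
  evalsP s E (clet e f) Q (q1 + q2).+1.
Proof.
move=> H1 H2 E' EE'; have [u Pu [w1 [d1 [e1 ws1 ds1]]]] := H1 _ EE'.
have [v Qv [w2 [d2 [e2 ws2 ds2]]]] :=
  H2 u (u :: E') (size E') Pu (extends_cons u EE') (lookup_top _ _) _ (extends_refl _).
exists v => //; exists (w1 + w2).+1, (d1 + d2).+1; split; try by size_tac.
exact: EvLet e1 e2.
Qed.

Lemma ev_evP_let E e f u (Q : value R -> Prop) q1 q2 : evals s E e u q1 ->
  (forall E1 l, extends E E1 -> lookup E1 l u -> evalsP s E1 (f l) Q q2) ->
  evalsP s E (clet e f) Q (q1 + q2).+1.
Proof.
move=> H1 H2; apply: (evP_let (P := eq u)); first exact: ev_evP H1 _.
by move=> _ E1 l <-; apply: H2.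
Qed.

(** Induction on the number of remaining rounds. The test computes [i + 1] also at [i = k], hence
    [k < W]. *)
Lemma evP_for E c init body k (Inv : nat -> value R -> Prop) qc qi qb :
  evals s E c (VWord k) qc -> evalsP s E init (Inv 0) qi -> (k < W)%N ->
  (forall i u E1 li lu, (i < k)%N -> Inv i u -> extends E E1 ->
     lookup E1 li (VWord i) -> lookup E1 lu u ->
     evalsP s E1 (body li lu) (Inv i.+1) qb) ->
  evalsP s E (cfor c init body) (Inv k) (qi + qc + 20 + k * (qb + qc + 20)).
Proof.
move=> Hc Hi kW Hb E' EE'.
pose whl d := (While (WordOp WLe (WordOp WAdd (Fst (Var 0)) (Word 1)) (c d.+1))
       (Let (Fst (Var 0)) (Let (Snd (Var 1))
          (Pair (WordOp WAdd (Var 1) (Word 1)) (body d.+1 d.+2 d.+3))))).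
suff key n i u : (i + n = k)%N -> Inv i u -> exists2 u', Inv k u' & exists w d,
      [/\ eval_wd W (VPair (VWord i) u :: E') (whl (size E')) (VPair (VWord k) u') w d,
          (w <= s.+1 * (qc + 8 + n * (qb + qc + 20)))%N & (d <= qc + 8 + n * (qb + qc + 20))%N].
  have [v Iv [w1 [d1 [ei ws1 ds1]]]] := Hi _ EE'.
  have [u' Iu' [w [d [ew ws ds]]]] := key k 0 v (add0n k) Iv; exists u' => //.
  exists ((1 + w1).+1 + w.+1).+1, ((1 + d1).+1 + d.+1).+1; split; try size_tac.
  apply: EvLet; first exact: EvPair (EvWord _ (leq0n _)) ei.
  exact: EvSnd ew.
move: n i u.
have evc i u : exists w1 d1,
    [/\ eval_wd W (VPair (VWord i) u :: E') (c (size E').+1) (VWord k) w1 d1, (w1 <= s.+1 * qc)%N & (d1 <= qc)%N].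
  exact: (Hc _ (extends_cons (VPair (VWord i) u) EE')).
have ev1 i u w1 d1 : (i <= k)%N -> eval_wd W (VPair (VWord i) u :: E') (c (size E').+1) (VWord k) w1 d1 ->
    eval_wd W (VPair (VWord i) u :: E')
      (WordOp WLe (WordOp WAdd (Fst (Var 0)) (Word 1)) (c (size E').+1))
      (VWord (word_op_sem WLe (i + 1) k)) ((2 + 1).+1 + w1).+1 ((2 + 1).+1 + d1).+1.
  move=> ik ec; apply: EvWordOp ec _; last by rewrite /=; case: leqP => //; lia.
  apply: (@EvWordOp _ _ _ WAdd _ _ i 1); last by rewrite /=; lia.
    by apply: EvFst; apply: EvVar.
  by apply: EvWord; lia.
elim=> [i u ink Iu|n IH i u ink Iu].
  have ik : i = k by lia.
  exists u; first by rewrite -ik.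
  have [w1 [d1 [ec ws1 ds1]]] := evc i u.
  exists ((2 + 1).+1 + w1).+2, ((2 + 1).+1 + d1).+2; split; try size_tac.
  have {ec} := ev1 _ _ _ _ _ ec; rewrite ik => /(_ (leqnn _)) /=.
  by rewrite addn1 ltnn => H; apply: EvWhileStop.
have ik : (i < k)%N by lia.
have [|||u1 Iu1 [w2 [d2 [eb ws2 ds2]]]] :=
  Hb i u (u :: VWord i :: VPair (VWord i) u :: E') (size E').+1 (size E').+2 ik Iu _ _ _ _ (extends_refl _).
- by case: EE' => D ->; exists [:: u, VWord i, VPair (VWord i) u & D].
- exact: (lookup_ext (extends_cons _ (extends_refl _)) (lookup_top _ _)).
- exact: lookup_top.
have [|v' Iv' [w3 [d3 [ew ws3 ds3]]]] := IH i.+1 u1 _ Iu1; first by lia.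
exists v' => //.
have [w1 [d1 [ec ws1 ds1]]] := evc i u.
exists (((2 + 1).+1 + w1).+1 + (2 + (2 + ((1 + 1).+1 + w2).+1).+1).+1 + w3).+1,
       (((2 + 1).+1 + d1).+1 + (2 + (2 + ((1 + 1).+1 + d2).+1).+1).+1 + d3).+1.
split; try size_tac.
apply: EvWhileStep (ev1 _ _ _ _ (ltnW ik) ec) _ _ ew; first by rewrite /= addn1 ik.
apply: EvLet; first by apply: EvFst; apply: EvVar.
apply: EvLet; first by apply: EvSnd; apply: EvVar.
apply: EvPair eb; have -> : i.+1 = word_op_sem WAdd i 1 by rewrite /= addn1.
by apply: (@EvWordOp _ _ _ WAdd _ _ i 1); [apply: EvVar | apply: EvWord; lia | rewrite /=; lia].
Qed.

End Rules.
End Judgement.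

(** Copies of [cif] and [cget] that record the type of the result, so that [jstep] finds the
    evaluation rule from the head symbol. *)
Definition cifR := cif.
Definition cifW := cif.
Definition cgetR := cget.
Definition cgetW := cget.
Definition ceq (a b : lterm) := cwop WMul (cwop WLe a b) (cwop WLe b a).
Definition cbit (a b : lterm) := cwop WMod (cwop WDiv a b) (cword 2).

Notation cadd := (cwop WAdd).
Notation csub := (cwop WSub).
Notation cmul := (cwop WMul).
Notation cdiv := (cwop WDiv).
Notation cmod := (cwop WMod).
Notation cle := (cwop WLe).
Notation radd := (crop RAdd).
Notation rsub := (crop RSub).
Notation rmul := (crop RMul).
Notation rdiv := (crop RDiv).
Notation rnat k := (creal (cword k)).

Notation arr f n := (VVec (mkseq f n)).
Notation arrR f n := (VVec (mkseq (fun i => VReal (f i)) n)).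
Notation arrW f n := (VVec (mkseq (fun i => VWord (f i)) n)).

Section Derived.
Variables (R : realType) (W : nat) (s : nat).
Implicit Types (E : seq (value R)).

Lemma ev_add E e1 e2 x y q1 q2 : evals W s E e1 (VWord x) q1 ->
  evals W s E e2 (VWord y) q2 -> (x + y <= W)%N ->
  evals W s E (cadd e1 e2) (VWord (x + y)) (q1 + q2).+1.
Proof. by move=> H1 H2 H; exact: (ev_wop (o := WAdd) H1 H2 H). Qed.

Lemma ev_sub E e1 e2 x y q1 q2 : evals W s E e1 (VWord x) q1 ->
  evals W s E e2 (VWord y) q2 -> (x - y <= W)%N ->
  evals W s E (csub e1 e2) (VWord (x - y)) (q1 + q2).+1.
Proof. by move=> H1 H2 H; exact: (ev_wop (o := WSub) H1 H2 H). Qed.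

Lemma ev_mul E e1 e2 x y q1 q2 : evals W s E e1 (VWord x) q1 ->
  evals W s E e2 (VWord y) q2 -> (x * y <= W)%N ->
  evals W s E (cmul e1 e2) (VWord (x * y)) (q1 + q2).+1.
Proof. by move=> H1 H2 H; exact: (ev_wop (o := WMul) H1 H2 H). Qed.

Lemma ev_div E e1 e2 x y q1 q2 : evals W s E e1 (VWord x) q1 ->
  evals W s E e2 (VWord y) q2 -> (x %/ y <= W)%N ->
  evals W s E (cdiv e1 e2) (VWord (x %/ y)) (q1 + q2).+1.
Proof. by move=> H1 H2 H; exact: (ev_wop (o := WDiv) H1 H2 H). Qed.

Lemma ev_mod E e1 e2 x y q1 q2 : evals W s E e1 (VWord x) q1 ->
  evals W s E e2 (VWord y) q2 -> (x %% y <= W)%N ->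
  evals W s E (cmod e1 e2) (VWord (x %% y)) (q1 + q2).+1.
Proof. by move=> H1 H2 H; exact: (ev_wop (o := WMod) H1 H2 H). Qed.

Lemma ev_wle E e1 e2 x y q1 q2 : evals W s E e1 (VWord x) q1 ->
  evals W s E e2 (VWord y) q2 -> (0 < W)%N ->
  evals W s E (cle e1 e2) (VWord (x <= y)%N) (q1 + q2).+1.
Proof. by move=> H1 H2 W0; apply: (ev_wop (o := WLe) H1 H2); rewrite /=; case: leqP; lia. Qed.

Lemma ev_radd E e1 e2 x y q1 q2 : evals W s E e1 (VReal x) q1 ->
  evals W s E e2 (VReal y) q2 ->
  evals W s E (radd e1 e2) (VReal (x + y)%R) (q1 + q2).+1.
Proof. by move=> H1 H2; exact: (@ev_rop _ _ _ _ RAdd _ _ _ _ _ _ H1 H2). Qed.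

Lemma ev_rsub E e1 e2 x y q1 q2 : evals W s E e1 (VReal x) q1 ->
  evals W s E e2 (VReal y) q2 ->
  evals W s E (rsub e1 e2) (VReal (x - y)%R) (q1 + q2).+1.
Proof. by move=> H1 H2; exact: (@ev_rop _ _ _ _ RSub _ _ _ _ _ _ H1 H2). Qed.

Lemma ev_rmul E e1 e2 x y q1 q2 : evals W s E e1 (VReal x) q1 ->
  evals W s E e2 (VReal y) q2 ->
  evals W s E (rmul e1 e2) (VReal (x * y)%R) (q1 + q2).+1.
Proof. by move=> H1 H2; exact: (@ev_rop _ _ _ _ RMul _ _ _ _ _ _ H1 H2). Qed.

Lemma ev_rdiv E e1 e2 x y q1 q2 : evals W s E e1 (VReal x) q1 ->
  evals W s E e2 (VReal y) q2 ->
  evals W s E (rdiv e1 e2) (VReal (x / y)%R) (q1 + q2).+1.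
Proof. by move=> H1 H2; exact: (@ev_rop _ _ _ _ RDiv _ _ _ _ _ _ H1 H2). Qed.

Lemma ev_getR E e1 e2 k (f : nat -> R) i q1 q2 :
  evals W s E e1 (arrR f k) q1 -> evals W s E e2 (VWord i) q2 -> (i < k)%N ->
  evals W s E (cgetR e1 e2) (VReal (f i)) (q1 + q2).+1.
Proof. exact: (@ev_get _ _ _ _ _ _ _ (fun i => VReal (f i))). Qed.

Lemma ev_getW E e1 e2 k f i q1 q2 :
  evals W s E e1 (arrW f k) q1 -> evals W s E e2 (VWord i) q2 -> (i < k)%N ->
  evals W s E (cgetW e1 e2) (VWord (f i)) (q1 + q2).+1.
Proof. exact: (@ev_get _ _ _ _ _ _ _ (fun i => VWord (f i))). Qed.

Lemma ev_ceq E e1 e2 x y q1 q2 : (0 < W)%N ->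
  evals W s E e1 (VWord x) q1 -> evals W s E e2 (VWord y) q2 ->
  evals W s E (ceq e1 e2) (VWord (x == y)) (2 * (q1 + q2) + 3).
Proof.
move=> W0 H1 H2.
have H3 := ev_mul (ev_wle H1 H2 W0) (ev_wle H2 H1 W0).
apply: (ev_eq (H3 _)); last by lia.
  by case: leqP; case: leqP; lia.
by congr VWord; case: eqP => [->|]; rewrite ?leqnn //; case: leqP; case: leqP; lia.
Qed.

Lemma ev_cbit E e1 e2 x y q1 q2 : (2 <= W)%N -> (x %/ y <= W)%N ->
  evals W s E e1 (VWord x) q1 -> evals W s E e2 (VWord y) q2 ->
  evals W s E (cbit e1 e2) (VWord (odd (x %/ y))) (q1 + q2 + 3).
Proof.
move=> W0 xy H1 H2.
have H3 := ev_mod (ev_div H1 H2 xy) (@ev_word _ _ s E _ W0).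
apply: (ev_eq (H3 _)); last by lia.
  by have := ltn_pmod (x %/ y) (isT : (0 < 2)%N); lia.
by congr VWord; rewrite modn2.
Qed.

Lemma evP_ev E t (P : value R -> Prop) v q : evalsP W s E t P q -> (forall u, P u -> u = v) -> evals W s E t v q.
Proof. by move=> H Pv E' /H[u /Pv ->]. Qed.

End Derived.

(** Each binder opens an extended environment; carrying all known lookups and evaluations over to it
    lets later goals be closed by assumption. *)
Ltac jlift h :=
  match type of h with extends ?E _ =>
    repeat match goal with
    | H : lookup E _ _ |- _ => apply (lookup_ext h) in H
    | H : evals _ _ E _ _ _ |- _ => apply (ev_ext h) in H
    end end.

Ltac jlookup :=
  match goal with H : lookup ?E ?l _ |- lookup ?E ?l _ => exact H end.
Ltac jcall := eassumption.

Ltac jstep :=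
  lazymatch goal with
  | |- evals _ _ _ (cvar _) _ _ => eapply ev_var; jlookup
  | |- evals _ _ _ (cword _) _ _ => eapply ev_word
  | |- evals _ _ _ (ceq _ _) _ _ => eapply ev_ceq
  | |- evals _ _ _ (cbit _ _) _ _ => eapply ev_cbit
  | |- evals _ _ _ (clet _ _) _ _ =>
      let h := fresh "hx" in eapply ev_let; [ | intros ? ? h ?; jlift h ]
  | |- evals _ _ _ (cadd _ _) _ _ => eapply ev_add
  | |- evals _ _ _ (csub _ _) _ _ => eapply ev_sub
  | |- evals _ _ _ (cmul _ _) _ _ => eapply ev_mul
  | |- evals _ _ _ (cdiv _ _) _ _ => eapply ev_div
  | |- evals _ _ _ (cmod _ _) _ _ => eapply ev_mod
  | |- evals _ _ _ (cle _ _) _ _ => eapply ev_wle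
  | |- evals _ _ _ (creal _) _ _ => eapply ev_real
  | |- evals _ _ _ (radd _ _) _ _ => eapply ev_radd
  | |- evals _ _ _ (rsub _ _) _ _ => eapply ev_rsub
  | |- evals _ _ _ (rmul _ _) _ _ => eapply ev_rmul
  | |- evals _ _ _ (rdiv _ _) _ _ => eapply ev_rdiv
  | |- evals _ _ _ (crle _ _) _ _ => eapply ev_rle
  | |- evals _ _ _ (cifR _ _ _) _ _ => eapply ev_ifR; [ | intros ? | intros ? ]
  | |- evals _ _ _ (cifW _ _ _) _ _ => eapply ev_ifW; [ | intros ? | intros ? ]
  | |- evals _ _ _ (cif _ _ _) _ _ => eapply ev_if; [ | intros ? | intros ? ]
  | |- evals _ _ _ (cpair _ _) _ _ => eapply ev_pair
  | |- evals _ _ _ (cfst _) _ _ => eapply ev_fst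
  | |- evals _ _ _ (csnd _) _ _ => eapply ev_snd
  | |- evals _ _ _ (cget _ _) _ _ => eapply ev_get
  | |- evals _ _ _ (cgetR _ _) _ _ => eapply ev_getR
  | |- evals _ _ _ (cgetW _ _) _ _ => eapply ev_getW
  | |- evals _ _ _ (ctab _ _) _ _ =>
      let h := fresh "hx" in eapply ev_tab; [ | | intros ? ? ? ? h ?; jlift h ]
  | |- evals _ _ _ _ _ _ => jcall
  end.

Ltac jside :=
  lazymatch goal with
  | |- is_true ?G => tryif has_evar G then fail else solve [by [] | lia]
  end.

Ltac jauto := repeat jstep; try jside.
Ltac jrun := eapply ev_eq; [jauto | | ].

(** * Generic subroutines *)

(** Determines the number of indices that pass a monotone test bit by bit, from the highest bit
    down. The guard against [z] keeps the test within the array. *)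
Definition cbsearch (lz lpw llg : nat) (test : nat -> lterm) : lterm :=
  clet (cfor (cvar llg) (cpair (cvar lpw) (cword 0)) (fun _ st =>
    clet (cdiv (cfst (cvar st)) (cword 2)) (fun d =>
    clet (cadd (csnd (cvar st)) (cvar d)) (fun e =>
    cpair (cvar d)
      (cifW (cle (cvar e) (cvar lz))
         (clet (csub (cvar e) (cword 1)) (fun i =>
           cifW (test i) (cvar e) (csnd (cvar st))))
         (csnd (cvar st)))))))
    (fun r => csnd (cvar r)).

Lemma ev_bsearch (R : realType) W (E : seq (value R)) lz lpw llg lg z cnt test qt :
  lookup E lz (VWord z) -> lookup E lpw (VWord (2 ^ lg)) -> lookup E llg (VWord lg) ->
  (z < 2 ^ lg)%N -> (2 ^ lg * 2 <= W)%N -> (cnt <= z)%N ->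
  (forall i E1 l, (i < z)%N -> extends E E1 -> lookup E1 l (VWord i) ->
     evals W 0 E1 (test l) (VWord (i < cnt)%N) qt) ->
  evals W 0 E (cbsearch lz lpw llg test) (VWord cnt) (40 + lg * (qt + 60)).
Proof.
move=> hz hpw hlg zlg lgW cz Ht.
have p0 : (0 < 2 ^ lg)%N by rewrite expn_gt0.
have lgl : (lg < 2 ^ lg)%N by exact: ltn_expl.
apply: (ev_le (q := (1 + (1 + 1 + 1) + 20 + lg * ((qt + 30) + 1 + 20)) + (1 + 1).+1 + 1)); last by lia.
rewrite addn1; apply: (ev_let (u := VPair (VWord 1) (VWord cnt))).
  pose Inv i (v : value R) := exists pos, v = VPair (VWord (2 ^ (lg - i))) (VWord pos) /\
             (pos <= cnt < pos + 2 ^ (lg - i))%N.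
  apply: (evP_ev (P := Inv lg)); last first.
    by move=> u [pos [-> H]]; rewrite subnn expn0 in H *; congr (VPair _ (VWord _)); lia.
  apply: evP_le; first apply: (evP_for (Inv := Inv) (qc := 1) (qi := 3) (qb := qt + 30)).
  - by jauto.
  - apply: ev_evP; last by exists 0; rewrite subn0; split => //; lia.
    by jrun.
  - by lia.
  - move=> i u E1 li lu ik [pos [-> Hpos]] hx hi hu; jlift hx.
    have Ht' i0 E2 l (i0z : (i0 < z)%N) (h : extends E1 E2) (hh : lookup E2 l (VWord i0)) :=
      Ht i0 E2 l i0z (extends_trans hx h) hh.
    have e2 : 2 ^ (lg - i) = (2 ^ (lg - i.+1) * 2)%N by rewrite -expnSr subnSK.
    have l2 : (2 ^ (lg - i) <= 2 ^ lg)%N by rewrite leq_exp2l// leq_subr.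
    have d0 : (0 < 2 ^ (lg - i.+1))%N by rewrite expn_gt0.
    apply: ev_evP; last first.
      exists (if (pos + 2 ^ (lg - i.+1) <= z)%N then
                if (pos + 2 ^ (lg - i.+1) <= cnt)%N then (pos + 2 ^ (lg - i.+1))%N else pos else pos).
      split; first by reflexivity.
      by case: ifPn => H1; [case: ifPn|]; lia.
    jrun.
    all: try (rewrite ?e2 ?mulnK//; lia).
    + eapply ev_eq.
        by apply: Ht' H2; [lia | exact: extends_trans hx0 (extends_trans hx1 hx2)].
      + by congr VWord; congr nat_of_bool; rewrite e2 mulnK//; lia.
      + exact: leqnn.
    + by lia.
by move=> E1 l hx hl; jrun.
Qed.

(** Scan by doubling: after [k] rounds cell [i] combines the last [2 ^ k] cells up to [i], or all of
    them if there are fewer. This costs a logarithmic factor of work. *)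
Definition cscan (ln llg : nat) (op : nat -> nat -> lterm) (la : nat) : lterm :=
  clet (cfor (cvar llg) (cpair (cword 1) (cvar la)) (fun _ st =>
    clet (cfst (cvar st)) (fun d =>
    clet (csnd (cvar st)) (fun a =>
    cpair (cadd (cvar d) (cvar d))
      (ctab (cvar ln) (fun i =>
         cif (cle (cvar d) (cvar i))
           (clet (cget (cvar a) (csub (cvar i) (cvar d))) (fun x =>
            clet (cget (cvar a) (cvar i)) (fun y => op x y)))
           (cget (cvar a) (cvar i))))))))
    (fun r => csnd (cvar r)).

Lemma ev_scan (R : realType) (W s : nat) (T : Type) (idx : T) (opT : Monoid.law idx)
  (inj : T -> value R) (op : nat -> nat -> lterm)
  (E : seq (value R)) ln llg la n lg (f : nat -> T) qo :
  lookup E ln (VWord n) -> lookup E llg (VWord lg) ->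
  lookup E la (arr (fun i => inj (f i)) n) ->
  (n <= 2 ^ lg)%N -> (n <= s.+1)%N -> (2 ^ lg <= W)%N -> (n <= W)%N ->
  (forall i1 i2 i3 E1 l1 l2, (i1 <= i2 <= i3)%N -> (i3 <= n)%N -> extends E E1 ->
     lookup E1 l1 (inj (\big[opT/idx]_(i1 <= j < i2) f j)) ->
     lookup E1 l2 (inj (\big[opT/idx]_(i2 <= j < i3) f j)) ->
     evals W 0 E1 (op l1 l2) (inj (\big[opT/idx]_(i1 <= j < i3) f j)) qo) ->
  evals W s E (cscan ln llg op la)
    (arr (fun i => inj (\big[opT/idx]_(j < i.+1) f j)) n) (40 + lg * (qo + 80)).
Proof.
move=> hn hlg ha nlg ns lgW nW Hop.
have lgl : (lg < 2 ^ lg)%N by exact: ltn_expl.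
pose g k i := inj (\big[opT/idx]_(i.+1 - 2 ^ k <= j < i.+1) f j).
apply: (ev_le (q := (1 + (1 + 1 + 1) + 20 + lg * ((qo + 40) + 1 + 20)) + (1 + 1).+1 + 1)); last by lia.
rewrite addn1; apply: (ev_let (u := VPair (VWord (2 ^ lg)) (arr (g lg) n))).
  pose Inv i (v : value R) := v = VPair (VWord (2 ^ i)) (arr (g i) n).
  apply: (evP_ev (P := Inv lg)) => [|//].
  apply: evP_le; first apply: (evP_for (Inv := Inv) (qc := 1) (qi := 3) (qb := qo + 40)).
  - by jauto.
  - apply: (@ev_evP _ _ _ _ _ (VPair (VWord 1) (arr (fun i => inj (f i)) n))).
      by jrun; [lia..| |].
    rewrite /Inv /g; congr (VPair _ (VVec _)); apply: eq_mkseq => i.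
    by rewrite expn0 subn1 /= big_nat1.
  - by lia.
  - move=> i u E1 li lu ik -> hx hi hu; jlift hx.
    have l2 : (2 ^ i.+1 <= 2 ^ lg)%N by rewrite leq_exp2l.
    have e2 : (2 ^ i.+1 = 2 ^ i + 2 ^ i)%N by rewrite expnS mul2n addnn.
    have d0 : (0 < 2 ^ i)%N by rewrite expn_gt0.
    apply: (@ev_evP _ _ _ _ _ (VPair (VWord (2 ^ i.+1)) (arr (g i.+1) n))); last by [].
    rewrite e2.
    jrun.
    + apply: (Hop ((i0 - 2 ^ i).+1 - 2 ^ i)%N (i0 - 2 ^ i).+1 i0.+1) => //.
      * by lia.
      * exact: extends_trans hx (extends_trans hx0 (extends_trans hx1
          (extends_trans hx2 (extends_trans hx3 hx4)))).
      * by rewrite -subSn.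
    + congr (VPair _ (VVec _)); apply: eq_mkseq => i0; rewrite /g e2.
      case: ifPn => hi0.
        by congr (inj (\big[opT/idx]_(_ <= j < _) f j)); lia.
      have -> : (i0.+1 - 2 ^ i = 0)%N by lia.
      by have -> : (i0.+1 - (2 ^ i + 2 ^ i) = 0)%N by lia.
    + by lia.
  - by [].
  - by [].
move=> E1 l hx hl; jrun; last by [].
congr VVec; apply/eq_in_map => i; rewrite mem_iota /= /g add0n => ilt.
have -> : (i.+1 - 2 ^ lg = 0)%N by lia.
by rewrite big_mkord.
Qed.

Definition cpref (u : lterm) (ls li : nat) : lterm :=
  cif (cle (cvar li) (cword 0)) u (cget (cvar ls) (csub (cvar li) (cword 1))).

Lemma ev_pref (R : realType) (W : nat) (T : Type) (idx : T) (opT : Monoid.law idx)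
  (inj : T -> value R) u (E : seq (value R)) ls li n i (f : nat -> T) :
  (0 < W)%N -> (i <= n)%N -> (n <= W)%N ->
  lookup E ls (arr (fun i => inj (\big[opT/idx]_(j < i.+1) f j)) n) ->
  lookup E li (VWord i) ->
  evals W 0 E u (inj idx) 2 ->
  evals W 0 E (cpref u ls li) (inj (\big[opT/idx]_(j < i) f j)) 15.
Proof.
move=> W0 iln nW hs hi Hu; rewrite /cpref.
case: i iln hi => [|i] iln hi.
  by jrun; [rewrite big_ord0|].
jrun; [by rewrite subn1|by []].
Qed.

(** * Sorted keys *)

Section Keys.
Variables (z : nat) (key : nat -> nat).
Hypothesis key_mono : forall e e', (e < e' < z)%N -> (key e <= key e')%N.

Definition below x := (\sum_(e < z) (key e < x))%N.

Lemma below_le x : (below x <= z)%N.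
Proof.
rewrite -[leqRHS](card_ord z) -sum1_card; apply: leq_sum => e _; exact: leq_b1.
Qed.

Lemma below_lt x e : (e < z)%N -> (key e < x)%N = (e < below x)%N.
Proof.
move=> ez; rewrite /below -(big_mkord predT (fun i => (key i < x) : nat)).
case: ltnP => kx.
- rewrite (@big_cat_nat _ _ _ e.+1)//= (@eq_big_nat _ _ _ 0 e.+1 _ (fun=> 1)) => [|i /andP[_ ie]].
    by rewrite sum_nat_const_nat subn0 muln1; lia.
  have : (key i <= key e)%N by case: (ltngtP i e) => [ie'||->]//; [apply: key_mono|]; lia.
  by move=> kik; rewrite (leq_ltn_trans kik).
- rewrite (@big_cat_nat _ _ _ e)//=; last exact: ltnW.
  rewrite [X in (_ + X)%N]big1_seq ?addn0 => [|i].
    apply/esym/negbTE; rewrite -leqNgt -[leqRHS]subn0 -[leqRHS]muln1 -sum_nat_const_nat.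
    by apply: leq_sum => i _; exact: leq_b1.
  rewrite mem_index_iota => /andP[_ /andP[ei iz]]; apply/eqP; rewrite eqb0 -leqNgt (leq_trans kx)//.
  by case: (ltngtP i e) ei => [||->]// ei _; apply: key_mono; lia.
Qed.

Lemma below_mono x y : (x <= y)%N -> (below x <= below y)%N.
Proof.
by move=> xy; apply: leq_sum => e _; case: ltnP => //= kx; rewrite (leq_trans kx xy).
Qed.

Lemma big_segment (T : Type) (idx : T) (op : Monoid.com_law idx) (f : nat -> T) pw nu :
  (0 < pw)%N ->
  \big[op/idx]_(e < z | key e %/ pw == nu) f e =
  \big[op/idx]_(below (nu * pw) <= e < below (nu.+1 * pw)) f e.
Proof.
move=> p0; have lh : (below (nu * pw) <= below (nu.+1 * pw))%N.
  by apply: below_mono; rewrite leq_mul2r leqnSn orbT.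
rewrite -(big_mkord (fun e => key e %/ pw == nu)).
rewrite (@big_cat_nat _ _ _ (below (nu * pw)))//= ?below_le//.
rewrite (@big_cat_nat _ _ _ (below (nu.+1 * pw)) (below (nu * pw)))//= ?below_le//.
have E e : (e < z)%N -> (key e %/ pw == nu) = (below (nu * pw) <= e < below (nu.+1 * pw))%N.
  move=> ez; rewrite leqNgt -!below_lt// -leqNgt eqn_leq andbC leq_divRL//.
  by rewrite -[(_ %/ _ <= nu)%N]ltnS ltn_divLR.
have bz := below_le (nu.+1 * pw).
rewrite [X in op X _]big1_seq ?Monoid.mul1m => [|e]; last first.
  rewrite mem_index_iota => /andP[+ /andP[_ eb]].
  by rewrite E; [lia | rewrite (leq_trans eb)// below_le].
rewrite [X in op _ X]big1_seq ?Monoid.mulm1 => [|e]; last first.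
  by rewrite mem_index_iota => /andP[+ /andP[eb ez]]; rewrite E//; lia.
rewrite big_nat_cond [RHS]big_nat_cond; apply: eq_bigl => e.
case: (boolP (_ <= e < _)%N) => //= He; rewrite E ?He//.
by case/andP: He => _ He; apply: leq_trans He bz.
Qed.

End Keys.

(** * Segment queries *)

(* The levels below 4 are the inputs, 10 and 11 the unsorted keys and the sorting index. *)
Definition Lp := 0.
Definition Lmat := 1.
Definition Ln := 2.
Definition Lm := 3.
Definition Lz := 4.
Definition Lell := 5.
Definition LK := 6.
Definition LN := 7.
Definition Llg := 8.
Definition Lpw := 9.
Definition Lkey := 12.
Definition La := 13.

(* Entry [e] of the matrix, in row-major order, is in row [key e %/ 2 ^ K] and column
   [key e %% 2 ^ K], so that the entries of a row in an aligned block of [2 ^ h] columns are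
   those with a given value of [key e %/ 2 ^ h]: they occupy a segment. *)
Record instance (m n z ell K : nat) (key : nat -> nat) : Prop := Instance {
  in_m : (0 < m < 2 ^ ell)%N;
  in_n : (0 < n < 2 ^ K)%N;
  in_ml : (2 ^ ell <= 2 * m)%N;
  in_nl : (2 ^ K <= 2 * n)%N;
  in_z : (z <= m * n)%N;
  in_key : forall e, (e < z)%N -> (key e < m * 2 ^ K)%N;
  in_col : forall e, (e < z)%N -> (key e %% 2 ^ K < n)%N;
  in_mono : forall e e', (e < e' < z)%N -> (key e < key e')%N
}.

Record globals (R : realType) (m n z ell K : nat) (key : nat -> nat) (a : nat -> R)
    (E : seq (value R)) : Prop := Globals {
  gl_n : lookup E Ln (VWord n);
  gl_m : lookup E Lm (VWord m);
  gl_z : lookup E Lz (VWord z);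
  gl_ell : lookup E Lell (VWord ell);
  gl_K : lookup E LK (VWord K);
  gl_N : lookup E LN (VWord (2 ^ K));
  gl_lg : lookup E Llg (VWord (ell + K));
  gl_pw : lookup E Lpw (VWord (2 ^ (ell + K)));
  gl_key : lookup E Lkey (arrW key z);
  gl_a : lookup E La (arrR a z)
}.

Definition clb (lx : nat) : lterm :=
  cbsearch Lz Lpw Llg (fun i => cle (cadd (cgetW (cvar Lkey) (cvar i)) (cword 1)) (cvar lx)).

Definition cseg (o : real_op) (u : lterm) (ls lnu lpw : nat) : lterm :=
  clet (cmul (cvar lnu) (cvar lpw)) (fun l1 =>
  clet (cmul (cadd (cvar lnu) (cword 1)) (cvar lpw)) (fun l2 =>
  clet (clb l1) (fun lo =>
  clet (clb l2) (fun hi =>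
    crop o (cpref u ls hi) (cpref u ls lo))))).

Definition csumscan (ln la : nat) := cscan ln Llg (fun x y => radd (cvar x) (cvar y)) la.
Definition cprodscan (ln la : nat) := cscan ln Llg (fun x y => rmul (cvar x) (cvar y)) la.
Definition csumseg := cseg RSub (rnat 0).
Definition cprodseg := cseg RDiv (rnat 1).


Section Queries.
Variables (R : realType) (W s m n z ell K : nat) (key : nat -> nat) (a : nat -> R).
Hypothesis inst : instance m n z ell K key.
Hypothesis bigW : (2 ^ (20 + 4 * (ell + K)) <= W)%N.
Local Notation glob := (globals m n z ell K key a).
Local Notation lg := (ell + K)%N.

Definition segsum (f : nat -> R) pw nu : R :=
  (\sum_(e < z | (key e %/ pw == nu)%N) f e)%R.
Definition segprod (f : nat -> R) pw nu : R :=
  (\prod_(e < z | (key e %/ pw == nu)%N) f e)%R.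

Lemma globals_ext E E' : extends E E' -> glob E -> glob E'.
Proof. by move=> h [*]; split; apply: lookup_ext h _. Qed.

Lemma key_W e : (e < z)%N -> (key e < 2 ^ lg)%N.
Proof.
move=> /(in_key inst) /leq_trans; apply; rewrite expnD leq_mul2r.
by have /andP[_ /ltnW ->] := in_m inst; rewrite orbT.
Qed.

Lemma lgW : (2 ^ 20 * (2 ^ lg * 2 ^ lg * 2 ^ lg) <= W)%N.
Proof.
by apply: leq_trans bigW; rewrite -!expnD leq_exp2l//; lia.
Qed.

Lemma key_homo e e' : (e < e' < z)%N -> (key e <= key e')%N.
Proof. by move/(in_mono inst)/ltnW. Qed.

Lemma pow_lg : (lg < 2 ^ lg)%N. Proof. exact: ltn_expl. Qed.

Lemma z_lg : (z < 2 ^ lg)%N.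
Proof.
have /andP[m0 mell] := in_m inst; have /andP[n0 nK] := in_n inst.
rewrite (leq_ltn_trans (in_z inst))// expnD.
by apply: (@leq_ltn_trans (m * 2 ^ K)); rewrite ?leq_mul2l ?ltn_mul2r ?expn_gt0 ?(ltnW nK) ?orbT.
Qed.

Ltac wside := have := lgW; have := pow_lg; have := z_lg; nia.

Lemma ev_lb E lx x : glob E -> lookup E lx (VWord x) ->
  evals W 0 E (clb lx) (VWord (below z key x)) (40 + lg * 70).
Proof.
move=> G hx; have := lgW; have := pow_lg; have := z_lg => z1 l1 w1.
have l0 : (0 < 2 ^ lg)%N by rewrite expn_gt0.
have w2 : (2 ^ lg * 3 <= W)%N.
  by apply: leq_trans w1; rewrite mulnC -mulnA leq_mul//; nia.
apply: ev_le.
  apply: (ev_bsearch (lg := lg) (z := z) (qt := 10)); 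
    [apply: gl_z G|apply: gl_pw G|apply: gl_lg G|by []|by lia|exact: below_le|].
  move=> i E1 l iz h hl; have {}G := globals_ext h G; jlift h; case: (G) => *.
  jrun; [..|].
  - by have := key_W iz; lia.
  - by congr VWord; rewrite addn1 (below_lt key_homo).
  - by [].
by lia.
Qed.

Section Seg.
Variables (idx : R) (op : Monoid.com_law idx) (o : real_op) (u : lterm) (f : nat -> R).
Hypothesis op_inv : forall x y, x \in [seq \big[op/idx]_(e < i) f e | i <- iota 0 z.+1] ->
  real_op_sem o (op x y) x = y.
Hypothesis u_ev : forall E, glob E -> evals W 0 E u (VReal idx) 2.

(** [op_inv] is demanded at prefix values only: subtraction inverts everywhere, but division needs a
    nonzero prefix product. *)
Lemma ev_seg ls lnu lpw nu pw E : glob E -> (0 < pw)%N -> (nu.+1 * pw <= W)%N ->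
  lookup E ls (arrR (fun i => \big[op/idx]_(j < i.+1) f j) z) ->
  lookup E lnu (VWord nu) -> lookup E lpw (VWord pw) ->
  evals W 0 E (cseg o u ls lnu lpw)
    (VReal (\big[op/idx]_(e < z | key e %/ pw == nu) f e)) (200 + lg * 140).
Proof.
move=> G p0 npW hs hnu hpw.
have := lgW; have := pow_lg; have := z_lg => z1 l1 w1.
have w2 : (z <= W)%N.
  by apply: leq_trans w1; apply: (leq_trans (ltnW z1)); nia.
have W0 : (0 < W)%N by apply: leq_trans npW; rewrite muln_gt0.
rewrite (big_segment key_homo) //.
rewrite /cseg; eapply ev_eq.
- jstep; first by jauto; nia.
  jstep; first by jauto; nia.
  jstep; first by eapply ev_lb; [exact: globals_ext hx0 (globals_ext hx G)|eassumption].
  jstep; first by eapply ev_lb; [exact: globals_ext hx1 (globals_ext hx0 (globals_ext hx G))|eassumption].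
  have G4 := globals_ext hx2 (globals_ext hx1 (globals_ext hx0 (globals_ext hx G))).
  by eapply ev_rop; eapply (ev_pref (opT := op) (inj := VReal) (f := f) (n := z));
    try eassumption; try exact: below_le; exact: u_ev.
- congr VReal; rewrite -!(big_mkord predT).
  rewrite (@big_cat_nat _ _ _ (below z key (nu * pw)) 0 (below z key ((nu + 1) * pw)))//=.
    rewrite op_inv ?addn1//.
    apply/mapP; exists (below z key (nu * pw)); last by rewrite big_mkord.
    by rewrite mem_iota /= add0n ltnS below_le.
  by apply: below_mono; rewrite leq_mul2r addn1 leqnSn orbT.
- by lia.
Qed.
End Seg.

Lemma ev_sumseg (f : nat -> R) ls lnu lpw nu pw E : glob E -> (0 < pw)%N -> (nu.+1 * pw <= W)%N ->
  lookup E ls (arrR (fun i => \sum_(j < i.+1) f j)%R z) ->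
  lookup E lnu (VWord nu) -> lookup E lpw (VWord pw) ->
  evals W 0 E (csumseg ls lnu lpw)
    (VReal (segsum f pw nu)) (200 + lg * 140).
Proof.
move=> *; apply: (ev_seg (op := GRing.add)); try eassumption.
  by move=> x y _ /=; rewrite [X in (X - _)%R]addrC addrK.
by move=> E' _; jrun.
Qed.

Lemma ev_prodseg (f : nat -> R) ls lnu lpw nu pw E : glob E -> (0 < pw)%N -> (nu.+1 * pw <= W)%N ->
  (forall e, (e < z)%N -> f e != 0)%R ->
  lookup E ls (arrR (fun i => \prod_(j < i.+1) f j)%R z) ->
  lookup E lnu (VWord nu) -> lookup E lpw (VWord pw) ->
  evals W 0 E (cprodseg ls lnu lpw)
    (VReal (segprod f pw nu)) (200 + lg * 140).
Proof.
move=> G p0 npW f0 *; apply: (ev_seg (op := GRing.mul)); try eassumption.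
  move=> x y /mapP[i]; rewrite mem_iota /= add0n ltnS => iz -> /=.
  rewrite [X in (X / _)%R]mulrC mulfK//; apply/prodf_neq0 => j _; apply: f0.
  exact: leq_trans iz.
have W0 : (0 < W)%N by apply: leq_trans npW; rewrite muln_gt0.
by move=> E' _; jrun.
Qed.

Lemma ev_sumscan (f : nat -> R) k ln la E : glob E -> (k <= s.+1)%N -> (k <= 2 ^ lg)%N ->
  lookup E ln (VWord k) -> lookup E la (arrR f k) ->
  evals W s E (csumscan ln la) (arrR (fun i => \sum_(j < i.+1) f j)%R k) (40 + lg * 90).
Proof.
move=> G ks klg hk ha; apply: ev_le.
  apply: (ev_scan (opT := GRing.add) (inj := VReal) (qo := 5)) hk (gl_lg G) ha _ ks _ _ _ => //.
  - by wside.
  - by apply: leq_trans klg _; wside.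
  - move=> i1 i2 i3 E1 l1 l2 /andP[i12 i23] i3k h h1 h2; jrun; last by [].
    by congr VReal; rewrite -big_cat_nat.
by lia.
Qed.

Lemma ev_prodscan (f : nat -> R) k ln la E : glob E -> (k <= s.+1)%N -> (k <= 2 ^ lg)%N ->
  lookup E ln (VWord k) -> lookup E la (arrR f k) ->
  evals W s E (cprodscan ln la) (arrR (fun i => \prod_(j < i.+1) f j)%R k) (40 + lg * 90).
Proof.
move=> G ks klg hk ha; apply: ev_le.
  apply: (ev_scan (opT := GRing.mul) (inj := VReal) (qo := 5)) hk (gl_lg G) ha _ ks _ _ _ => //.
  - by wside.
  - by apply: leq_trans klg _; wside.
  - move=> i1 i2 i3 E1 l1 l2 /andP[i12 i23] i3k h h1 h2; jrun; last by [].
    by congr VReal; rewrite -big_cat_nat.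
by lia.
Qed.

End Queries.

Ltac jlift h ::=
  match type of h with extends ?E _ =>
    repeat match goal with
    | H : lookup E _ _ |- _ => apply (lookup_ext h) in H
    | H : evals _ _ E _ _ _ |- _ => apply (ev_ext h) in H
    | H : globals _ _ _ _ _ _ _ E |- _ => apply (globals_ext h) in H
    end end.

Ltac jlookup ::=
  first [ match goal with H : lookup ?E ?l _ |- lookup ?E ?l _ => exact H end
        | eapply gl_n; eassumption | eapply gl_m; eassumption
        | eapply gl_z; eassumption | eapply gl_ell; eassumption | eapply gl_K; eassumption
        | eapply gl_N; eassumption | eapply gl_lg; eassumption | eapply gl_pw; eassumption
        | eapply gl_key; eassumption | eapply gl_a; eassumption ].

Section Entries.
Variables (R : realType) (W m n z ell K : nat) (key : nat -> nat) (a : nat -> R).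
Hypothesis inst : instance m n z ell K key.
Hypothesis bigW : (2 ^ (20 + 4 * (ell + K)) <= W)%N.
Local Notation glob := (globals m n z ell K key a).
Local Notation lg := (ell + K)%N.

Lemma W_bounds : [/\ (2 ^ lg * 2 ^ lg * 1000 <= W)%N, (lg < 2 ^ lg)%N, (z < 2 ^ lg)%N,
   (m < 2 ^ lg)%N /\ (n < 2 ^ lg)%N & (0 < 2 ^ lg)%N].
Proof.
have H := lgW bigW; have H1 := z_lg inst.
have /andP[m0 mell] := in_m inst; have /andP[n0 nK] := in_n inst.
have e0 : (0 < 2 ^ lg)%N by rewrite expn_gt0.
split => //; last split.
- by apply: leq_trans H; rewrite mulnC; apply: leq_mul; nia.
- exact: ltn_expl.
- by apply: leq_trans mell _; rewrite leq_exp2l// leq_addr.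
- by apply: leq_trans nK _; rewrite leq_exp2l// leq_addl.
Qed.

Definition crow (e : nat) : lterm := cdiv (cgetW (cvar Lkey) (cvar e)) (cvar LN).
Definition ccol (e : nat) : lterm := cmod (cgetW (cvar Lkey) (cvar e)) (cvar LN).
Definition ckey (e : nat) : lterm := cgetW (cvar Lkey) (cvar e).
Definition cnode (lpw e : nat) : lterm := cdiv (cgetW (cvar Lkey) (cvar e)) (cvar lpw).
Definition cpairix (lpw2 lP e : nat) : lterm := cmod (cnode lpw2 e) (cvar lP).
Definition ctotal (la ln : nat) : lterm := cpref (rnat 0) la ln.

(** For [h.+1 + c = K] this is the column of [e] divided by [2 ^ h.+1]; the reduction modulo [2 ^ c]
    discards the row. *)
Definition pair_index h c (e : nat) := ((key e %/ 2 ^ h.+1) %% 2 ^ c)%N.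

Lemma row_lt e : (e < z)%N -> (key e %/ 2 ^ K < m)%N.
Proof. by move=> /(in_key inst); rewrite ltn_divLR ?expn_gt0. Qed.

Lemma key_le_W x : (key x < 2 ^ lg)%N -> (key x <= W)%N.
Proof. by have [w1 _ _ _ w5] := W_bounds => kx; nia. Qed.

Lemma ev_key E s le e : glob E -> (e < z)%N -> lookup E le (VWord e) ->
  evals W s E (ckey le) (VWord (key e)) 3.
Proof. by move=> G ez he; rewrite /ckey; jrun. Qed.

Lemma ev_node E s lpw le e pw : glob E -> (e < z)%N -> lookup E le (VWord e) ->
  lookup E lpw (VWord pw) ->
  evals W s E (cnode lpw le) (VWord (key e %/ pw)) 5.
Proof.
move=> G ez he hp; rewrite /cnode; jrun; [|by []|by []].
by have := key_le_W (key_W inst ez); apply: leq_trans (leq_div _ _).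
Qed.

Lemma ev_row E s le e : glob E -> (e < z)%N -> lookup E le (VWord e) ->
  evals W s E (crow le) (VWord (key e %/ 2 ^ K)) 5.
Proof. by move=> G ez he; exact: ev_node (gl_N G). Qed.

Lemma ev_col E s le e : glob E -> (e < z)%N -> lookup E le (VWord e) ->
  evals W s E (ccol le) (VWord (key e %% 2 ^ K)) 5.
Proof.
move=> G ez he; rewrite /ccol; jrun; [|by []|by []].
by have := key_le_W (key_W inst ez); apply: leq_trans (leq_mod _ _).
Qed.

Lemma ev_pairix E s lpw lP le e h c : glob E -> (e < z)%N -> lookup E le (VWord e) ->
  lookup E lpw (VWord (2 ^ h.+1)) -> lookup E lP (VWord (2 ^ c)) ->
  evals W s E (cpairix lpw lP le) (VWord (pair_index h c e)) 7.
Proof.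
move=> G ez he hp hP; rewrite /cpairix; eapply ev_eq.
  eapply ev_mod; [exact: ev_node G ez he hp|by jauto|].
  have := key_le_W (key_W inst ez); apply: leq_trans.
  exact: leq_trans (leq_mod _ _) (leq_div _ _).
all: by [].
Qed.

Lemma ev_total (f : nat -> R) E la ln k : (k <= W)%N ->
  lookup E la (arrR (fun i => \sum_(j < i.+1) f j)%R k) -> lookup E ln (VWord k) ->
  evals W 0 E (ctotal la ln) (VReal (\sum_(j < k) f j)%R) 15.
Proof.
have [w1 _ _ _ w5] := W_bounds.
move=> kW ha hn; apply: (ev_pref (opT := GRing.add) (inj := VReal) (f := f) (n := k)) => //; first by nia.
by jrun.
Qed.

End Entries.

Ltac jcall ::=
  lazymatch goal with
  | |- evals _ _ _ (crow _) _ _ => eapply ev_row; [eassumption|eassumption|eassumption| |jlookup]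
  | |- evals _ _ _ (ccol _) _ _ => eapply ev_col; [eassumption|eassumption|eassumption| |jlookup]
  | |- evals _ _ _ (clb _) _ _ => apply: ev_scale; eapply ev_lb; [eassumption|eassumption|eassumption|jlookup]
  | |- evals _ _ _ (ckey _) _ _ => eapply ev_key; [eassumption| |jlookup]
  | |- evals _ _ _ (cnode _ _) _ _ => eapply ev_node; [eassumption|eassumption|eassumption| |jlookup|jlookup]
  | |- evals _ _ _ (cpairix _ _ _) _ _ => eapply ev_pairix; [eassumption|eassumption|eassumption| |jlookup|jlookup|jlookup]
  | |- evals _ _ _ (ctotal _ _) _ _ => apply: ev_scale; eapply ev_total; [eassumption|eassumption| |jlookup|jlookup]
  | |- evals _ _ _ (csumscan _ _) _ _ => eapply ev_sumscan; [eassumption|eassumption|eassumption| | |jlookup|jlookup]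
  | |- evals _ _ _ (cprodscan _ _) _ _ => eapply ev_prodscan; [eassumption|eassumption|eassumption| | |jlookup|jlookup]
  | |- evals _ _ _ (csumseg _ _ _) _ _ => eapply ev_sumseg; [eassumption|eassumption|eassumption| | |jlookup|jlookup|jlookup]
  | |- evals _ _ _ (cprodseg _ _ _) _ _ => eapply ev_prodseg; [eassumption|eassumption|eassumption| | | |jlookup|jlookup|jlookup]
  | |- _ => eassumption
  end.

(** * Sums and products over the nodes of the binary tree *)

Section Nodes.
Local Open Scope ring_scope.
Variables (R : realType) (z : nat) (key : nat -> nat).
Implicit Types f g : nat -> R.
Local Notation nodesum := (segsum z key).

Lemma sum_double f n : \sum_(p < n.*2) f p = \sum_(p < n) (f p.*2 + f p.*2.+1).
Proof.
elim: n => [|n IH]; first by rewrite !big_ord0.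
by rewrite doubleS !big_ord_recr /= IH addrA.
Qed.

Lemma divn_double e pw nu : (e %/ (pw * 2) == nu)%N = (e %/ pw == nu.*2)%N || (e %/ pw == nu.*2.+1)%N.
Proof. rewrite divnMA; lia. Qed.

Lemma segsum_double f pw nu :
  nodesum f (pw * 2)%N nu = nodesum f pw nu.*2 + nodesum f pw nu.*2.+1.
Proof.
rewrite /segsum [LHS](bigID (fun e : 'I_z => key e %/ pw == nu.*2)%N) /=.
congr (_ + _); apply: eq_bigl => e; rewrite divn_double; lia.
Qed.

Lemma segprod_double f pw nu :
  segprod z key f (pw * 2)%N nu = segprod z key f pw nu.*2 * segprod z key f pw nu.*2.+1.
Proof.
rewrite /segprod [LHS](bigID (fun e : 'I_z => key e %/ pw == nu.*2)%N) /=.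
congr (_ * _); apply: eq_bigl => e; rewrite divn_double; lia.
Qed.

Lemma sum_shift (F : nat -> R) n k :
  \sum_(n <= p < n + k) F p = \sum_(p < k) F (n + p)%N.
Proof.
rewrite -[X in \sum_(X <= _ < _) _]add0n big_addn addKn big_mkord.
by apply: eq_bigr => p _; rewrite addnC.
Qed.

Lemma segsum_pow f pw c nu :
  nodesum f (pw * 2 ^ c)%N nu = \sum_(p < 2 ^ c) nodesum f pw (nu * 2 ^ c + p)%N.
Proof.
elim: c nu => [|c IH] nu; first by rewrite big_ord1 /= addn0 expn0 !muln1.
rewrite -(big_mkord predT (fun p => nodesum f pw (nu * 2 ^ c.+1 + p)%N)).
have e : (2 ^ c.+1 = 2 ^ c + 2 ^ c)%N by rewrite expnS mul2n addnn.
rewrite (@big_cat_nat _ _ _ (2 ^ c)%N) ?e ?leq_addr //= (sum_shift _ (2 ^ c)%N) big_mkord.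
rewrite addnn -muln2 mulnA segsum_double !IH; congr (_ + _).
  by apply: eq_bigr => p _; congr nodesum; lia.
by apply: eq_bigr => p _; congr nodesum; lia.
Qed.

Lemma sum_segsum f pw M : (forall e, (e < z)%N -> (key e %/ pw < M)%N) ->
  \sum_(e < z) f e = \sum_(nu < M) nodesum f pw nu.
Proof.
move=> kM; rewrite (partition_big (fun e : 'I_z => inord (key e %/ pw) : 'I_M.-1.+1) predT)//=.
case: M kM => [|M] kM; first by rewrite big_ord0 big_ord1 big1// => -[e ez]; have := kM e ez.
apply: eq_bigr => nu _; apply: eq_bigl => e; rewrite -val_eqE /= inordK//; exact: kM.
Qed.

Lemma eq_segsum f g pw nu :
  (forall e, (e < z)%N -> (key e %/ pw)%N = nu -> f e = g e) -> nodesum f pw nu = nodesum g pw nu.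
Proof. by move=> fg; apply: eq_bigr => e /eqP ke; apply: fg. Qed.

Lemma eq_segprod f g pw nu :
  (forall e, (e < z)%N -> (key e %/ pw)%N = nu -> f e = g e) ->
  segprod z key f pw nu = segprod z key g pw nu.
Proof. by move=> fg; apply: eq_bigr => e /eqP ke; apply: fg. Qed.

Lemma segsumZ x f pw nu : nodesum (fun e => x * f e) pw nu = x * nodesum f pw nu.
Proof. by rewrite /segsum mulr_sumr. Qed.

End Nodes.

(* The sign of pair [p] is the product, over the bits set in [p], of the signs that make the
   cross terms of these bits nonpositive. *)
Definition cchoose_bits (lpw2 lP lcnt lU leta : nat) : lterm :=
  cfor (cvar lcnt) (cpair (cword 1) (ctab (cvar lP) (fun=> rnat 1))) (fun _ st =>
    clet (cfst (cvar st)) (fun q =>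
    clet (csnd (cvar st)) (fun sg =>
    clet (cmul (cvar lpw2) (cvar q)) (fun pw =>
    clet (ctab (cvar Lz) (fun e =>
            rmul (cgetR (cvar sg) (cpairix lpw2 lP e)) (cgetR (cvar leta) (cvar e)))) (fun v =>
    clet (csumscan Lz v) (fun S =>
    clet (ctab (cvar Lz) (fun e =>
            cifR (cbit (ckey e) (cvar pw)) (rnat 0)
              (clet (cadd (cnode pw e) (cword 1)) (fun nu =>
               rmul (rmul (cgetR (cvar lU) (crow e)) (cgetR (cvar v) (cvar e)))
                    (csumseg S nu pw))))) (fun cr =>
    clet (csumscan Lz cr) (fun C =>
    clet (ctotal C Lz) (fun X =>
    clet (cifR (crle (cvar X) (rnat 0)) (rnat 1) (rsub (rnat 0) (rnat 1))) (fun sig =>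
    cpair (cmul (cvar q) (cword 2))
      (ctab (cvar lP) (fun p =>
         cifR (cbit (cvar p) (cvar q)) (rmul (cvar sig) (cgetR (cvar sg) (cvar p)))
           (cgetR (cvar sg) (cvar p)))))))))))))).

Definition cchoose (lpw2 lP lcnt lU leta llin : nat) : lterm :=
  clet (cchoose_bits lpw2 lP lcnt lU leta) (fun r =>
  clet (csnd (cvar r)) (fun sg =>
  clet (ctab (cvar Lz) (fun e =>
          rmul (cgetR (cvar lU) (crow e))
            (rmul (cgetR (cvar sg) (cpairix lpw2 lP e)) (cgetR (cvar leta) (cvar e))))) (fun v =>
  clet (csumscan Lz v) (fun S =>
  clet (ctab (cvar lP) (fun p => rmul (cgetR (cvar llin) (cvar p)) (cgetR (cvar sg) (cvar p)))) (fun v' =>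
  clet (csumscan lP v') (fun S' =>
  clet (radd (ctotal S Lz) (ctotal S' lP)) (fun T =>
  ctab (cvar lP) (fun p =>
    cifR (crle (cvar T) (rnat 0)) (cgetR (cvar sg) (cvar p))
      (rsub (rnat 0) (cgetR (cvar sg) (cvar p))))))))))).

(** * Second moment of signs chosen bit by bit *)

Section ChooseMath.
Local Open Scope ring_scope.
Variables (R : realType) (m z h c : nat) (key : nat -> nat).
Hypothesis keym : forall e, (e < z)%N -> (key e < m * 2 ^ (h.+1 + c))%N.
Local Notation nodesum := (segsum z key).

Lemma sum_rows (G : nat -> R) k n :
  \sum_(nu < n * k) G nu = \sum_(i < n) \sum_(p < k) G (i * k + p)%N.
Proof.
elim: n => [|n IH]; first by rewrite !big_ord0.
rewrite big_ord_recr /= -IH -sum_shift -!(big_mkord predT) mulSn addnC.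
by rewrite -big_cat_nat ?leq_addr.
Qed.

Local Notation pix := (pair_index key h c).

Lemma odd_mod_pow x k : (k < c)%N -> odd (x %% 2 ^ c %/ 2 ^ k) = odd (x %/ 2 ^ k).
Proof.
move=> kc; rewrite {2}(divn_eq x (2 ^ c)).
have -> : (2 ^ c = 2 ^ (c - k.+1) * 2 * 2 ^ k)%N.
  by rewrite -mulnA -expnS -expnD; congr (_ ^ _)%N; lia.
rewrite mulnA divnMDl ?expn_gt0// oddD mulnA oddM andbF //.
Qed.

Variables (U eta : nat -> R).
Hypothesis U0 : forall i, (i < m)%N -> 0 <= U i.

Definition signed (sg : nat -> R) (e : nat) := sg (pix e) * eta e.

(** Interpolates between the value for independent directions ([k = 0], sum of squares) and the
    actual one ([k = c], square of the row sum) through blocks of [2 ^ k] pairs. *)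
Definition energy k (sg : nat -> R) := \sum_(i < m) U i *
  \sum_(p < 2 ^ (c - k)) nodesum (signed sg) (2 ^ (h.+1 + k)) (i * 2 ^ (c - k) + p)%N ^+ 2.

(** Summed over the entries of an even node, this gives the product of the sums of the node and of
    its right sibling, with the weight of the row. *)
Definition cross_term k (sg : nat -> R) e :=
  let pw := (2 ^ h.+1 * 2 ^ k)%N in
  if odd (key e %/ pw) then 0 else
  U (key e %/ 2 ^ (h.+1 + c))%N * signed sg e * nodesum (signed sg) pw (key e %/ pw + 1)%N.

Definition flip_bit k (sig : R) (sg : nat -> R) p :=
  if odd (p %/ 2 ^ k) then sig * sg p else sg p.

(** Merging siblings turns [V0^2 + V1^2] into [(V0 + sig V1)^2] with the same [sig] for all rows and
    blocks. The total change is [2 sig X], and [sig] is chosen against the sign of [X]. *)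
Lemma energy_flip k sg : (k < c)%N ->
  energy k.+1 (flip_bit k (if \sum_(e < z) cross_term k sg e <= 0 then 1 else 0 - 1) sg)
    <= energy k sg.
Proof.
move=> kc; set X := \sum_(e < z) _; set sig := if _ then _ else _.
have sigX : sig * X <= 0 by rewrite /sig; case: ifPn; [lra | rewrite -ltNge; lra].
have sig2 : sig ^+ 2 = 1 by rewrite /sig; case: ifP; rewrite ?sub0r ?sqrrN expr1n.
set pw := (2 ^ h.+1 * 2 ^ k)%N; set d := (c - k.+1)%N.
pose V := nodesum (signed sg) pw.
have pw0 : (0 < pw)%N by rewrite muln_gt0 !expn_gt0.
have ek : (2 ^ (h.+1 + k) = pw)%N by rewrite expnD.
have ek1 : (2 ^ (h.+1 + k.+1) = pw * 2)%N by rewrite /pw -mulnA -expnSr expnD.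
have ed : (2 ^ (c - k) = (2 ^ d).*2)%N.
  by rewrite -muln2 -expnSr; congr (_ ^ _)%N; rewrite /d; lia.
have eN : (2 ^ (h.+1 + c) = pw * 2 * 2 ^ d)%N.
  by rewrite /pw -!expnD -expnSr -expnD; congr (_ ^ _)%N; rewrite /d; lia.
have EX : X = \sum_(i < m) U i * \sum_(p < 2 ^ d)
    (V (i * 2 ^ d + p)%N.*2 * V (i * 2 ^ d + p)%N.*2.+1).
  rewrite /X (@sum_segsum _ _ key _ (pw * 2) (m * 2 ^ d)); last first.
    by move=> e ez; rewrite ltn_divLR ?muln_gt0 ?pw0//; have := keym ez; rewrite eN; lia.
  rewrite (@sum_rows (fun nu => nodesum (cross_term k sg) (pw * 2) nu)).
  apply: eq_bigr => i _; rewrite mulr_sumr; apply: eq_bigr => p _.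
  rewrite segsum_double [X in _ + X]big1 ?addr0 => [|e /eqP ke]; last first.
    by rewrite /cross_term -/pw ke /= odd_double.
  transitivity (nodesum (fun e => U i * V (i * 2 ^ d + p)%N.*2.+1 * signed sg e) pw (i * 2 ^ d + p)%N.*2).
    apply: eq_segsum => e ez ke; rewrite /cross_term -/pw ke odd_double addn1 eN.
    rewrite -mulnA divnMA ke divnMA divn2 doubleK -/V.
    rewrite divnMDl ?expn_gt0// divn_small// addn0; ring.
  by rewrite segsumZ -/V; ring.
rewrite /energy -/d ek ek1 -subr_le0 -sumrB.
suff -> : \sum_(i < m) (U i * \sum_(p < 2 ^ d)
            nodesum (signed (flip_bit k sig sg)) (pw * 2) (i * 2 ^ d + p)%N ^+ 2 -
          U i * \sum_(p < 2 ^ (c - k)) nodesum (signed sg) pw (i * 2 ^ (c - k) + p)%N ^+ 2)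
      = 2 * (sig * X) by rewrite pmulr_rle0.
rewrite EX 2!mulr_sumr; apply: eq_bigr => i _; rewrite -mulrBr (mulrCA sig (U i)) (mulrCA 2 (U i)); congr (_ * _).
rewrite ed (sum_double (fun p => nodesum (signed sg) pw (i * (2 ^ d).*2 + p)%N ^+ 2)).
rewrite -sumrB 2!mulr_sumr; apply: eq_bigr => p _; rewrite segsum_double.
set nu := (i * 2 ^ d + p)%N.
have -> : (i * (2 ^ d).*2 + p.*2 = nu.*2)%N by rewrite /nu; lia.
have -> : (i * (2 ^ d).*2 + p.*2.+1 = nu.*2.+1)%N by rewrite /nu; lia.
have bitE e : odd (pix e %/ 2 ^ k) = odd (key e %/ pw).
  by rewrite /pair_index odd_mod_pow// -divnMA.
have -> : nodesum (signed (flip_bit k sig sg)) pw nu.*2 = V nu.*2.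
  by apply: eq_segsum => e ez ke; rewrite /signed /flip_bit bitE ke odd_double.
have -> : nodesum (signed (flip_bit k sig sg)) pw nu.*2.+1 = sig * V nu.*2.+1.
  rewrite -segsumZ; apply: eq_segsum => e ez ke.
  by rewrite /signed /flip_bit bitE ke /= odd_double mulrA.
rewrite -/V sqrrD exprMn sig2; ring.
Qed.

End ChooseMath.

Lemma pow_cn m n z ell K key h c :
  instance m n z ell K key -> (h.+1 + c)%N = K -> (2 ^ c <= n)%N.
Proof.
move=> inst hcK; have := in_nl inst; rewrite -hcK expnD expnS.
have : (0 < 2 ^ h)%N by rewrite expn_gt0.
nia.
Qed.

Section ChooseProgram.
Variables (R : realType) (W s m n z ell K : nat) (key : nat -> nat) (a : nat -> R).
Hypothesis inst : instance m n z ell K key.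
Hypothesis bigW : (2 ^ (20 + 4 * (ell + K)) <= W)%N.
Hypothesis sE : s.+1 = (n + m + z)%N.
Local Notation glob := (globals m n z ell K key a).
Local Notation lg := (ell + K)%N.
Local Notation nodesum := (segsum z key).

Variables (h c : nat).
Hypothesis hcK : (h.+1 + c)%N = K.

Lemma keym e : (e < z)%N -> (key e < m * 2 ^ (h.+1 + c))%N.
Proof. by rewrite hcK => /(in_key inst). Qed.

Variables (U eta : nat -> R).
Hypothesis U0 : forall i, (i < m)%N -> (0 <= U i)%R.
Local Notation pix := (pair_index key h c).
Local Notation sgd := (signed h c key eta).

Definition is_sign (R : realType) (x : R) := x = 1%R \/ x = (-1)%R.

Lemma evP_choose_bits E lpw2 lP lcnt lU leta : glob E ->
  lookup E lpw2 (VWord (2 ^ h.+1)) -> lookup E lP (VWord (2 ^ c)) ->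
  lookup E lcnt (VWord c) -> lookup E lU (arrR U m) -> lookup E leta (arrR eta z) ->
  evalsP W s E (cchoose_bits lpw2 lP lcnt lU leta)
    (fun v => exists sg, [/\ v = VPair (VWord (2 ^ c)) (arrR sg (2 ^ c)),
      forall p, is_sign (sg p)
      & (energy m z h c key U eta c sg <= energy m z h c key U eta 0 (fun=> 1))%R])
    (100 + c * (1000 + 400 * lg)).
Proof.
move=> G hpw hP hcnt hU heta; have [w1 w2 w3 [w4 w4'] w5] := W_bounds inst bigW.
have cK : (c < K)%N by rewrite -hcK; lia.
have P0 : (0 < 2 ^ c)%N by rewrite expn_gt0.
have N0 : (0 < 2 ^ K)%N by rewrite expn_gt0.
have Pn := pow_cn inst hcK.
pose Inv k (v : value R) := exists sg, [/\ v = VPair (VWord (2 ^ k)) (arrR sg (2 ^ c)),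
      forall p, is_sign (sg p)
      & (energy m z h c key U eta k sg <= energy m z h c key U eta 0 (fun=> 1))%R].
apply: evP_le; first apply: (evP_for (Inv := Inv) (qb := 900 + 400 * lg)).
- by jauto.
- apply: ev_evP; first by jauto; lia.
  exists (fun=> 1%R); split => //.
  by move=> p; left.
- by nia.
- move=> k u E1 li lu kc [sg [-> sgS sgE]] hx hi hu; jlift hx.
  have q0 : (0 < 2 ^ k)%N by rewrite expn_gt0.
  have qP : (2 ^ k * 2 <= 2 ^ c)%N by rewrite -expnSr leq_exp2l.
  have pwP : (2 ^ h.+1 * 2 ^ k <= 2 ^ lg)%N by rewrite -expnD leq_exp2l//; lia.
  have pw0 : (0 < 2 ^ h.+1 * 2 ^ k)%N by rewrite muln_gt0 !expn_gt0.
  pose sig : R := (if \sum_(e < z) cross_term z h c key U eta k sg e <= 0 then 1 else 0 - 1)%R.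
  apply: (@ev_evP _ _ _ _ _ (VPair (VWord (2 ^ k.+1)) (arrR (flip_bit k sig sg) (2 ^ c)))); last first.
    exists (flip_bit k sig sg); split => //.
      move=> p; rewrite /flip_bit; case: ifP => // _; rewrite /sig /is_sign.
      by case: ifP => _; case: (sgS p) => ->; rewrite ?mul1r ?sub0r ?mulN1r ?opprK; auto.
    by apply: le_trans sgE; apply: energy_flip => //; exact: keym.
  have keyW e : (e < z)%N -> (key e < 2 ^ lg)%N := @key_W _ _ _ _ _ _ inst e.
  have pixP e : (pix e < 2 ^ c)%N by rewrite ltn_mod.
  have rowm e : (e < z)%N -> (key e %/ 2 ^ K < m)%N := @row_lt _ _ _ _ _ _ inst e.
  rewrite expnSr.
  apply: (@ev_le _ _ _ _ _ _ (900 + 400 * lg)); last by lia.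
  rewrite /sig.
  have W3 : (2 ^ lg * 3 <= W)%N by nia.
  eapply ev_eq; first jauto.
  all: try by [exact: leq_trans z3 _ | auto].
  + by have := keyW _ H4; have := leq_div (key i) (2 ^ h.+1 * 2 ^ k); lia.
  + by have := keyW _ H4; have := leq_div (key i) (2 ^ h.+1 * 2 ^ k); lia.
  + have := keyW _ H4; have := leq_divM (key i) (2 ^ h.+1 * 2 ^ k).
    by rewrite mulSn mulnDl mul1n; lia.
  + by have := leq_div i (2 ^ k); lia.
  + by rewrite -hcK.
  + by lia.
- by nia.
Qed.

Lemma node_eta sg (i p : nat) : (p < 2 ^ c)%N ->
  (nodesum (sgd sg) (2 ^ h.+1) (i * 2 ^ c + p)%N = sg p * nodesum eta (2 ^ h.+1) (i * 2 ^ c + p)%N)%R.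
Proof.
move=> pc; rewrite -segsumZ; apply: eq_segsum => e ez ke.
by rewrite /signed /pair_index ke modnMDl modn_small.
Qed.

Lemma row_eta sg (i : nat) : nodesum (sgd sg) (2 ^ K) i =
  (\sum_(p < 2 ^ c) sg p * nodesum eta (2 ^ h.+1) (i * 2 ^ c + p)%N)%R.
Proof.
rewrite -hcK expnD segsum_pow; apply: eq_bigr => p _; exact: node_eta.
Qed.

Variable lin : nat -> R.

(** Negating all signs keeps the second moment and negates the linear form [T], so one global sign
    makes [T] nonpositive. The two inequalities are those that [walk_potential] asks for. *)
Lemma evP_choose E lpw2 lP lcnt lU leta llin : glob E ->
  lookup E lpw2 (VWord (2 ^ h.+1)) -> lookup E lP (VWord (2 ^ c)) ->
  lookup E lcnt (VWord c) -> lookup E lU (arrR U m) -> lookup E leta (arrR eta z) ->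
  lookup E llin (arrR lin (2 ^ c)) ->
  evalsP W s E (cchoose lpw2 lP lcnt lU leta llin)
    (fun v => exists sg, [/\ v = arrR sg (2 ^ c), forall p, is_sign (sg p),
      (\sum_(i < m) U i * (\sum_(p < 2 ^ c) sg p * nodesum eta (2 ^ h.+1) (i * 2 ^ c + p)%N) ^+ 2
      <= \sum_(i < m) U i * \sum_(p < 2 ^ c) nodesum eta (2 ^ h.+1) (i * 2 ^ c + p)%N ^+ 2)%R
      & (\sum_(i < m) U i * (\sum_(p < 2 ^ c) sg p * nodesum eta (2 ^ h.+1) (i * 2 ^ c + p)%N)
        + \sum_(p < 2 ^ c) lin p * sg p <= 0)%R])
    (1000 + 400 * lg + c * (1000 + 400 * lg)).
Proof.
move=> G hpw hP hcnt hU heta hlin; have [w1 w2 w3 [w4 w4'] w5] := W_bounds inst bigW.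
have Pn := pow_cn inst hcK.
have pixP e : (pix e < 2 ^ c)%N by rewrite ltn_mod expn_gt0.
have rowm e : (e < z)%N -> (key e %/ 2 ^ K < m)%N := @row_lt _ _ _ _ _ _ inst e.
apply: evP_cost; first apply: (evP_let (evP_choose_bits G hpw hP hcnt hU heta)).
- move=> u E1 l [sg [-> sgS sgE]] hx hl; jlift hx.
  pose T := (\sum_(e < z) U (key e %/ 2 ^ K)%N * sgd sg e + \sum_(p < 2 ^ c) lin p * sg p)%R.
  pose sg' p := (if (T <= 0)%R then sg p else 0 - sg p)%R.
  have ET : (T = \sum_(i < m) U i * (\sum_(p < 2 ^ c) sg p * nodesum eta (2 ^ h.+1) (i * 2 ^ c + p)%N)
        + \sum_(p < 2 ^ c) lin p * sg p)%R.
    rewrite /T (@sum_segsum _ _ key (fun e => U (key e %/ 2 ^ K)%N * sgd sg e)%R (2 ^ K) m)//; congr (_ + _)%R.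
    apply: eq_bigr => i _; rewrite -row_eta -segsumZ; apply: eq_segsum => e ez ke.
    by rewrite ke.
  apply: (@ev_evP _ _ _ _ _ (arrR sg' (2 ^ c)) _ (800 + 380 * lg)).
    have W3 : (2 ^ lg * 3 <= W)%N by nia.
    eapply ev_eq; first jauto.
    all: try by [auto].
    all: try lia.
  have sgp p : is_sign (sg' p).
    rewrite /sg' /is_sign; case: ifP => _ //; case: (sgS p) => ->; rewrite ?sub0r ?opprK; auto.
  exists sg'; split => //.
  - apply: le_trans (_ : energy m z h c key U eta c sg <= _)%R.
      rewrite le_eqVlt; apply/orP; left; apply/eqP.
      apply: eq_bigr => i _; congr (_ * _)%R; rewrite subnn expn0 big_ord1 muln1 addn0 hcK row_eta.
      case: (boolP (T <= 0)%R) => T0.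
        by congr (_ ^+ 2)%R; apply: eq_bigr => p _; rewrite /sg' T0.
      rewrite -[LHS]sqrrN -sumrN; congr (_ ^+ 2)%R; apply: eq_bigr => p _.
      by rewrite /sg' (negbTE T0) sub0r mulNr opprK.
    apply: le_trans sgE _; rewrite le_eqVlt; apply/orP; left; apply/eqP.
    apply: eq_bigr => i _; congr (_ * _)%R; rewrite subn0 addn0.
    apply: eq_bigr => p _; congr (_ ^+ 2)%R; apply: eq_segsum => e _ _.
    by rewrite /signed mul1r.
  - case: (boolP (T <= 0)%R) => T0.
      by move: (T0); rewrite ET /sg' T0.
    rewrite -oppr_ge0 opprD -!sumrN ltW// (lt_le_trans (_ : 0 < T)%R) ?ltNge// ET.
    rewrite le_eqVlt; apply/orP; left; apply/eqP; congr (_ + _)%R.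
      apply: eq_bigr => i _; rewrite -mulrN -sumrN; congr (_ * _)%R.
      by apply: eq_bigr => p _; rewrite /sg' (negbTE T0) sub0r mulNr opprK.
    by apply: eq_bigr => p _; rewrite /sg' (negbTE T0) sub0r mulrN opprK.
Qed.

End ChooseProgram.

(** * The random walk of the signs *)

Section WalkMath.
Local Open Scope ring_scope.
Variable R : realType.
Implicit Types x y : R.

(** Square [1 - x/2 <= exp (-x/2)] and use [(1 - x/2)^2 (1 + x + x^2) = 1 + x^2 (1 - 3 x + x^2) /
    4], which is at least 1 for [x <= 1/3]. *)
Lemma expR_quad x : x <= 1 / 3 -> expR x <= 1 + x + x ^+ 2.
Proof.
move=> x3; have h : 0 < 1 - x / 2 by lra.
have e : 1 - x / 2 <= expR (- (x / 2)) by apply: expR_ge1Dx.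
have E : expR x * expR (- (x / 2)) ^+ 2 = 1.
  by rewrite -expRM_natl -expRD (_ : x + _ = 0) ?expR0 //; lra.
rewrite -(@ler_pM2r _ ((1 - x / 2) ^+ 2)) ?exprn_gt0//.
apply: le_trans (_ : 1 <= _); last by nra.
rewrite -[leRHS]E ler_pM2l ?expR_gt0// ler_sqr ?nnegrE ?expR_ge0//; lra.
Qed.

(** The term [x^2 / 8] is what later pays for the variance of the walk. *)
Lemma ln_slack x : -1 < x <= 1 -> ln (1 + x) <= x - x ^+ 2 / 8.
Proof.
move=> /andP[x1 x2]; rewrite -[leRHS]expRK ler_ln ?posrE ?expR_gt0//; last by lra.
set y := x - _; have y1 : 0 <= 1 + y / 2 by rewrite /y; nra.
have -> : expR y = expR (y / 2) ^+ 2 by rewrite -expRM_natl; congr (expR _); lra.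
apply: le_trans (_ : (1 + y / 2) ^+ 2 <= _); last first.
  by rewrite ler_sqr ?nnegrE ?expR_ge0 // expR_ge1Dx.
rewrite /y; have : 0 <= x ^+ 2 * ((1 - x / 8) ^+ 2 - 1 / 2) by apply: mulr_ge0; nra.
by nra.
Qed.

(* The positions [y p] in [-1, 1] move by [gam] in the directions [u p] until they reach
   an end.  The weights [W i] dominate the exponential of [walk_exponent], and [ka] times
   the sum of [1 - y p ^+ 2] decreases at each step, which ends the walk. *)
Variables (m P : nat) (gam ka ka' A : R) (LG W : nat -> R) (th : nat -> nat -> R)
  (y u : nat -> R).

Definition dead p := 1 <= y p * y p.
(** [gam / 18] times the derivative in [y] of [y th - y^2 th^2 / 8], the term of [p] in
    [walk_exponent]; [walk_var] collects 1/18 of the second-order losses [gam^2 th^2 / 8]. A step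
    thus changes the exponent by exactly 18 (drift - variance). *)
Definition walk_eta i p :=
  if dead p then 0 else gam / 18%:R * (th i p - y p * (th i p * th i p) / 4%:R).
Definition walk_var i :=
  gam * gam / 144%:R * \sum_(p < P) (if dead p then 0 else th i p * th i p).
Definition walk_drift i := \sum_(p < P) u p * walk_eta i p.
Definition walk_damped i := W i / (1 + walk_var i).
(** The quadratic stands for the exponential of the drift. Its weighted sum over the rows involves
    only two moments of the directions, and the damping by [1 + walk_var] absorbs the second one. *)
Definition walk_weight i :=
  walk_damped i * (1 + walk_drift i + walk_drift i * walk_drift i).
Definition walk_pos p := if dead p then y p else y p + gam * u p.
(** Coefficient of [u p] in [ka' (1 - (y p + gam u p)^2)]. The form [0 - 2] mirrors the program,
    whose constants are nonnegative. *)
Definition walk_lin p := if dead p then 0 else (0 - 2%:R) * gam * ka' * y p.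
Definition walk_exponent (y' : nat -> R) i :=
  LG i + \sum_(p < P) (y' p * th i p - y' p ^+ 2 * th i p ^+ 2 / 8).

Hypothesis gam0 : 0 < gam.
Hypothesis gam1 : gam <= 1.
Hypothesis u_sign : forall p, is_sign (u p).
Hypothesis y1 : forall p, (p < P)%N -> y p ^+ 2 <= 1.
Hypothesis th1 : forall i p, (i < m)%N -> (p < P)%N -> `|th i p| <= 1.
Hypothesis W0 : forall i, (i < m)%N -> 0 < W i.

Lemma sign_sqr p : u p ^+ 2 = 1.
Proof. by case: (u_sign p) => ->; rewrite ?sqrrN expr1n. Qed.

Lemma walk_var_ge0 i : 0 <= walk_var i.
Proof.
apply: mulr_ge0; first by rewrite divr_ge0// mulr_ge0// ltW.
by apply: sumr_ge0 => p _; case: ifP => // _; rewrite -expr2 sqr_ge0.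
Qed.

Lemma walk_damped_gt0 i : (i < m)%N -> 0 < walk_damped i.
Proof. by move=> im; rewrite divr_gt0 ?W0// ltr_wpDr// walk_var_ge0. Qed.

Lemma walk_weight_gt0 i : (i < m)%N -> 0 < walk_weight i.
Proof. by move=> im; rewrite mulr_gt0 ?walk_damped_gt0//; nra. Qed.

Lemma walk_drift_le i B : (i < m)%N -> \sum_(p < P) `|th i p| <= B ->
  walk_drift i <= gam / 18 * (5 / 4) * B.
Proof.
move=> im hB; apply: le_trans (_ : gam / 18 * (5 / 4) * \sum_(p < P) `|th i p| <= _); last first.
  by apply: ler_wpM2l => //; move: gam0; lra.
rewrite mulr_sumr; apply: ler_sum => -[p pP] _ /=; rewrite /walk_eta.
have t1 := th1 im pP; have y2 := y1 pP.
have g0 : 0 <= gam / 18 by move: gam0; lra.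
case: ifP => _; first by rewrite mulr0 mulr_ge0// mulr_ge0//; lra.
rewrite mulrCA -[leRHS]mulrA; apply: ler_wpM2l => //.
have : `|y p| <= 1 by rewrite -(@expr_le1 _ 2)// -normrX ger0_norm ?sqr_ge0.
move: t1; case: (u_sign p) => ->; rewrite !ler_norml => t1 y3;
  case: (ger0P (th i p)) => ht; nra.
Qed.

Lemma walk_exponent_step i : (i < m)%N -> walk_drift i <= 1 / 3 ->
  walk_exponent y i <= 18 * ln (W i) + A ->
  walk_exponent walk_pos i <= 18 * ln (walk_weight i) + A.
Proof.
move=> im Z3 H; have Q0 := walk_var_ge0 i.
have lnW : ln (W i) - walk_var i + walk_drift i <= ln (walk_weight i).
  have d0 : 0 < 1 + walk_var i by lra.
  have z0 : 0 < 1 + walk_drift i + walk_drift i * walk_drift i by nra.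
  rewrite /walk_weight /walk_damped lnM ?posrE ?divr_gt0 ?W0// ln_div ?posrE ?W0//.
  have : ln (1 + walk_var i) <= walk_var i by apply: le_ln1Dx; lra.
  have : walk_drift i <= ln (1 + walk_drift i + walk_drift i * walk_drift i).
    by rewrite -[leLHS]expRK ler_ln ?posrE ?expR_gt0// -expr2 expR_quad.
  by lra.
suff -> : walk_exponent walk_pos i = walk_exponent y i + 18 * (walk_drift i - walk_var i) by lra.
rewrite /walk_exponent -addrA; congr (_ + _).
rewrite /walk_drift /walk_var mulrBr !mulr_sumr -sumrB -big_split /=.
apply: eq_bigr => p _; rewrite /walk_pos /walk_eta; case: ifP => _; first by rewrite !mulr0 subr0 addr0.
have := sign_sqr p; set v := u p => v2.
rewrite sqrrD exprMn v2; by field.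
Qed.

(** The linear hypothesis bounds the first-order terms of the weights and of the positions together.
    The second moment of the drift is covered by the damping, while the loss [gam^2] in each live
    [1 - y^2] leaves room for [ka] to grow to [ka']. *)
Lemma walk_potential : 0 <= ka' -> ka' * (1 - gam ^+ 2) <= ka ->
  \sum_(i < m) walk_damped i * (\sum_(p < P) u p * walk_eta i p) ^+ 2
    <= \sum_(i < m) walk_damped i * \sum_(p < P) walk_eta i p ^+ 2 ->
  \sum_(i < m) walk_damped i * (\sum_(p < P) u p * walk_eta i p)
    + \sum_(p < P) walk_lin p * u p <= 0 ->
  \sum_(i < m) walk_weight i + ka' * \sum_(p < P) (1 - walk_pos p ^+ 2)
    <= \sum_(i < m) W i + ka * \sum_(p < P) (1 - y p ^+ 2).
Proof.
move=> ka0 kaka' Hq Hl.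
have E1 : \sum_(i < m) walk_weight i = \sum_(i < m) walk_damped i
   + \sum_(i < m) walk_damped i * walk_drift i + \sum_(i < m) walk_damped i * walk_drift i ^+ 2.
  by rewrite -!big_split /=; apply: eq_bigr => i _; rewrite /walk_weight; ring.
have E2 : \sum_(i < m) walk_damped i * \sum_(p < P) walk_eta i p ^+ 2
    <= \sum_(i < m) walk_damped i * walk_var i.
  apply: ler_sum => -[i im] _ /=; rewrite ler_pM2l ?walk_damped_gt0//.
  rewrite /walk_var mulr_sumr; apply: ler_sum => -[p pP] _ /=.
  rewrite /walk_eta; case: ifP => _; first by rewrite mulr0 expr0n.
  have t1 := th1 im pP; have y2 := y1 pP.
  have : `|y p| <= 1 by rewrite -(@expr_le1 _ 2)// -normrX ger0_norm ?sqr_ge0.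
  have -> : th i p - y p * (th i p * th i p) / 4 = th i p * (1 - y p * th i p / 4) by field.
  move: t1; rewrite !ler_norml => t1 y3.
  (* Hence [(1 - y th / 4)^2 <= 25/16], and [25/16 / 324 <= 1/144]. With an exponent [B] in place of
     18 this reads [25/16 / B^2 <= 1 / (8 B)], that is, [B >= 12.5]. *)
  have yt : -1 <= y p * th i p <= 1 by nra.
  have -> : (gam / 18 * (th i p * (1 - y p * th i p / 4))) ^+ 2
     = gam * gam * (th i p * th i p) * ((1 - y p * th i p / 4) ^+ 2 / 324) by field.
  have -> : gam * gam / 144 * (th i p * th i p) = gam * gam * (th i p * th i p) * (1 / 144) by field.
  by apply: ler_wpM2l; [apply: mulr_ge0; rewrite -expr2 sqr_ge0 | nra].
have E3 : \sum_(i < m) walk_damped i + \sum_(i < m) walk_damped i * walk_var i = \sum_(i < m) W i.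
  rewrite -big_split /=; apply: eq_bigr => i _.
  have Q0 := walk_var_ge0 i; rewrite /walk_damped; field; lra.
have E4 : ka' * \sum_(p < P) (1 - walk_pos p ^+ 2)
    <= ka * \sum_(p < P) (1 - y p ^+ 2) + \sum_(p < P) walk_lin p * u p.
  rewrite !mulr_sumr -big_split /=; apply: ler_sum => -[p pP] _ /=.
  have y2 := y1 pP; rewrite /walk_pos /walk_lin.
  case: ifPn => [|_].
    by rewrite /dead -expr2 => dp; 
      have -> : y p ^+ 2 = 1 by [apply/eqP; rewrite eq_le y2 dp]; rewrite mul0r addr0 subrr !mulr0.
  (* The intermediate value exceeds the exact one by [ka' gam^2 y^2], and its factor
     [ka' (1 - gam^2)] is at most [ka]. *)
  apply: le_trans (_ : ka' * (1 - gam ^+ 2) * (1 - y p ^+ 2) + (0 - 2) * gam * ka' * y p * u p <= _); last first.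
    by rewrite lerD2r ler_wpM2r// subr_ge0.
  have v2 := sign_sqr p; rewrite sqrrD exprMn v2.
  have := mulr_ge0 ka0 (mulr_ge0 (sqr_ge0 gam) (sqr_ge0 (y p))).
  by nra.
by rewrite E1; move: Hq Hl; rewrite /walk_drift; lra.
Qed.

End WalkMath.

(** * Node values carried by the first entry of a node *)

Section Heads.
Local Open Scope ring_scope.
Variables (R : realType) (z : nat) (key : nat -> nat).
Hypothesis key_mono : forall e e', (e < e' < z)%N -> (key e < key e')%N.

Definition is_head pw e := below z key (key e %/ pw * pw) == e.

(** In a nonempty node, [below] at its lower end is the position of the first entry, so exactly one
    entry is a head. An empty node has no head, whence the condition that [G] vanishes there. *)
Lemma segsum_head (G : nat -> R) pw nu : (0 < pw)%N ->
  ((forall e, (e < z)%N -> (key e %/ pw)%N <> nu) -> G nu = 0) ->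
  segsum z key (fun e => if is_head pw e then G (key e %/ pw)%N else 0) pw nu = G nu.
Proof.
move=> p0 Gempty; set e0 := below z key (nu * pw).
case: (boolp.pselect (exists2 e, (e < z)%N & (key e %/ pw)%N = nu)) => [[e ez ke]|H]; last first.
  rewrite Gempty => [|e ez ke]; last by apply: H; exists e.
  by apply: big1 => e /eqP ke; case: H; exists e.
have e0e : (e0 <= e)%N.
  by rewrite leqNgt -(below_lt (fun e e' h => ltnW (key_mono h)) _ ez) -leqNgt -ke leq_divM.
have e0z : (e0 < z)%N by exact: leq_ltn_trans ez.
have k0 : (key e0 %/ pw)%N = nu.
  apply/eqP; rewrite eqn_leq; apply/andP; split; last first.
    by rewrite leq_divRL// leqNgt (below_lt (fun e e' h => ltnW (key_mono h)) _ e0z) ltnn.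
  rewrite -ke leq_div2r//; move: e0e; rewrite leq_eqVlt => /orP[/eqP->//|lt].
  by apply/ltnW/key_mono; rewrite lt.
rewrite /segsum (bigD1 (Ordinal e0z)) /= ?k0// /is_head k0 eqxx big1 ?addr0// => i /andP[/eqP ki].
by rewrite -val_eqE /= eq_sym ki => /negbTE ->.
Qed.

End Heads.

Ltac pstep := let h := fresh "hx" in eapply ev_evP_let; [jauto | intros ? ? h ?; jlift h].

Notation cdead ye := (crle (rnat 1) (rmul (cvar ye) (cvar ye))).

Definition cwalk_step (lpw2 lP lcnt lth lgam st : nat) : lterm :=
  clet (cfst (csnd (cvar st))) (fun y =>
  clet (csnd (csnd (cvar st))) (fun w =>
  clet (rmul (cfst (cvar st)) (radd (rnat 1) (rmul (cvar lgam) (cvar lgam)))) (fun ka =>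
  clet (ctab (cvar Lz) (fun e =>
    clet (cgetR (cvar y) (cpairix lpw2 lP e)) (fun ye =>
    clet (cgetR (cvar lth) (cvar e)) (fun t =>
      cifR (cdead ye) (rnat 0) (rmul (cvar t) (cvar t)))))) (fun sq =>
  clet (csumscan Lz sq) (fun S1 =>
  clet (ctab (cvar Lm) (fun i =>
    rdiv (cgetR (cvar w) (cvar i))
      (radd (rnat 1) (rmul (rdiv (rmul (cvar lgam) (cvar lgam)) (rnat 144))
                           (csumseg S1 i LN))))) (fun wd =>
  clet (ctab (cvar Lz) (fun e =>
    clet (cgetR (cvar y) (cpairix lpw2 lP e)) (fun ye =>
    clet (cgetR (cvar lth) (cvar e)) (fun t =>
      cifR (cdead ye) (rnat 0)
        (rmul (rdiv (cvar lgam) (rnat 18))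
          (rsub (cvar t) (rdiv (rmul (cvar ye) (rmul (cvar t) (cvar t))) (rnat 4)))))))) (fun eta =>
  clet (ctab (cvar lP) (fun p =>
    clet (cgetR (cvar y) (cvar p)) (fun yp =>
      cifR (cdead yp) (rnat 0)
        (rmul (rmul (rmul (rsub (rnat 0) (rnat 2)) (cvar lgam)) (cvar ka)) (cvar yp))))) (fun lin =>
  clet (cchoose lpw2 lP lcnt wd eta lin) (fun u =>
  clet (ctab (cvar Lz) (fun e =>
    rmul (cgetR (cvar u) (cpairix lpw2 lP e)) (cgetR (cvar eta) (cvar e)))) (fun ue =>
  clet (csumscan Lz ue) (fun S2 =>
  cpair (cvar ka)
    (cpair
      (ctab (cvar lP) (fun p =>
        clet (cgetR (cvar y) (cvar p)) (fun yp =>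
          cifR (cdead yp) (cvar yp) (radd (cvar yp) (rmul (cvar lgam) (cgetR (cvar u) (cvar p)))))))
      (ctab (cvar Lm) (fun i =>
        clet (csumseg S2 i LN) (fun zz =>
          rmul (cgetR (cvar wd) (cvar i))
            (radd (radd (rnat 1) (cvar zz)) (rmul (cvar zz) (cvar zz)))))))))))))))))).

Ltac pstep_as v := let h := fresh "hx" in
  apply: (ev_evP_let (u := v)); [eapply ev_eq; [jauto | | exact: leqnn] | intros ? ? h ?; jlift h].

Section WalkProgram.
Variables (R : realType) (W s m n z ell K : nat) (key : nat -> nat) (a : nat -> R).
Hypothesis inst : instance m n z ell K key.
Hypothesis bigW : (2 ^ (20 + 4 * (ell + K)) <= W)%N.
Hypothesis sE : s.+1 = (n + m + z)%N.
Local Notation glob := (globals m n z ell K key a).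
Local Notation lg := (ell + K)%N.
Local Notation nodesum := (segsum z key).
Variables (h c : nat).
Hypothesis hcK : (h.+1 + c)%N = K.
Variable thn : nat -> R.
Hypothesis thn_empty : forall nu,
  (forall e, (e < z)%N -> (key e %/ 2 ^ h.+1)%N <> nu) -> thn nu = 0%R.
Let th i p := thn (i * 2 ^ c + p)%N.
Definition head_theta (e : nat) : R :=
  (if is_head z key (2 ^ h.+1) e then thn (key e %/ 2 ^ h.+1)%N else 0)%R.
Hypothesis th1 : forall nu, (`|thn nu| <= 1)%R.
Variable gam : R.
Hypothesis gam0 : (0 < gam)%R.
Hypothesis gam1 : (gam <= 1)%R.

(** [F p 0 = 0] silences the entries that are not heads, where [head_theta] is 0. *)
Lemma segsum_head_theta (F : nat -> R -> R) i p : (p < 2 ^ c)%N -> (forall p, F p 0%R = 0%R) ->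
  nodesum (fun e => F (pair_index key h c e) (head_theta e)) (2 ^ h.+1) (i * 2 ^ c + p)%N
    = F p (th i p).
Proof.
move=> pc F0.
pose G nu := F (nu %% 2 ^ c)%N (thn nu).
have -> : F p (th i p) = G (i * 2 ^ c + p)%N by rewrite /G modnMDl modn_small.
rewrite -(@segsum_head _ _ _ (in_mono inst) G (2 ^ h.+1)) ?expn_gt0//; last first.
  by move=> H; rewrite /G thn_empty.
apply: eq_segsum => e ez ke; rewrite /head_theta /G /pair_index.
by case: ifP.
Qed.

Variables (y w : nat -> R) (ka : R).
Hypothesis w0 : forall i, (i < m)%N -> (0 < w i)%R.
Hypothesis y1 : forall p, (p < 2 ^ c)%N -> (y p ^+ 2 <= 1)%R.

(** The program only sees arrays over entries, pairs and rows; [segsum_pow] and [segsum_head_theta]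
    translate its row sums into the sums over pairs of the abstract walk. *)
Lemma evP_walk_step E lpw2 lP lcnt lth lgam st : glob E ->
  lookup E lpw2 (VWord (2 ^ h.+1)) -> lookup E lP (VWord (2 ^ c)) ->
  lookup E lcnt (VWord c) -> lookup E lth (arrR head_theta z) ->
  lookup E lgam (VReal gam) ->
  lookup E st (VPair (VReal ka) (VPair (arrR y (2 ^ c)) (arrR w m))) ->
  evalsP W s E (cwalk_step lpw2 lP lcnt lth lgam st)
    (fun v => exists u, 
      let ka' := (ka * (1 + gam * gam))%R in
      let wd := walk_damped (2 ^ c) gam w th y in
      [/\ v = VPair (VReal ka') (VPair (arrR (walk_pos gam y u) (2 ^ c))
                (arrR (walk_weight (2 ^ c) gam w th y u) m)),
      forall p, is_sign (u p),
      (\sum_(i < m) wd i * (\sum_(p < 2 ^ c) u p * walk_eta gam th y i p) ^+ 2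
      <= \sum_(i < m) wd i * \sum_(p < 2 ^ c) walk_eta gam th y i p ^+ 2)%R
      & (\sum_(i < m) wd i * (\sum_(p < 2 ^ c) u p * walk_eta gam th y i p)
        + \sum_(p < 2 ^ c) walk_lin gam ka' y p * u p <= 0)%R])
    (3000 + 1200 * lg + c * (1000 + 400 * lg)).
Proof.
move=> G hpw hP hcnt hth hgam hst; have [w1 w2 w3 [w4 w4'] w5] := W_bounds inst bigW.
have Pn := pow_cn inst hcK.
have W3 : (2 ^ lg * 3 <= W)%N by nia.
have W1000 : (1000 <= W)%N by nia.
have pixP e : (pair_index key h c e < 2 ^ c)%N by rewrite ltn_mod expn_gt0.
have N0 : (0 < 2 ^ K)%N by rewrite expn_gt0.
have rowW i : (i < m)%N -> (i.+1 * 2 ^ K <= W)%N.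
  have /andP[_ mell] := in_m inst; move=> im; apply: leq_trans (_ : 2 ^ lg <= _)%N; last by lia.
  by rewrite expnD leq_mul2r (leq_trans im (ltnW mell)) orbT.
set ka' := (ka * (1 + gam * gam))%R; set wd := walk_damped _ _ _ _ _.
pose eta e : R := (if dead y (pair_index key h c e) then 0 else
   gam / 18%:R * (head_theta e - y (pair_index key h c e) * (head_theta e * head_theta e) / 4%:R))%R.
have etaE i p : (p < 2 ^ c)%N -> nodesum eta (2 ^ h.+1) (i * 2 ^ c + p)%N = walk_eta gam th y i p.
  move=> pc; pose F q (t : R) := (if dead y q then 0 else gam / 18%:R * (t - y q * (t * t) / 4%:R))%R.
  apply: (@segsum_head_theta F) => // q; rewrite /F; case: ifP => // _.
  by rewrite mulr0 mulr0 mul0r subrr mulr0.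
have wdE i : (w i / (1 + gam * gam / 144%:R * nodesum (fun e =>
   if dead y (pair_index key h c e) then 0 else head_theta e * head_theta e) (2 ^ K) i))%R = wd i.
  congr (_ / (1 + _ * _))%R; rewrite -hcK expnD segsum_pow; apply: eq_bigr => p _.
  pose F q (t : R) := (if dead y q then 0 else t * t)%R.
  by apply: (@segsum_head_theta F) => // q; rewrite /F; case: ifP => // _; rewrite mulr0.
apply: evP_cost; first do 3 pstep.
  do 2 pstep.
  pstep_as (arrR wd m); [by auto|by congr VVec; apply: eq_mkseq => i; rewrite /= -wdE|].
  pstep_as (arrR eta z); [by []|].
  pstep_as (arrR (walk_lin gam ka' y) (2 ^ c)); [by []|].
  eapply evP_let.
    by eapply (evP_choose inst bigW sE hcK); first eassumption; jlookup.
  move=> v E' l' [u [-> u_sign Hq Hl]] hx' hl; jlift hx'.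
  pstep.
  pstep.
  apply: (@ev_evP _ _ _ _ _ (VPair (VReal ka') (VPair (arrR (walk_pos gam y u) (2 ^ c))
                (arrR (walk_weight (2 ^ c) gam w th y u) m)))).
    eapply ev_eq; [jauto| |exact: leqnn].
      by auto.
    congr (VPair _ (VPair _ (VVec _))); apply: eq_mkseq => i; congr VReal.
    have -> : nodesum (fun e => u (pair_index key h c e) * eta e)%R (2 ^ K) i
       = walk_drift (2 ^ c) gam th y u i.
      rewrite (row_eta z key hcK eta u i) /walk_drift; apply: eq_bigr => -[p pP] _ /=.
      by rewrite etaE.
    by [].
  exists u; split => //.
  - have EQ1 (f : nat -> R -> R) :
       (\sum_(i < m) wd i * \sum_(p < 2 ^ c) f p (nodesum eta (2 ^ h.+1) (i * 2 ^ c + p)%N)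
       = \sum_(i < m) wd i * \sum_(p < 2 ^ c) f p (walk_eta gam th y i p))%R.
      by apply: eq_bigr => i _; congr (_ * _)%R; apply: eq_bigr => -[p pP] _ /=; rewrite etaE.
    have EQ2 : (\sum_(i < m) wd i * (\sum_(p < 2 ^ c) u p * nodesum eta (2 ^ h.+1) (i * 2 ^ c + p)%N) ^+ 2
       = \sum_(i < m) wd i * (\sum_(p < 2 ^ c) u p * walk_eta gam th y i p) ^+ 2)%R.
      apply: eq_bigr => i _; congr (_ * _ ^+ 2)%R; apply: eq_bigr => -[p pP] _ /=; by rewrite etaE.
    by move: Hq; rewrite EQ2 (EQ1 (fun _ x => x ^+ 2)%R).
  - have EQ3 : (\sum_(i < m) wd i * (\sum_(p < 2 ^ c) u p * nodesum eta (2 ^ h.+1) (i * 2 ^ c + p)%N)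
       = \sum_(i < m) wd i * (\sum_(p < 2 ^ c) u p * walk_eta gam th y i p))%R.
      apply: eq_bigr => i _; congr (_ * _)%R; apply: eq_bigr => -[p pP] _ /=; by rewrite etaE.
    by move: Hl; rewrite EQ3.
lia.
Qed.

End WalkProgram.

Definition cwalk (lpw2 lP lcnt lth lgam lT lka lw : nat) : lterm :=
  cfor (cvar lT)
    (cpair (cvar lka) (cpair (ctab (cvar lP) (fun=> rnat 0)) (cvar lw)))
    (fun _ st => cwalk_step lpw2 lP lcnt lth lgam st).

Section WalkLoop.
Variables (R : realType) (W s m n z ell K : nat) (key : nat -> nat) (a : nat -> R).
Hypothesis inst : instance m n z ell K key.
Hypothesis bigW : (2 ^ (20 + 4 * (ell + K)) <= W)%N.
Hypothesis sE : s.+1 = (n + m + z)%N.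
Local Notation glob := (globals m n z ell K key a).
Local Notation lg := (ell + K)%N.
Variables (h c : nat).
Hypothesis hcK : (h.+1 + c)%N = K.
Variable thn : nat -> R.
Hypothesis thn_empty : forall nu,
  (forall e, (e < z)%N -> (key e %/ 2 ^ h.+1)%N <> nu) -> thn nu = 0%R.
Let th i p := thn (i * 2 ^ c + p)%N.
Hypothesis th1 : forall nu, (`|thn nu| <= 1)%R.
Variable k : nat.
Hypothesis k0 : (0 < k)%N.
Let gam : R := (1 / k%:R)%R.
Variables (ka0 A B : R) (w LG : nat -> R) (T : nat).
Hypothesis TW : (T < W)%N.
Hypothesis ka00 : (0 < ka0)%R.
Hypothesis w0 : forall i, (i < m)%N -> (0 < w i)%R.
Hypothesis LGw : forall i, (i < m)%N -> (LG i <= 18 * ln (w i) + A)%R.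
Hypothesis thB : forall i, (i < m)%N -> (\sum_(p < 2 ^ c) `|th i p| <= B)%R.
Hypothesis gamB : (gam / 18 * (5 / 4) * B <= 1 / 3)%R.
Hypothesis Tend : (\sum_(i < m) w i + ka0 * (2 ^ c)%:R < ka0 * (1 + gam * gam) ^+ T * gam)%R.

(** The walk starts at 0 with steps [1 / k], so it meets -1 and 1 exactly and never jumps over
    them. *)
Definition on_grid (x : R) := exists2 v, (v <= 2 * k)%N & (x = v%:R / k%:R - 1)%R.

Lemma gam_gt0 : (0 < gam)%R. Proof. by rewrite divr_gt0 ?ltr0n. Qed.

Lemma gam_le1 : (gam <= 1)%R.
Proof. by rewrite ler_pdivrMr ?ltr0n// mul1r ler1n. Qed.

Lemma grid_le1 x : on_grid x -> (x ^+ 2 <= 1)%R.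
Proof.
move=> [v vk ->]; have k1 : (0 < k%:R :> R)%R by rewrite ltr0n.
have : (v%:R / k%:R <= 2 :> R)%R by rewrite ler_pdivrMr// -natrM ler_nat.
have : (0 <= v%:R / k%:R :> R)%R by rewrite divr_ge0.
by nra.
Qed.

(* A point of the grid other than +-1 has slack at least 1/k in [1 - x^2]. *)
Lemma grid_slack x : on_grid x -> ~~ (1 <= x * x)%R ->
  (gam <= 1 - x ^+ 2)%R /\ (on_grid (x + gam) /\ on_grid (x - gam)).
Proof.
move=> [v vk xE] nd; have k1 : (0 < k%:R :> R)%R by rewrite ltr0n.
have kE : (k%:R * gam = 1 :> R)%R by rewrite /gam mul1r mulfV// lt0r_neq0.
have xk : (x * k%:R = v%:R - k%:R)%R by rewrite xE mulrBl mul1r divfK// lt0r_neq0.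
have v0 : (0 < v)%N.
  rewrite lt0n; apply/eqP => v0; move: nd; rewrite xE v0 mul0r sub0r mulrNN mulr1.
  by rewrite lexx.
have v2 : (v < 2 * k)%N.
  rewrite ltn_neqAle vk andbT; apply/eqP => vE; move: nd; rewrite xE vE natrM mulfK ?lt0r_neq0//.
  have -> : (2 - 1 = 1 :> R)%R by lra.
  by rewrite mulr1 lexx.
split; last split.
- have g0 := gam_gt0.
  have gk : ((1 - gam) * k%:R = k%:R - 1 :> R)%R by rewrite mulrBl mul1r [(gam * _)%R]mulrC kE.
  have x1 : (x <= 1 - gam)%R.
    rewrite -(ler_pM2r k1) gk xk.
    have : ((v.+1)%:R <= (2 * k)%:R :> R)%R by rewrite ler_nat.
    by rewrite -natr1 natrM => ?; lra.
  have x2 : (- (1 - gam) <= x)%R.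
    rewrite -(ler_pM2r k1) mulNr gk xk.
    have : (1 <= v%:R :> R)%R by rewrite ler1n.
    by move=> ?; lra.
  have := gam_le1; nra.
- exists v.+1 => //; rewrite xE -natr1 mulrDl /gam; lra.
- exists v.-1; first by lia.
  by rewrite xE -subn1 natrB// mulrBl /gam; lra.
Qed.

Definition walk_inv t (v : value R) := exists y' w' : nat -> R,
  [/\ v = VPair (VReal (ka0 * (1 + gam * gam) ^+ t)%R) (VPair (arrR y' (2 ^ c)) (arrR w' m)),
      forall p, (p < 2 ^ c)%N -> on_grid (y' p),
      forall i, (i < m)%N -> (0 < w' i)%R,
      forall i, (i < m)%N -> (walk_exponent (2 ^ c) LG th y' i <= 18 * ln (w' i) + A)%R
    & (\sum_(i < m) w' i + ka0 * (1 + gam * gam) ^+ t * \sum_(p < 2 ^ c) (1 - y' p ^+ 2)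
        <= \sum_(i < m) w i + ka0 * (2 ^ c)%:R)%R].

(** The factor of the sum of [1 - y^2] grows exponentially while the whole potential stays bounded.
    After [T] steps one live position, by [grid_slack] and [Tend], would exceed the potential, so
    all have stopped. *)
Lemma evP_walk E lpw2 lP lcnt lth lgam lT lka lw : glob E ->
  lookup E lpw2 (VWord (2 ^ h.+1)) -> lookup E lP (VWord (2 ^ c)) ->
  lookup E lcnt (VWord c) -> lookup E lth (arrR (head_theta z key h thn) z) ->
  lookup E lgam (VReal gam) -> lookup E lT (VWord T) -> lookup E lka (VReal ka0) ->
  lookup E lw (arrR w m) ->
  evalsP W s E (cwalk lpw2 lP lcnt lth lgam lT lka lw)
    (fun v => exists ka' (y' w' : nat -> R),
     [/\ v = VPair (VReal ka') (VPair (arrR y' (2 ^ c)) (arrR w' m)),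
      forall p, (p < 2 ^ c)%N -> is_sign (y' p),
      forall i, (i < m)%N -> (0 < w' i)%R,
      forall i, (i < m)%N -> (walk_exponent (2 ^ c) LG th y' i <= 18 * ln (w' i) + A)%R
    & (\sum_(i < m) w' i <= \sum_(i < m) w i + ka0 * (2 ^ c)%:R)%R])
    (100 + T * (4000 + 1200 * lg + c * (1000 + 400 * lg))).
Proof.
move=> G hpw hP hcnt hth hgam hT hka hw; have [w1 w2 w3 [w4 w4'] w5] := W_bounds inst bigW.
have Pn := pow_cn inst hcK.
have g0 := gam_gt0; have g1 := gam_le1.
apply: (@evP_le _ _ _ _ _ (walk_inv T)); first apply: (evP_for (Inv := walk_inv)).
- by jauto.
- apply: ev_evP; first by jauto; lia.
  exists (fun=> 0%R), w; split => //.
  + by rewrite expr0 mulr1.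
  + by move=> p _; exists k; rewrite ?leq_pmull// mulfV ?subrr// pnatr_eq0 -lt0n.
  + move=> i im; rewrite /walk_exponent big1 ?addr0 ?LGw// => p _.
    by rewrite mul0r expr0n mul0r mul0r subrr.
  + by rewrite expr0 mulr1 expr0n subr0 sumr_const card_ord.
- exact: TW.
- move=> t u E1 li lu tT [y' [w' [-> y'g w'0 w'E w'S]]] hx hi hu; jlift hx.
  have y'1 p : (p < 2 ^ c)%N -> (y' p ^+ 2 <= 1)%R by move=> /y'g /grid_le1.
  have th1' i p : (i < m)%N -> (p < 2 ^ c)%N -> (`|th i p| <= 1)%R by move=> _ _; exact: th1.
  apply: evP_le; first by eapply (evP_walk_step inst bigW sE hcK thn_empty g0 g1); first eassumption; jlookup.
  + move=> v [sg [-> sgS Hq Hl]].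
    exists (walk_pos gam y' sg), (walk_weight (2 ^ c) gam w' th y' sg); split.
    * by rewrite exprSr mulrA.
    * move=> p pP; rewrite /walk_pos; case: ifPn => dp; first exact: y'g.
      have [_ [gp gm]] := grid_slack (y'g p pP) dp.
      by case: (sgS p) => ->; rewrite ?mulr1 ?mulrN1.
    * by move=> i im; apply: (@walk_weight_gt0 _ m).
    * move=> i im; apply: (@walk_exponent_step _ m) => //; last exact: w'E.
      apply: le_trans gamB; apply: (@walk_drift_le _ m) => //; exact: thB.
    * rewrite exprSr mulrA; apply: le_trans w'S; apply: walk_potential => //.
        by rewrite !mulr_ge0// ?exprn_ge0// ltW//; nra.
      rewrite -mulrA -[leRHS]mulr1 ler_wpM2l//; last by nra.
      by rewrite mulr_ge0// ?exprn_ge0// ltW//; nra.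
  + exact: leqnn.
- move=> v [y' [w' [-> y'g w'0 w'E w'S]]].
  exists (ka0 * (1 + gam * gam) ^+ T)%R, y', w'; split => //.
  + move=> p pP; case: (boolP (1 <= y' p * y' p)%R) => dp.
      have y1 := grid_le1 (y'g p pP).
      have : (y' p ^+ 2 == 1)%R by rewrite eq_le y1 expr2 dp.
      by rewrite sqrf_eq1 => /orP[]/eqP; [left|right].
    have [sl _] := grid_slack (y'g p pP) dp; exfalso.
    move: w'S; apply/negP; rewrite -ltNge; apply: lt_le_trans Tend _.
    have ge0 : (0 <= ka0 * (1 + gam * gam) ^+ T)%R by rewrite mulr_ge0 ?exprn_ge0// ?ltW//; nra.
    rewrite -[leLHS]add0r; apply: lerD; first by apply: sumr_ge0 => -[i im] _; exact/ltW/w'0.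
    rewrite ler_wpM2l// (bigD1 (Ordinal pP))//= (le_trans sl)// lerDl.
    by apply: sumr_ge0 => -[q qP] _ /=; rewrite subr_ge0 grid_le1//; exact: y'g.
  + apply: le_trans w'S; rewrite lerDl mulr_ge0//; first by rewrite mulr_ge0 ?exprn_ge0// ?ltW//; nra.
    by apply: sumr_ge0 => -[q qP] _ /=; rewrite subr_ge0 grid_le1//; exact: y'g.
- by lia.
Qed.

End WalkLoop.

(** * Merging pairs of columns *)

Section MergeMath.
Local Open Scope ring_scope.
Variable R : realType.
Implicit Types x y : R.

(* [cosh] and [tanh] of [ln x], as rational functions of [x]. *)
Definition coshln x := (x + x^-1) / 2.
Definition tanhln x := (x * x - 1) / (x * x + 1).

Definition spow x (eps : R) := if 0 <= eps then x else 1 / x.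

Lemma spow_gt0 x eps : 0 < x -> 0 < spow x eps.
Proof. by move=> x0; rewrite /spow; case: ifP => _ //; rewrite divr_gt0. Qed.

Lemma coshln_ge1 x : 0 < x -> 1 <= coshln x.
Proof.
move=> x0; rewrite /coshln ler_pdivlMr// mul1r.
rewrite -subr_ge0; have -> : x + x^-1 - 2 = (x - 1) ^+ 2 / x by field; lra.
by rewrite divr_ge0 ?sqr_ge0 ?ltW.
Qed.

Lemma coshln_gt0 x : 0 < x -> 0 < coshln x.
Proof. by move=> /coshln_ge1; apply: lt_le_trans. Qed.

(** [cosh (u + v) = cosh u cosh v (1 + tanh u tanh v)] at [u = ln x] and [v = eps ln y]. *)
Lemma coshlnM x y eps : 0 < x -> 0 < y -> is_sign eps ->
  coshln (x * spow y eps) = coshln x * coshln y * (1 + eps * (tanhln x * tanhln y)).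
Proof.
move=> x0 y0 s.
have x2 : x * x + 1 != 0 by apply: lt0r_neq0; nra.
have y2 : y * y + 1 != 0 by apply: lt0r_neq0; nra.
have x1 : x != 0 by rewrite lt0r_neq0.
have y1 : y != 0 by rewrite lt0r_neq0.
rewrite /coshln /spow /tanhln; case: s => ->; rewrite ?ler01 ?ler0N1 /=.
  by field; rewrite x1 y1 x2 y2.
by field; rewrite x1 y1 x2 y2.
Qed.

Lemma tanhln_lt1 x : 0 < x -> -1 < tanhln x < 1.
Proof.
move=> x0; have x2 : 0 < x * x + 1 by nra.
rewrite /tanhln ltr_pdivlMr// ltr_pdivrMr// mul1r mulN1r; apply/andP; split; nra.
Qed.

Lemma tanhlnM_lt1 x y : 0 < x -> 0 < y -> -1 < tanhln x * tanhln y < 1.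
Proof. by move=> /tanhln_lt1/andP[? ?] /tanhln_lt1/andP[? ?]; apply/andP; split; nra. Qed.

Lemma ln_merge x y eps : 0 < x -> 0 < y -> is_sign eps ->
  let t := tanhln x * tanhln y in
  ln (coshln (x * spow y eps)) <= ln (coshln x) + ln (coshln y) + (eps * t - eps ^+ 2 * t ^+ 2 / 8).
Proof.
move=> x0 y0 s /=; rewrite coshlnM//; set t := _ * tanhln y.
have /andP[t1 t2] : -1 < t < 1 by exact: tanhlnM_lt1.
have e2 : eps ^+ 2 = 1 by case: s => ->; rewrite ?sqrrN expr1n.
have /andP[s1 s2] : -1 < eps * t < 1.
  by case: s => ->; rewrite ?mul1r ?mulN1r; apply/andP; split; lra.
have [cx cy] := (coshln_gt0 x0, coshln_gt0 y0).
have cc := mulr_gt0 cx cy.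
rewrite (@lnM _ (coshln x * coshln y)) ?posrE//; last by lra.
rewrite (@lnM _ (coshln x)) ?posrE//.
rewrite lerD2l e2 mul1r; have := @ln_slack _ (eps * t).
by rewrite s1 ltW// exprMn e2 mul1r; apply.
Qed.

(** Let [c] be the product of the two [coshln]. The merged node has [cosh >= 1] for both relative
    signs, that is [1 / c <= 1 + eps t]; so [- eps t <= 1 - 1 / c <= ln c]. *)
Lemma tanh_le_ln x y : 0 < x -> 0 < y ->
  `|tanhln x * tanhln y| <= ln (coshln x) + ln (coshln y).
Proof.
move=> x0 y0; set t := _ * tanhln y.
suff H eps : is_sign eps -> - (eps * t) <= ln (coshln x) + ln (coshln y).
  have H1 := H (-1) (or_intror erefl); have H2 := H 1 (or_introl erefl).
  by rewrite ler_norml; apply/andP; split; lra.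
move=> s; have H := coshlnM x0 y0 s; rewrite -/t in H.
have g1 := coshln_ge1 (mulr_gt0 x0 (spow_gt0 eps y0)).
have c0 := mulr_gt0 (coshln_gt0 x0) (coshln_gt0 y0).
rewrite -(@lnM _ (coshln x)) ?posrE ?coshln_gt0//.
set c := coshln x * coshln y in H c0 *.
have : 1 / c <= 1 + eps * t by rewrite ler_pdivrMr// mulrC -H.
have : ln (1 / c) <= 1 / c - 1.
  by have := @le_ln1Dx _ (1 / c - 1); rewrite [1 + _]addrC subrK; apply; have := divr_gt0 ltr01 c0; lra.
by rewrite div1r lnV ?posrE//; lra.
Qed.

Lemma bernoulli x k : 0 <= x -> 1 + k%:R * x <= (1 + x) ^+ k.
Proof.
move=> x0; elim: k => [|k IH]; first by rewrite mul0r addr0.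
have k0 : 0 <= k%:R :> R by [].
rewrite exprS -natr1; apply: le_trans (_ : (1 + x) * (1 + k%:R * x) <= _).
  have : 0 <= k%:R * x * x by rewrite !mulr_ge0.
  by lra.
by rewrite ler_wpM2l// addr_ge0.
Qed.

End MergeMath.

(** * The log-potential of the blocks from one level to the next *)

Section Levels.
Local Open Scope ring_scope.
Variables (R : realType) (m z K : nat) (key : nat -> nat) (x : nat -> R).
Hypothesis x0 : forall e, 0 < x e.
Local Notation nodeprod := (segprod z key).

Definition signed_x (eps : nat -> R) (e : nat) := spow (x e) (eps (key e %% 2 ^ K)%N).

(* Once the signs are chosen within the blocks of [2 ^ h] columns, the blocks of row [i]
   are independent: this is the logarithm of the mean of [\prod_e x e ^ (+-1)] over the signs
   of the blocks. *)
Definition log_potential h eps i := \sum_(q < 2 ^ (K - h))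
  ln (coshln (nodeprod (signed_x eps) (2 ^ h) (i * 2 ^ (K - h) + q)%N)).

Definition merge_signs h (y eps : nat -> R) j :=
  if odd (j %/ 2 ^ h) then eps j * y (j %/ (2 ^ h * 2))%N else eps j.

Definition node_theta h eps nu :=
  tanhln (nodeprod (signed_x eps) (2 ^ h) (nu * 2)%N) *
  tanhln (nodeprod (signed_x eps) (2 ^ h) (nu * 2 + 1)%N).

Lemma signed_x_gt0 eps e : 0 < signed_x eps e.
Proof. exact: spow_gt0. Qed.

Lemma segprod_gt0 eps pw nu : 0 < nodeprod (signed_x eps) pw nu.
Proof. by apply: prodr_gt0 => e _; exact: signed_x_gt0. Qed.

Lemma node_theta_lt1 h eps nu : `|node_theta h eps nu| <= 1.
Proof.
have /andP[h1 h2] := tanhlnM_lt1 (segprod_gt0 eps (2 ^ h) (nu * 2)) (segprod_gt0 eps (2 ^ h) (nu * 2 + 1)).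
by rewrite ler_norml; apply/andP; split; apply: ltW.
Qed.

Lemma node_theta_empty h eps nu :
  (forall e, (e < z)%N -> (key e %/ 2 ^ h.+1)%N <> nu) -> node_theta h eps nu = 0.
Proof.
move=> H; rewrite /node_theta.
have -> : nodeprod (signed_x eps) (2 ^ h) (nu * 2) = 1.
  apply: big1 => e /eqP ke; case: (H e) => //.
  by rewrite expnSr divnMA ke mulnK.
by rewrite /tanhln mulr1 subrr mul0r mul0r.
Qed.

Section OneLevel.
Variables (h c : nat) (eps : nat -> R).
Hypothesis hcK : (h.+1 + c)%N = K.
Let X nu := nodeprod (signed_x eps) (2 ^ h) nu.

Lemma log_potential_pairs i : log_potential h eps i =
  \sum_(p < 2 ^ c) (ln (coshln (X ((i * 2 ^ c + p) * 2)%N)) + ln (coshln (X ((i * 2 ^ c + p) * 2 + 1)%N))).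
Proof.
rewrite /log_potential.
have -> : (2 ^ (K - h) = (2 ^ c).*2)%N by rewrite -muln2 -expnSr; congr (_ ^ _)%N; lia.
rewrite (sum_double (fun q => ln (coshln (nodeprod (signed_x eps) (2 ^ h) (i * (2 ^ c).*2 + q)%N)))).
by apply: eq_bigr => p _; congr (ln (coshln (nodeprod _ _ _)) + ln (coshln (nodeprod _ _ _))); lia.
Qed.

(** Through this bound the invariant on the log-potential limits the drift of a step, see
    [walk_drift_le]. *)
Lemma theta_sum i : \sum_(p < 2 ^ c) `|node_theta h eps (i * 2 ^ c + p)| <= log_potential h eps i.
Proof.
rewrite log_potential_pairs; apply: ler_sum => p _.
by apply: tanh_le_ln; exact: segprod_gt0.
Qed.

Variable y : nat -> R.
Hypothesis eps_sign : forall j, is_sign (eps j).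
Hypothesis y_sign : forall p, (p < 2 ^ c)%N -> is_sign (y p).
Hypothesis keym : forall e, (e < z)%N -> (key e < m * 2 ^ K)%N.

Lemma segprod_merge i p : (p < 2 ^ c)%N ->
  nodeprod (signed_x (merge_signs h y eps)) (2 ^ h.+1) (i * 2 ^ c + p)%N =
  X ((i * 2 ^ c + p) * 2)%N * spow (X ((i * 2 ^ c + p) * 2 + 1)%N) (y p).
Proof.
move=> pc; rewrite expnSr segprod_double; set nu := (i * 2 ^ c + p)%N.
have -> : nu.*2.+1 = (nu * 2 + 1)%N by lia.
rewrite -muln2.
have eN : (2 ^ K = 2 ^ c * (2 ^ h * 2))%N by rewrite -expnSr -expnD addnC hcK.
have bitE e : odd ((key e %% 2 ^ K) %/ 2 ^ h) = odd (key e %/ 2 ^ h).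
  by rewrite odd_mod_pow//; lia.
have pE e : (key e %/ (2 ^ h * 2))%N = nu -> (key e %% 2 ^ K %/ (2 ^ h * 2))%N = p.
  by move=> ke; rewrite eN -modn_divl ke /nu modnMDl modn_small.
congr (_ * _).
  apply: eq_segprod => e ez ke; rewrite /signed_x /merge_signs bitE ke.
  by rewrite oddM andbF.
have nodeE e : (key e %/ 2 ^ h = nu * 2 + 1)%N -> (key e %/ (2 ^ h * 2))%N = nu.
  by move=> ke; rewrite divnMA ke; lia.
have sE e : (key e %/ 2 ^ h)%N = (nu * 2 + 1)%N ->
    signed_x (merge_signs h y eps) e = spow (signed_x eps e) (y p).
  move=> ke; rewrite /signed_x /merge_signs bitE ke addn1 /= oddM andbF /= (pE _ (nodeE e ke)).
  have y1 := y_sign pc; have e1 := eps_sign (key e %% 2 ^ K)%N.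
  rewrite /spow; case: y1 => ->; case: e1 => ->;
    rewrite ?mulr1 ?mulrN1 ?opprK ?ler01 ?ler0N1 /=//.
  by rewrite div1r div1r invrK.
rewrite (@eq_segprod _ _ _ _ (fun e => spow (signed_x eps e) (y p))); last by move=> e _; exact: sE.
rewrite /X /spow /segprod; case: ifP => _ //.
by rewrite div1r -prodfV; apply: eq_bigr => e _; rewrite div1r.
Qed.

Lemma merge_sign_sign j : (j < 2 ^ K)%N -> is_sign (merge_signs h y eps j).
Proof.
move=> jK; rewrite /merge_signs; case: ifP => _ //.
have : (j %/ (2 ^ h * 2) < 2 ^ c)%N.
  rewrite ltn_divLR ?muln_gt0 ?expn_gt0//; apply: leq_trans jK _.
  by rewrite -expnSr -expnD addnC hcK.
move=> /y_sign y1; have e1 := eps_sign j; rewrite /is_sign.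
by case: y1 => ->; case: e1 => ->; rewrite ?mulr1 ?mulrN1 ?opprK; auto.
Qed.

Lemma log_potential_merge i :
  log_potential h.+1 (merge_signs h y eps) i <=
  walk_exponent (2 ^ c) (log_potential h eps) (fun i p => node_theta h eps (i * 2 ^ c + p)) y i.
Proof.
rewrite /walk_exponent log_potential_pairs -big_split /=.
rewrite /log_potential; have -> : (K - h.+1 = c)%N by lia.
apply: ler_sum => -[p pc] _ /=; rewrite segprod_merge//.
apply: ln_merge; [exact: segprod_gt0|exact: segprod_gt0|exact: y_sign].
Qed.

End OneLevel.
End Levels.

Notation ctanhln x :=
  (rdiv (rsub (rmul (cvar x) (cvar x)) (rnat 1)) (radd (rmul (cvar x) (cvar x)) (rnat 1))).

Definition clevel (lx lgam lT lka h st : nat) : lterm :=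
  clet (cfst (cvar st)) (fun pw =>
  clet (cfst (csnd (cvar st))) (fun eps =>
  clet (csnd (csnd (cvar st))) (fun w =>
  clet (cmul (cvar pw) (cword 2)) (fun pw2 =>
  clet (cdiv (cvar LN) (cvar pw2)) (fun P =>
  clet (csub (cvar LK) (cadd (cvar h) (cword 1))) (fun cnt =>
  clet (ctab (cvar Lz) (fun e =>
    clet (cgetR (cvar lx) (cvar e)) (fun x =>
      cifR (crle (rnat 0) (cgetR (cvar eps) (ccol e))) (cvar x) (rdiv (rnat 1) (cvar x))))) (fun xs =>
  clet (cprodscan Lz xs) (fun PX =>
  clet (ctab (cvar Lz) (fun e =>
    clet (cnode pw2 e) (fun nu =>
    clet (cmul (cvar nu) (cvar pw2)) (fun b =>
    clet (clb b) (fun l0 =>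
      cifR (ceq (cvar l0) (cvar e))
        (clet (cmul (cvar nu) (cword 2)) (fun n0 =>
         clet (cadd (cvar n0) (cword 1)) (fun n1 =>
         clet (cprodseg PX n0 pw) (fun x0 =>
         clet (cprodseg PX n1 pw) (fun x1 => rmul (ctanhln x0) (ctanhln x1))))))
        (rnat 0)))))) (fun th =>
  clet (cwalk pw2 P cnt th lgam lT lka w) (fun r =>
  clet (cfst (csnd (cvar r))) (fun y =>
  cpair (cvar pw2)
    (cpair
      (ctab (cvar Ln) (fun j =>
        cifR (cbit (cvar j) (cvar pw))
          (rmul (cgetR (cvar eps) (cvar j)) (cgetR (cvar y) (cdiv (cvar j) (cvar pw2))))
          (cgetR (cvar eps) (cvar j))))
      (csnd (csnd (cvar r))))))))))))))).

Lemma ell_gt0 m n z ell K key : instance m n z ell K key -> (0 < ell)%N.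
Proof. by move=> /in_m/andP[m0]; case: ell => //; rewrite expn0; lia. Qed.

Section LevelProgram.
Variables (R : realType) (W s m n z ell K : nat) (key : nat -> nat) (a : nat -> R).
Hypothesis inst : instance m n z ell K key.
Hypothesis bigW : (2 ^ (20 + 4 * (ell + K)) <= W)%N.
Hypothesis sE : s.+1 = (n + m + z)%N.
Local Notation glob := (globals m n z ell K key a).
Local Notation lg := (ell + K)%N.
Variable x : nat -> R.
Hypothesis x0 : forall e, (0 < x e)%R.

(** By [bernoulli] the factor of the positions at least doubles every [(4 ell)^2] steps. Of the
    doublings, [2 K] cancel [kappa0] and [2 ell + 4] outweigh [m + 2] divided by the step size. *)
Definition walk_len := ((4 * ell) * (4 * ell) * (2 * K + 2 * ell + 4))%N.
Definition step_size : R := (1 / (4 * ell)%N%:R)%R.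
(** A level adds at most [kappa0 2^K = 1 / 2^K] to the total weight, so all [K] levels together add
    less than 1. *)
Definition kappa0 : R := (1 / ((2 ^ K)%N%:R * (2 ^ K)%N%:R))%R.

Lemma ln2_le1 : (ln 2 <= 1 :> R)%R.
Proof. by have := @le_ln1Dx R 1; have -> : (1 + 1 = 2 :> R)%R by []; apply; lra. Qed.

Lemma ln_m : (ln (m.+1)%:R <= ell%:R :> R)%R.
Proof.
apply: le_trans (_ : ln ((2 ^ ell)%N%:R : R) <= _)%R.
  by rewrite ler_ln ?posrE ?ltr0n ?expn_gt0// ler_nat; have /andP[] := in_m inst.
by rewrite natrX lnXn// -[leLHS]mulr_natl -[leRHS]mulr1 ler_wpM2l// ln2_le1.
Qed.

Lemma walk_len_W : (walk_len < W)%N.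
Proof.
have ell1 : (ell < 2 ^ ell)%N by exact: ltn_expl.
have K1 : (K < 2 ^ K)%N by exact: ltn_expl.
have e0 := ell_gt0 inst.
apply: leq_trans bigW; rewrite /walk_len.
have -> : (2 ^ (20 + 4 * lg) = 2 ^ 20 * (2 ^ ell * 2 ^ ell * 2 ^ ell * 2 ^ ell) * (2 ^ K * 2 ^ K * 2 ^ K * 2 ^ K))%N.
  by rewrite -!expnD; congr (_ ^ _)%N; lia.
set E := (2 ^ ell)%N in ell1 *; set N := (2 ^ K)%N in K1 *.
have h1 : (ell * ell <= E * E)%N by nia.
have h2 : (K + ell + 2 <= 2 * (E * N))%N by nia.
apply: (@leq_trans (2 ^ 20 * (E * E) * (E * N))%N); last first.
  have -> : (2 ^ 20 * (E * E * E * E) * (N * N * N * N) = 2 ^ 20 * (E * E) * (E * N) * (E * N * N * N))%N by ring.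
  by rewrite leq_pmulr//; nia.
apply: (@leq_trans (32 * (E * E) * (2 * (E * N))).+1)%N; last by nia.
rewrite ltnS; have -> : (4 * ell * (4 * ell) * (2 * K + 2 * ell + 4) = 32 * (ell * ell) * (K + ell + 2))%N by ring.
by apply: leq_mul => //; rewrite leq_mul2l h1 orbT.
Qed.

Lemma walk_end c (w : nat -> R) : (c < K)%N -> (\sum_(i < m) w i <= m.+1%:R)%R ->
  (\sum_(i < m) w i + kappa0 * (2 ^ c)%N%:R < kappa0 * (1 + step_size * step_size) ^+ walk_len * step_size)%R.
Proof.
move=> cK sw; have e0 := ell_gt0 inst.
have ell1 : (ell < 2 ^ ell)%N by exact: ltn_expl.
set k := (4 * ell)%N; have k0 : (0 < k%:R :> R)%R by rewrite ltr0n muln_gt0.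
have N0 : (0 < (2 ^ K)%:R :> R)%R by rewrite ltr0n expn_gt0.
have b1 : (2 <= (1 + step_size * step_size) ^+ (k * k))%R.
  apply: le_trans (bernoulli (k * k) _); last by rewrite mulr_ge0// divr_ge0// ltW.
  rewrite natrM /step_size -/k; have -> : (k%:R * k%:R * (1 / k%:R * (1 / k%:R)) = 1 :> R)%R.
    by field; rewrite lt0r_neq0.
  lra.
have b2 : ((2 ^ (2 * K + 2 * ell + 4))%N%:R <= (1 + step_size * step_size) ^+ walk_len)%R.
  rewrite /walk_len -/k exprM natrX; apply: lerXn2r => //; rewrite nnegrE //.
  by apply: le_trans b1.
have kap : (kappa0 * (2 ^ c)%N%:R <= 1)%R.
  rewrite /kappa0 mulrAC mul1r ler_pdivrMr ?mulr_gt0// mul1r -natrM ler_nat.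
  apply: leq_trans (_ : 2 ^ K <= _)%N; first by rewrite leq_exp2l// ltnW.
  by rewrite leq_pmulr// expn_gt0.
apply: le_lt_trans (_ : (m.+2%:R : R) < _)%R; first by rewrite -natr1; apply: lerD.
apply: lt_le_trans (_ : kappa0 * (2 ^ (2 * K + 2 * ell + 4))%N%:R * step_size <= _)%R; last first.
  have s0 : (0 <= step_size)%R by rewrite divr_ge0.
  have ka0 : (0 <= kappa0)%R by rewrite divr_ge0// mulr_ge0.
  by rewrite ler_wpM2r// ler_wpM2l.
have -> : (2 ^ (2 * K + 2 * ell + 4) = 2 ^ K * 2 ^ K * (16 * (2 ^ ell * 2 ^ ell)))%N.
  by rewrite mulnC -(expnD _ K) -(expnD _ ell) -[16]/(2 ^ 4)%N -!expnD; congr (_ ^ _)%N; lia.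
have -> : (kappa0 * (2 ^ K * 2 ^ K * (16 * (2 ^ ell * 2 ^ ell)))%N%:R * step_size =
  (16 * (2 ^ ell * 2 ^ ell))%N%:R / k%:R :> R)%R.
  rewrite (natrM _ (2 ^ K * 2 ^ K)%N) (natrM _ (2 ^ K)%N) /kappa0 /step_size -/k; field.
  by rewrite !lt0r_neq0.
rewrite ltr_pdivlMr// -natrM ltr_nat.
have /andP[_ mell] := in_m inst.
rewrite /k; nia.
Qed.

Let A : R := (ell%:R / 2)%R.
Local Notation LG := (log_potential z K key x).

(** [w i] bounds the 18th root of the row potential up to the factor [exp (A / 18)]; [A = ell / 2]
    is the initial log-potential allowed by [log_potential_init], where all weights are 1. *)
Definition level_inv h (v : value R) := exists eps w : nat -> R,
  [/\ v = VPair (VWord (2 ^ h)) (VPair (arrR eps n) (arrR w m)),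
      forall j, is_sign (eps j),
      forall i, (i < m)%N -> (0 < w i)%R,
      forall i, (i < m)%N -> (LG h eps i <= 18 * ln (w i) + A)%R
    & (\sum_(i < m) w i <= m%:R + h%:R / (2 ^ K)%N%:R)%R].

Lemma sum_weights h (w : nat -> R) : (h <= K)%N ->
  (\sum_(i < m) w i <= m%:R + h%:R / (2 ^ K)%N%:R)%R -> (\sum_(i < m) w i <= m.+1%:R)%R.
Proof.
move=> hK; move/le_trans; apply; rewrite -natr1 lerD2l ler_pdivrMr ?ltr0n ?expn_gt0//.
by rewrite mul1r ler_nat (leq_trans hK)// ltnW// ltn_expl.
Qed.

Lemma ln_weight (w : nat -> R) i : (forall i, (i < m)%N -> (0 < w i)%R) ->
  (\sum_(i < m) w i <= m.+1%:R)%R -> (i < m)%N -> (ln (w i) <= ell%:R)%R.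
Proof.
move=> w0 sw im; apply: le_trans ln_m; rewrite ler_ln ?posrE ?w0 ?ltr0n//.
apply: le_trans sw; rewrite (bigD1 (Ordinal im)) //= lerDl.
by apply: sumr_ge0 => -[j jm] _; apply/ltW/w0.
Qed.

Lemma evP_level E lx lgam lT lka lh st h v : glob E -> (h < K)%N -> level_inv h v ->
  lookup E lx (arrR x z) -> lookup E lgam (VReal step_size) ->
  lookup E lT (VWord walk_len) -> lookup E lka (VReal kappa0) ->
  lookup E lh (VWord h) -> lookup E st v ->
  evalsP W s E (clevel lx lgam lT lka lh st) (level_inv h.+1)
    (2000 + 1200 * lg + walk_len * (4000 + 1200 * lg + K * (1000 + 400 * lg))).
Proof.
move=> G hK [eps [w [-> epsS w0 LGw sw]]] hx hgam hT hka hh hst.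
have [w1 w2 w3 [w4 w4'] w5] := W_bounds inst bigW.
have W3 : (2 ^ lg * 3 <= W)%N by nia.
have W1000 : (1000 <= W)%N by nia.
have [c hcK] : exists c, (h.+1 + c)%N = K by exists (K - h.+1)%N; lia.
have Pn := pow_cn inst hcK.
have /andP[n0 nK] := in_n inst.
have p1 : (2 ^ h * 2 = 2 ^ h.+1)%N by rewrite expnSr.
have pN : (2 ^ K %/ 2 ^ h.+1 = 2 ^ c)%N by rewrite -hcK expnD mulKn ?expn_gt0.
have pw0 : (0 < 2 ^ h)%N by rewrite expn_gt0.
have pw1 : (0 < 2 ^ h.+1)%N by rewrite expn_gt0.
have pwK : (2 ^ h.+1 <= 2 ^ K)%N by rewrite leq_exp2l.
have KW : (2 ^ K <= 2 ^ lg)%N by rewrite leq_exp2l// leq_addl.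
have keyW e : (e < z)%N -> (key e < 2 ^ lg)%N := @key_W _ _ _ _ _ _ inst e.
have colK e : (key e %% 2 ^ K < 2 ^ K)%N by rewrite ltn_mod expn_gt0.
have coln e : (e < z)%N -> (key e %% 2 ^ K < n)%N := @in_col _ _ _ _ _ _ inst e.
have keym e : (e < z)%N -> (key e < m * 2 ^ K)%N := @in_key _ _ _ _ _ _ inst e.
pose xs := signed_x K key x eps.
have xs0 e : (xs e != 0)%R by rewrite lt0r_neq0// signed_x_gt0.
pose thn := node_theta z K key x h eps.
apply: evP_cost; first do 3 pstep.
  pstep_as (@VWord R (2 ^ h.+1)); [by rewrite p1|].
  pstep_as (@VWord R (2 ^ c)); [by rewrite pN|].
  pstep_as (@VWord R c); [by congr VWord; lia|].
  pstep_as (arrR xs z); [by auto|by []|].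
  pstep.
  have keyn e : (e < z)%N -> (key e %/ 2 ^ h.+1 * 2 ^ h.+1 < 2 ^ lg)%N.
    by move=> ez; apply: leq_ltn_trans (leq_divM _ _) (keyW e ez).
  have kq e : (e < z)%N -> let q := (key e %/ 2 ^ h.+1)%N in
      [/\ (q * 2 ^ h.+1 <= W)%N, (q * 2 <= W)%N, (q * 2 + 1 <= W)%N,
          ((q * 2).+1 * 2 ^ h <= W)%N & ((q * 2 + 1).+1 * 2 ^ h <= W)%N].
    move=> /keyn /=; move: (key e %/ 2 ^ h.+1)%N => q; rewrite -p1 => B3.
    have B4 : (q * 2 <= q * (2 ^ h * 2))%N by rewrite leq_mul2l; lia.
    have B5 : (2 ^ h * 2 <= 2 ^ lg)%N by lia.
    have B6 : ((q * 2 + 1).+1 * 2 ^ h = q * (2 ^ h * 2) + 2 ^ h * 2)%N by ring.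
    have B7 : ((q * 2).+1 * 2 ^ h = q * (2 ^ h * 2) + 2 ^ h)%N by ring.
    by rewrite B6 B7; split; lia.
  pstep_as (arrR (head_theta z key h thn) z).
  all: try by match goal with H : is_true (leq (S ?e) z) |- _ => case: (kq e H) end.
  all: try by [].
  have e0 := ell_gt0 inst.
  have k0 : (0 < 4 * ell)%N by lia.
  have sw1 := sum_weights (ltnW hK) sw.
  (* This is [18 ln (w i) + A] with [ln (w i) <= ell], as the total weight is at most [m + 1]. The
     drift bound becomes [185/576 < 1/3], which explains the step size [1 / (4 ell)]. *)
  pose B : R := (18 * ell%:R + ell%:R / 2)%R.
  have LGB i : (i < m)%N -> (LG h eps i <= B)%R.
    move=> im; apply: le_trans (LGw i im) _; rewrite /B /A.
    by rewrite lerD2r ler_wpM2l// ln_weight.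
  have ka00 : (0 < kappa0)%R by rewrite divr_gt0// mulr_gt0// ltr0n expn_gt0.
  have gamB : ((1 / (4 * ell)%:R) / 18 * (5 / 4) * B <= 1 / 3)%R.
    have ER : (0 < ell%:R :> R)%R by rewrite ltr0n.
    rewrite /B natrM; have -> : (1 / (4 * ell%:R) / 18 * (5 / 4) * (18 * ell%:R + ell%:R / 2)
      = 185 / 576 :> R)%R by field; rewrite lt0r_neq0.
    lra.
  have ccK : (c < K)%N by lia.
  eapply evP_let.
    apply: (evP_walk inst bigW sE hcK (@node_theta_empty _ z K key x h eps)
      (node_theta_lt1 z K key x0 h eps) k0 walk_len_W ka00 w0 LGw _ gamB (walk_end ccK sw1) G);
      try jlookup.
    by move=> i im; apply: le_trans (LGB i im); apply: theta_sum.
  move=> u E' l' [ka' [y [w' [-> yS w'0 w'E w'S]]]] hx' hl; jlift hx'.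
  pstep.
  (* [y] is known to be a sign only below [2 ^ c]; the default 1 keeps [is_sign] at every index. *)
  pose eps' j := if (j < 2 ^ K)%N then merge_signs h y eps j else 1%R.
  apply: (@ev_evP _ _ _ _ _ (VPair (VWord (2 ^ h.+1)) (VPair (arrR eps' n) (arrR w' m)))).
    eapply ev_eq; [jauto| |exact: leqnn].
    - by match goal with H : is_true (leq (S ?i) n) |- _ => have := leq_div i (2 ^ h); lia end.
    - by match goal with H : is_true (leq (S ?i) n) |- _ => have := leq_div i (2 ^ h.+1); lia end.
    - match goal with H : is_true (leq (S ?i) n) |- _ =>
        by rewrite ltn_divLR// -expnD addnC hcK (ltn_trans H) end.
    - congr (VPair _ (VPair (VVec _) _)); apply/eq_in_map => j; rewrite mem_iota /= add0n => jn.
      by rewrite /eps' (ltn_trans jn nK) /merge_signs p1.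
  - exists eps', w'; split => //.
    + move=> j; rewrite /eps'; case: ifP => jK; last by left.
      exact: (merge_sign_sign hcK).
    + move=> i im; apply: le_trans (w'E i im).
      have -> : LG h.+1 eps' i = LG h.+1 (merge_signs h y eps) i.
        apply: eq_bigr => q _; congr (ln (coshln _)); apply: eq_segprod => e _ _.
        by rewrite /signed_x /eps' colK.
      exact: (log_potential_merge z key x0 hcK).
    + apply: le_trans w'S _; rewrite -natr1 mulrDl addrA; apply: lerD => //.
      have N0 : (0 < (2 ^ K)%:R :> R)%R by rewrite ltr0n expn_gt0.
      have -> : (1 / (2 ^ K)%N%:R = kappa0 * (2 ^ K)%N%:R :> R)%R.
        by rewrite /kappa0; field; rewrite lt0r_neq0.
      by rewrite ler_pM2l// ler_nat leq_exp2l// ltnW.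
have : (walk_len * (4000 + 1200 * lg + c * (1000 + 400 * lg)) <=
    walk_len * (4000 + 1200 * lg + K * (1000 + 400 * lg)))%N.
  by rewrite leq_mul2l leq_add2l leq_mul2r; apply/orP; right; apply/orP; right; lia.
by lia.
Qed.

End LevelProgram.

(** * From the potential of a row to the balance of its signed sum *)

Section BalanceMath.
Local Open Scope ring_scope.
Variables (R : realType) (m z K : nat) (key : nat -> nat).
Hypothesis key_mono : forall e e', (e < e' < z)%N -> (key e < key e')%N.
Variables (lam b : nat -> R) (L : R).
Hypothesis lam01 : forall i, 0 < lam i <= 1.
Hypothesis b01 : forall e, 0 <= b e <= 1.
Local Notation row e := (key e %/ 2 ^ K)%N.
Local Notation col e := (key e %% 2 ^ K)%N.
Definition scaled_x e := 1 + lam (row e) * b e.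
Local Notation LG := (log_potential z K key scaled_x).

Lemma lam_b_ge0 i e : 0 <= lam i * b e.
Proof. by have /andP[l0 l1] := lam01 i; have /andP[b0 b1] := b01 e; rewrite mulr_ge0// ltW. Qed.

Lemma scaled_x_gt0 e : 0 < scaled_x e.
Proof. by rewrite /scaled_x; have := lam_b_ge0 (row e) e; lra. Qed.

Lemma ln_coshln1 (t : R) : 0 <= t -> ln (coshln (1 + t)) <= t ^+ 2 / 2.
Proof.
move=> t0; have t1 : 0 < 1 + t by lra.
apply: le_trans (_ : ln (1 + t ^+ 2 / 2) <= _); last first.
  by apply: le_ln1Dx; have := sqr_ge0 t; lra.
rewrite ler_ln ?posrE ?coshln_gt0//; last by have := sqr_ge0 t; lra.
rewrite -subr_ge0; have -> : 1 + t ^+ 2 / 2 - coshln (1 + t) = t ^+ 3 / (2 * (1 + t)).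
  by rewrite /coshln; field; rewrite lt0r_neq0.
by rewrite divr_ge0 ?exprn_ge0// mulr_ge0// ltW.
Qed.

Lemma sqr_le_half i e : (lam i * b e) ^+ 2 <= lam i ^+ 2 * b e.
Proof.
have /andP[b0 b1] := b01 e; rewrite exprMn ler_wpM2l ?sqr_ge0// expr2.
by rewrite -[leRHS]mulr1 ler_wpM2l.
Qed.

Lemma segsum_row1 (f : nat -> R) i :
  segsum z key f (2 ^ K) i = \sum_(q < 2 ^ K) segsum z key f 1 (i * 2 ^ K + q)%N.
Proof. by rewrite -[X in segsum z key f X i]mul1n segsum_pow. Qed.

Lemma big_leaf (T : Type) (idx : T) (op : Monoid.com_law idx) (f : nat -> T) e : (e < z)%N ->
  \big[op/idx]_(e' < z | (key e' %/ 1 == key e)%N) f e' = f e.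
Proof.
move=> ez; rewrite (bigD1 (Ordinal ez)) /= ?divn1// big1 ?Monoid.mulm1// => e' /andP[].
rewrite divn1 => /eqP ke' ne'.
case: (ltngtP e e') => lt; last by move: ne'; rewrite -val_eqE /= lt eqxx.
  by have := @key_mono e e'; rewrite lt ltn_ord ke' ltnn => /(_ isT).
by have := @key_mono e' e; rewrite lt ez ke' ltnn => /(_ isT).
Qed.

Lemma big_leaf0 (T : Type) (idx : T) (op : Monoid.com_law idx) (f : nat -> T) nu :
  (forall e, (e < z)%N -> key e <> nu) ->
  \big[op/idx]_(e < z | (key e %/ 1 == nu)%N) f e = idx.
Proof. by move=> H; apply: big1 => e; rewrite divn1 => /eqP ke; case: (H e). Qed.

Lemma row_count i : segsum z key (fun=> 1 : R) (2 ^ K) i <= 2 ^+ K.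
Proof.
rewrite segsum_row1; have -> : 2 ^+ K = \sum_(q < 2 ^ K) (1 : R) by rewrite sumr_const card_ord natrX.
apply: ler_sum => q _; rewrite /segsum.
case: (boolp.pselect (exists2 e, (e < z)%N & key e = i * 2 ^ K + q)%N) => [[e ez <-]|H].
  by rewrite (big_leaf GRing.add (fun=> 1)).
by rewrite (big_leaf0 GRing.add (fun=> 1)) // => e ez ke; case: H; exists e.
Qed.

Lemma node_sum_sqr i :
  segsum z key (fun e => (lam (row e) * b e) ^+ 2) (2 ^ K) i
    <= lam i ^+ 2 * segsum z key b (2 ^ K) i.
Proof.
rewrite -segsumZ; apply: ler_sum => e /eqP ke; rewrite ke; exact: sqr_le_half.
Qed.

(** At level 0 a block is empty or a single entry with factor [1 + t], and contributes at most
    [t^2 / 2]; here [t^2 <= lam^2 b] because [b <= 1]. *)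
Lemma log_potential_init i : lam i ^+ 2 * segsum z key b (2 ^ K) i <= L ->
  LG 0 (fun=> 1) i <= L / 2.
Proof.
move=> H; apply: le_trans (_ : segsum z key (fun e => (lam (row e) * b e) ^+ 2) (2 ^ K) i / 2 <= _); last first.
  by have := node_sum_sqr i; lra.
rewrite segsum_row1 mulr_suml /log_potential subn0; apply: ler_sum => q _.
rewrite expn0; set nu := (i * 2 ^ K + q)%N.
case: (boolp.pselect (exists2 e, (e < z)%N & key e = nu)) => [[e ez ke]|H0]; last first.
  have {}H0 e : (e < z)%N -> key e <> nu by move=> ez ke; case: H0; exists e.
  have -> f : segprod z key f 1 nu = 1 by exact: (big_leaf0 GRing.mul).
  have -> f : segsum z key f 1 nu = 0 by exact: (big_leaf0 GRing.add).
  rewrite /coshln invr1 mul0r; have -> : (1 + 1) / 2 = 1 :> R by lra.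
  by rewrite ln1.
rewrite -{}ke.
have -> f : segprod z key f 1 (key e) = f e by exact: (big_leaf GRing.mul).
have -> f : segsum z key f 1 (key e) = f e by exact: (big_leaf GRing.add).
by rewrite /signed_x /spow ler01 ln_coshln1 ?lam_b_ge0.
Qed.

Lemma ln1D_ge (t : R) : 0 <= t -> t - t ^+ 2 <= ln (1 + t).
Proof.
move=> t0; have t1 : 0 < 1 + t by lra.
apply: le_trans (_ : 1 - (1 + t)^-1 <= _).
  rewrite -subr_ge0; have -> : 1 - (1 + t)^-1 - (t - t ^+ 2) = t ^+ 3 / (1 + t).
    by field; rewrite lt0r_neq0.
  by rewrite divr_ge0 ?exprn_ge0 // ltW.
have : ln (1 + ((1 + t)^-1 - 1)) <= (1 + t)^-1 - 1.
  by apply: le_ln1Dx; have := t1; rewrite -invr_gt0; lra.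
rewrite [1 + (_ - 1)]addrC subrK lnV ?posrE//; lra.
Qed.

(** Both [t] and [1 / t] are at most [2 coshln t], and [ln 2 <= 1]. *)
Lemma abs_ln_le (t : R) : 0 < t -> `|ln t| <= 1 + ln (coshln t).
Proof.
move=> t0; have c0 := coshln_gt0 t0.
have H u : 0 < u -> u <= 2 * coshln t -> ln u <= 1 + ln (coshln t).
  move=> u0 uc; apply: le_trans (_ : ln (2 * coshln t) <= _).
    by rewrite ler_ln ?posrE // mulr_gt0.
  rewrite (@lnM _ 2) ?posrE// lerD2r; have := @le_ln1Dx R 1.
  have -> : 1 + 1 = 2 :> R by [].
  by apply; lra.
have i0 : 0 < t^-1 by rewrite invr_gt0.
have h1 := H _ t0; have h2 := H _ i0.
have E : 2 * coshln t = t + t^-1 by rewrite /coshln; field; rewrite lt0r_neq0.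
rewrite E lerDl ltW// in h1; rewrite E lerDr ltW// in h2.
move: h1 => /(_ isT) h1; move: h2 => /(_ isT); rewrite lnV ?posrE// => h2.
by rewrite ler_norml; apply/andP; split; lra.
Qed.

Variable eps : nat -> R.
Hypothesis epsS : forall j, is_sign (eps j).

Lemma ln_prod_seg (f : nat -> R) pw nu : (forall e, 0 < f e) ->
  ln (segprod z key f pw nu) = segsum z key (fun e => ln (f e)) pw nu.
Proof.
move=> f0; rewrite /segprod /segsum.
suff [_ ->] : 0 < \prod_(e < z | (key e %/ pw == nu)%N) f e /\
   ln (\prod_(e < z | (key e %/ pw == nu)%N) f e) = \sum_(e < z | (key e %/ pw == nu)%N) ln (f e) by [].
elim/big_ind2 : _ => [|u1 u2 v1 v2 [u0 <-] [v0 <-]|e _] //; first by rewrite ln1.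
by rewrite mulr_gt0// lnM ?posrE.
Qed.

(** At level [K] a row is a single block, so [B] bounds the logarithm of the signed product.
    Replacing [ln (1 + t)] by [t] costs at most [t^2] per entry, in total at most [L]. *)
Lemma balance_bound i B : lam i ^+ 2 * segsum z key b (2 ^ K) i <= L ->
  LG K eps i <= B ->
  `|segsum z key (fun e => b e * eps (col e)) (2 ^ K) i| * lam i <= 1 + B + L.
Proof.
move=> H; rewrite /log_potential subnn expn0 big_ord1 /= muln1 addn0 => HB.
set X := segprod _ _ _ _ _ in HB.
have X0 : 0 < X by apply: segprod_gt0; exact: scaled_x_gt0.
have HX := le_trans (abs_ln_le X0) (lerD (lexx 1) HB).
have EX : ln X = segsum z key (fun e => eps (col e) * ln (scaled_x e)) (2 ^ K) i.
  rewrite ln_prod_seg; last by move=> e; apply: signed_x_gt0; exact: scaled_x_gt0.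
  apply: eq_segsum => e _ _; rewrite /signed_x /spow.
  case: (epsS (col e)) => ->; rewrite ?ler01 ?ler0N1 ?mul1r ?mulN1r//=.
  by rewrite lnV ?posrE ?scaled_x_gt0.
have /andP[l0 _] := lam01 i.
rewrite -[X in _ * X <= _](gtr0_norm l0) -normrM.
set D := segsum _ _ _ _ _ * lam i.
have -> : D = ln X - (ln X - D) by rewrite opprB addrC subrK.
apply: le_trans (ler_normB _ _) _; rewrite {}/D.
apply: lerD; first exact: HX.
apply: le_trans H; apply: le_trans (node_sum_sqr i).
rewrite EX mulrC -segsumZ /segsum -sumrB; apply: le_trans (ler_norm_sum _ _ _) _.
apply: ler_sum => e /eqP ke; rewrite /scaled_x ke.
have -> : eps (col e) * ln (1 + lam i * b e) - lam i * (b e * eps (col e))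
   = eps (col e) * (ln (1 + lam i * b e) - lam i * b e) by ring.
rewrite normrM; have -> : `|eps (col e)| = 1 by case: (epsS (col e)) => ->; rewrite ?normrN normr1.
rewrite mul1r ler_norml; have t0 := lam_b_ge0 i e.
have h1 := ln1D_ge t0; have h2 : ln (1 + lam i * b e) <= lam i * b e by apply: le_ln1Dx; lra.
by have := sqr_ge0 (lam i * b e) => h3; apply/andP; split; lra.
Qed.

End BalanceMath.

(** The inner loop finds [lam] by halving, for want of a square root. At the end 1 is added where
    the sign is positive: truncated division by 2 hides this for even values and rounds odd ones in
    the direction of the sign. *)
Definition cbalance (lzz lgam lT lka : nat) : lterm :=
  clet (ctab (cvar Lz) (fun e =>
    cifR (cbit (cgetW (cvar lzz) (ccol e)) (cword 1)) (cgetR (cvar La) (cvar e)) (rnat 0))) (fun b =>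
  clet (csumscan Lz b) (fun SB =>
  clet (ctab (cvar Lm) (fun i => csumseg SB i LN)) (fun sr =>
  clet (cfor (cvar Llg) (ctab (cvar Lm) (fun=> rnat 1)) (fun _ st =>
    ctab (cvar Lm) (fun i =>
      clet (cgetR (cvar st) (cvar i)) (fun l =>
        cifR (crle (rmul (rmul (cvar l) (cvar l)) (cgetR (cvar sr) (cvar i))) (creal (cvar Lell)))
          (cvar l) (rdiv (cvar l) (rnat 2)))))) (fun lam =>
  clet (ctab (cvar Lz) (fun e =>
    radd (rnat 1) (rmul (cgetR (cvar lam) (crow e)) (cgetR (cvar b) (cvar e))))) (fun x =>
  clet (cfor (cvar LK)
          (cpair (cword 1) (cpair (ctab (cvar Ln) (fun=> rnat 1)) (ctab (cvar Lm) (fun=> rnat 1))))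
          (fun h st => clevel x lgam lT lka h st)) (fun r =>
  clet (cfst (csnd (cvar r))) (fun eps =>
  ctab (cvar Ln) (fun j =>
    cdiv (cadd (cgetW (cvar lzz) (cvar j))
               (cifW (crle (rnat 0) (cgetR (cvar eps) (cvar j))) (cword 1) (cword 0)))
         (cword 2))))))))).

Section BalanceProgram.
Variables (R : realType) (W s m n z ell K : nat) (key : nat -> nat) (a : nat -> R).
Hypothesis inst : instance m n z ell K key.
Hypothesis bigW : (2 ^ (20 + 4 * (ell + K)) <= W)%N.
Hypothesis sE : s.+1 = (n + m + z)%N.
Hypothesis a01 : forall e, (0 <= a e <= 1)%R.
Local Notation glob := (globals m n z ell K key a).
Local Notation lg := (ell + K)%N.
Local Notation col e := (key e %% 2 ^ K)%N.
Variable zz : nat -> nat.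
Hypothesis zzK : forall j, (j < n)%N -> (zz j <= 2 ^ K)%N.

Definition odd_part e : R := if odd (zz (col e)) then a e else 0%R.

Lemma odd_part01 e : (0 <= odd_part e <= 1)%R.
Proof. by rewrite /odd_part; case: ifP => _ //; rewrite lexx ler01. Qed.

Lemma row_sum_ge0 i : (0 <= segsum z key odd_part (2 ^ K) i)%R.
Proof. by apply: sumr_ge0 => e _; have /andP[] := odd_part01 e. Qed.

Lemma row_sum_le i : (segsum z key odd_part (2 ^ K) i <= z%:R)%R.
Proof.
apply: le_trans (_ : \sum_(e < z) odd_part e <= _)%R.
  by rewrite /segsum big_mkcond /=; apply: ler_sum => e _; case: ifP => _ //; have /andP[] := odd_part01 e.
have -> : (z%:R = \sum_(e < z) 1 :> R)%R by rewrite sumr_const card_ord.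
apply: ler_sum => e _.
by have /andP[] := odd_part01 e.
Qed.

(** With [s] the row sum, a halving happens only where [lam^2 s > ell], so that [4 lam^2 s > ell]
    afterwards. A scale that is still too large has been halved in every round. *)
Definition scale_inv k (v : value R) := exists lam : nat -> R,
  [/\ v = arrR lam m, forall i, (0 < lam i <= 1)%R,
     forall i, lam i = 1%R \/ (ell%:R < 4 * (lam i ^+ 2 * segsum z key odd_part (2 ^ K) i))%R
   & forall i, (lam i ^+ 2 * segsum z key odd_part (2 ^ K) i <= ell%:R)%R \/ lam i = (1 / 2 ^+ k)%R].

(** If [lam] was halved in all [lg] rounds, then [lam s <= 1] since [s <= z < 2^lg], and
    [lam^2 s <= lam s <= 1 <= ell]. *)
Lemma scale_final lam i : (0 < lam i <= 1)%R ->
  (lam i ^+ 2 * segsum z key odd_part (2 ^ K) i <= ell%:R)%R \/ lam i = (1 / 2 ^+ lg)%R ->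
  (lam i ^+ 2 * segsum z key odd_part (2 ^ K) i <= ell%:R)%R.
Proof.
move=> /andP[l0 l1] [//|lE].
have e0 : (1 <= ell%:R :> R)%R by rewrite ler1n (ell_gt0 inst).
apply: le_trans e0; have s0 := row_sum_ge0 i; have s1 := row_sum_le i.
have s2 : (segsum z key odd_part (2 ^ K) i <= 2 ^+ lg)%R.
  by apply: le_trans s1 _; rewrite -natrX ler_nat ltnW// (z_lg inst).
have p0 : (0 < 2 ^+ lg :> R)%R by rewrite exprn_gt0.
have q : (lam i * segsum z key odd_part (2 ^ K) i <= 1)%R.
  by rewrite lE mulrAC mul1r ler_pdivrMr// mul1r.
rewrite expr2 -mulrA; apply: le_trans q.
by rewrite ler_piMl// mulr_ge0// ltW.
Qed.

(** Unless it is 1, the scale is more than half of [sqrt (ell / s)]. *)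
Lemma inv_scale_le lam i : (0 < lam i <= 1)%R ->
  lam i = 1%R \/ (ell%:R < 4 * (lam i ^+ 2 * segsum z key odd_part (2 ^ K) i))%R ->
  (ell%:R / lam i <= ell%:R + 2 * Num.sqrt (segsum z key odd_part (2 ^ K)%N i * ell%:R))%R.
Proof.
move=> /andP[l0 l1]; set sv := segsum _ _ _ _ _.
have e0 : (0 < ell%:R :> R)%R by rewrite ltr0n (ell_gt0 inst).
have s0 : (0 <= sv)%R := row_sum_ge0 i.
have q0 : (0 <= Num.sqrt (sv * ell%:R))%R := sqrtr_ge0 _.
case=> [->|H]; first by rewrite divr1; lra.
apply: le_trans (_ : (2 * Num.sqrt (sv * ell%:R) <= _)%R); last by lra.
have l0' := ltW l0; have e0' := ltW e0.
rewrite ler_pdivrMr//.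
have p0 : (0 <= 2 * Num.sqrt (sv * ell%:R) * lam i)%R by rewrite !mulr_ge0.
rewrite -(ler_sqr e0' p0) !exprMn sqr_sqrtr ?mulr_ge0//.
have -> : (2 ^+ 2 * (sv * ell%:R) * lam i ^+ 2 = ell%:R * (4 * (lam i ^+ 2 * sv)) :> R)%R by ring.
by rewrite expr2 ler_pM2l// ltW.
Qed.

Lemma evP_balance E lzz lgam lT lka : glob E ->
  lookup E lzz (arrW zz n) -> lookup E lgam (VReal (step_size R ell)) ->
  lookup E lT (VWord (walk_len ell K)) -> lookup E lka (VReal (kappa0 R K)) ->
  evalsP W s E (cbalance lzz lgam lT lka)
    (fun v => exists eps : nat -> R,
      [/\ v = arrW (fun j => (zz j + (0 <= eps j)%R) %/ 2)%N n, forall j, is_sign (eps j)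
      & forall i, (i < m)%N ->
        (`|segsum z key (fun e => odd_part e * eps (col e)) (2 ^ K)%N i| <=
          21 * (ell%:R + 2 * Num.sqrt (segsum z key odd_part (2 ^ K)%N i * ell%:R)))%R])
    (1000 + 1000 * lg + K * (3000 + 1200 * lg +
       walk_len ell K * (4000 + 1200 * lg + K * (1000 + 400 * lg)))).
Proof.
move=> G hzz hgam hT hka; have [w1 w2 w3 [w4 w4'] w5] := W_bounds inst bigW.
have W3 : (2 ^ lg * 3 <= W)%N by nia.
have W1000 : (1000 <= W)%N by nia.
have /andP[n0 nK] := in_n inst.
have KW : (2 ^ K <= 2 ^ lg)%N by rewrite leq_exp2l// leq_addl.
have K0 : (0 < 2 ^ K)%N by rewrite expn_gt0.
have rowm e : (e < z)%N -> (key e %/ 2 ^ K < m)%N := @row_lt _ _ _ _ _ _ inst e.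
have coln e : (e < z)%N -> (key e %% 2 ^ K < n)%N := @in_col _ _ _ _ _ _ inst e.
have rowW i : (i < m)%N -> (i.+1 * 2 ^ K <= W)%N.
  have /andP[_ mell] := in_m inst; move=> im; apply: leq_trans (_ : 2 ^ lg <= _)%N; last by lia.
  by rewrite expnD leq_mul2r (leq_trans im (ltnW mell)) orbT.
have zz1 j : (j < n)%N -> (zz j %/ 1 <= W)%N by move=> /zzK; rewrite divn1; lia.
have zzW j : (j < n)%N -> (zz j <= W)%N by move=> /zzK; lia.
apply: evP_cost.
  pstep_as (arrR odd_part z); [by auto|by auto| |].
    by congr VVec; apply: eq_mkseq => e; rewrite divn1.
  pstep.
  pstep_as (arrR (fun i => segsum z key odd_part (2 ^ K) i) m); [by auto|by []|].
  eapply (evP_let (P := scale_inv lg)).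
    apply: (evP_for (Inv := scale_inv) (qb := 30)).
    - by jauto.
    - apply: ev_evP; first by jauto.
      exists (fun=> 1%R); split => //.
      + by move=> i; rewrite ltr01 lexx.
      + by move=> i; left.
      + by move=> i; right; rewrite expr0 divr1.
    - by lia.
    - move=> k u E' li lu klg [lam [-> lam01 lamA lamB]] hxx hi hu; jlift hxx.
      pose lam' i := (if lam i * lam i * segsum z key odd_part (2 ^ K)%N i <= ell%:R
        then lam i else lam i / 2)%R.
      apply: (@ev_evP _ _ _ _ _ (arrR lam' m)); first by jrun; [|lia].
      exists lam'; split => // i; rewrite /lam' -expr2; have /andP[lm0 lm1] := lam01 i; case: ifPn => //.
      + by rewrite divr_gt0//= => _; rewrite ler_pdivrMr// mul1r; lra.
      + rewrite -ltNge => Hlt; right; rewrite exprMn exprVn.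
        have -> : (4 * (lam i ^+ 2 * (2 ^+ 2)^-1 * segsum z key odd_part (2 ^ K)%N i)
          = lam i ^+ 2 * segsum z key odd_part (2 ^ K)%N i :> R)%R by field.
        by [].
      + by left.
      + rewrite -ltNge => Hlt; right; case: (lamB i) => [|->]; first by rewrite leNgt Hlt.
        by rewrite exprSr; field; rewrite expf_neq0.
  move=> u E' l' [lam [-> lam01 lamA lamB]] hxx hl; jlift hxx.
  have x0 e : (0 < scaled_x K key lam odd_part e)%R := @scaled_x_gt0 _ _ _ _ _ lam01 odd_part01 e.
  pstep_as (arrR (scaled_x K key lam odd_part) z); [by auto|by []|].
  eapply (evP_let (P := level_inv m n z ell K key (scaled_x K key lam odd_part) K)).
    apply: (evP_for (Inv := level_inv m n z ell K key (scaled_x K key lam odd_part))).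
    - by jauto.
    - apply: ev_evP; first by jauto; lia.
      exists (fun=> 1%R), (fun=> 1%R); split => //.
      + by move=> j; left.
      + move=> i im; rewrite ln1 mulr0 add0r.
        by apply: (log_potential_init (in_mono inst) lam01 odd_part01); apply: scale_final.
      + by rewrite sumr_const card_ord mul0r addr0.
    - by lia.
    - move=> h u' E1' li lu hK inv_u hxx1 hi hu; jlift hxx1.
      by apply: (evP_level inst bigW sE x0 _ hK inv_u); first eassumption; jlookup.
  move=> u' E1' l1' [eps [w [-> epsS wpos LGw sw]]] hxx2 hl1; jlift hxx2.
  pstep.
  apply: (@ev_evP _ _ _ _ _ (arrW (fun j => (zz j + (0 <= eps j)%R) %/ 2)%N n)).
    eapply ev_eq; [jauto| |exact: leqnn].
    - by match goal with H : is_true (leq (S ?i) n) |- _ => have := zzK H end; case: ifP; lia.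
    - match goal with H : is_true (leq (S ?i) n) |- _ => have Hz := zzK H end.
      by apply: leq_trans (leq_div _ _) _; case: ifP; lia.
    - by congr VVec; apply: eq_mkseq => i; case: ifP.
  exists eps; split => // i im.
  have HB : (log_potential z K key (scaled_x K key lam odd_part) K eps i <= 18 * ell%:R + ell%:R / 2)%R.
    apply: le_trans (LGw i im) _; rewrite lerD2r ler_wpM2l//.
    apply: (ln_weight inst wpos _ im); exact: sum_weights (leqnn K) sw.
  have HD := balance_bound lam01 odd_part01 epsS (scale_final (lam01 i) (lamB i)) HB.
  have E1R : (1 <= ell%:R :> R)%R by rewrite ler1n (ell_gt0 inst).
  have /andP[lm0 lm1] := lam01 i.
  (* [1 + (18 ell + ell / 2) + ell <= 21 ell] because [ell >= 1]. *)
  apply: le_trans (_ : 21 * (ell%:R / lam i) <= _)%R; last first.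
    by rewrite ler_wpM2l// inv_scale_le.
  by rewrite mulrA ler_pdivlMr//; apply: le_trans HD _; lra.
by lia.
Qed.

End BalanceProgram.

(** * Rounding bit by bit *)

Section DeviationMath.
Local Open Scope ring_scope.
Variables (R : realType) (mu L : R).
Hypothesis mu0 : 0 <= mu.
Hypothesis L1 : 1 <= L.

(** If row values stay below [M], removing digit [k] moves a row by about [sqrt (2^k M L) / 2^k],
    that is, [sqrt (M L)] times the [k]-th power of this ratio. *)
Definition dev_ratio : R := Num.sqrt 2 / 2.
(** A bound [M] on the row value at every stage. The deviation of a stage depends on the current
    value, hence on [M]; the circle closes because [126 sqrt (M L) <= M / 2 + 8000 L], so that [mu]
    plus the deviation is at most [M] again. *)
Definition dev_max : R := 2 * mu + 17 * 1000 * L.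
(** The 1 is the error of truncation to [K] digits. One stage contributes the constant 42, and
    [(126 + 42) 3/4 = 126], where 3/4 bounds [dev_ratio]. *)
Definition dev_bound k : R := 1 + 21 * L / 2 ^+ k + 126 * Num.sqrt (dev_max * L) * dev_ratio ^+ k.

Lemma dev_ratio_ge0 : 0 <= dev_ratio.
Proof. by rewrite divr_ge0 ?sqrtr_ge0. Qed.

Lemma dev_ratio_le : dev_ratio <= 3 / 4.
Proof.
rewrite /dev_ratio; suff : Num.sqrt 2 <= 3 / 2 :> R by lra.
rewrite -[leRHS](@ger0_norm R) -?sqrtr_sqr; last by lra.
by rewrite ler_sqrt; lra.
Qed.

Lemma dev_max_ge0 : 0 <= dev_max. Proof. by rewrite /dev_max; move: mu0 L1; lra. Qed.

Lemma dev_sqrt : 126 * Num.sqrt (dev_max * L) <= dev_max / 2 + 8 * 1000 * L.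
Proof.
have M0 := dev_max_ge0; have L0 : 0 <= L by move: L1; lra.
rewrite (sqrtrM _ M0); have := sqr_ge0 (Num.sqrt dev_max - 126 * Num.sqrt L).
rewrite sqrrB exprMn (sqr_sqrtr M0) (sqr_sqrtr L0); move: (dev_max) => M; lra.
Qed.

Lemma dev_le_max k D : `|D - mu| <= dev_bound k -> D <= dev_max.
Proof.
rewrite ler_norml => /andP[_ H].
have h1 : 21 * L / 2 ^+ k <= 21 * L.
  by rewrite ler_pdivrMr ?exprn_gt0// ler_peMr ?exprn_ege1//; move: L1; lra.
have h2 : 126 * Num.sqrt (dev_max * L) * dev_ratio ^+ k <= 126 * Num.sqrt (dev_max * L).
  rewrite ler_piMr ?mulr_ge0 ?sqrtr_ge0// exprn_ile1 ?dev_ratio_ge0//.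
  by have := dev_ratio_le; lra.
have := dev_sqrt; move: H; rewrite /dev_bound /dev_max in h2 *.
by move: L1 mu0 h1 h2; lra.
Qed.

Lemma dev_step k D S s : `|D - mu| <= dev_bound k.+1 -> 0 <= s -> s <= 2 ^+ k.+1 * D ->
  `|S| <= 21 * (L + 2 * Num.sqrt (s * L)) -> `|D + S / 2 ^+ k.+1 - mu| <= dev_bound k.
Proof.
move=> HD s0 sD HS; have DM := dev_le_max HD.
have L0 : 0 <= L by move: L1; lra.
have M0 := dev_max_ge0.
have p0 : 0 < 2 ^+ k.+1 :> R by rewrite exprn_gt0.
have hs : Num.sqrt (s * L) <= Num.sqrt 2 ^+ k.+1 * Num.sqrt (dev_max * L).
  have -> : Num.sqrt 2 ^+ k.+1 = Num.sqrt (2 ^+ k.+1) :> R.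
    by rewrite -[LHS]ger0_norm ?exprn_ge0 ?sqrtr_ge0// -sqrtr_sqr exprAC sqr_sqrtr.
  have p0' := ltW p0.
  rewrite -sqrtrM// ler_sqrt ?mulr_ge0// mulrA ler_wpM2r//.
  by apply: le_trans sD _; rewrite ler_pM2l.
have hr : dev_ratio ^+ k.+1 = Num.sqrt 2 ^+ k.+1 / 2 ^+ k.+1 by rewrite expr_div_n.
have HS' : `|S / 2 ^+ k.+1| <= 21 * L / 2 ^+ k.+1 + 42 * Num.sqrt (dev_max * L) * dev_ratio ^+ k.+1.
  rewrite normrM (gtr0_norm (_ : 0 < (2 ^+ k.+1)^-1)) ?invr_gt0// hr ler_pdivrMr//.
  rewrite mulrDl !mulrA !divfK ?lt0r_neq0//; apply: le_trans HS _.
  by rewrite mulrDr; move: hs; lra.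
have -> : D + S / 2 ^+ k.+1 - mu = (D - mu) + S / 2 ^+ k.+1 by ring.
apply: le_trans (ler_normD _ _) _; apply: le_trans (lerD HD HS') _.
rewrite /dev_bound !exprS.
have r0 := dev_ratio_ge0; have r1 := dev_ratio_le.
have q0 : 0 <= Num.sqrt (dev_max * L) * dev_ratio ^+ k by rewrite mulr_ge0 ?sqrtr_ge0 ?exprn_ge0.
have h1 : 21 * L / (2 * 2 ^+ k) + 21 * L / (2 * 2 ^+ k) = 21 * L / 2 ^+ k.
  by field; rewrite expf_neq0.
set Q := Num.sqrt (dev_max * L) in q0 *; set rk := dev_ratio ^+ k in q0 *.
have h2 : Q * (dev_ratio * rk) <= 3 / 4 * (Q * rk) by rewrite mulrCA ler_wpM2r.
have := mulr_ge0 q0 q0; rewrite -h1; lra.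
Qed.

Lemma dev_final D : `|D - mu| <= dev_bound 0 ->
  `|D - mu| <= 20 * 1000 * (Num.sqrt (mu * L) + L).
Proof.
move/le_trans; apply; rewrite /dev_bound !expr0 mulr1 divr1.
have L0 : 0 <= L by move: L1; lra.
have q0 : 0 <= Num.sqrt (mu * L) by exact: sqrtr_ge0.
(* [131^2 > 17000], and [1 + 21 + 126 * 131 < 20000]. *)
suff : Num.sqrt (dev_max * L) <= 2 * Num.sqrt (mu * L) + 131 * L.
  by move: L1 q0; lra.
have r0 : 0 <= 2 * Num.sqrt (mu * L) + 131 * L by lra.
rewrite -(ger0_norm r0) -sqrtr_sqr ler_sqrt ?sqr_ge0//.
rewrite sqrrD exprMn sqr_sqrtr ?mulr_ge0// /dev_max.
have := mulr_ge0 q0 L0; have := mulr_ge0 mu0 L0; have := mulr_ge0 L0 L0.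
rewrite exprMn expr2; lra.
Qed.

End DeviationMath.

Definition cbits : lterm :=
  cfor (cvar LK)
    (ctab (cvar Ln) (fun j => cpair (cword 0) (cgetR (cvar Lp) (cvar j))))
    (fun _ st => ctab (cvar Ln) (fun j =>
      clet (cget (cvar st) (cvar j)) (fun pr =>
      clet (rmul (rnat 2) (csnd (cvar pr))) (fun r =>
      clet (cmul (cfst (cvar pr)) (cword 2)) (fun q =>
        cif (crle (rnat 1) (cvar r))
          (cpair (cadd (cvar q) (cword 1)) (rsub (cvar r) (rnat 1)))
          (cpair (cvar q) (cvar r))))))).

Definition cround (lgam lT lka : nat) : lterm :=
  clet cbits (fun bits =>
  clet (ctab (cvar Ln) (fun j => clet (cget (cvar bits) (cvar j)) (fun pr => cfst (cvar pr)))) (fun zz =>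
    cfor (cvar LK) (cvar zz) (fun _ st => cbalance st lgam lT lka))).

Section RoundProgram.
Variables (R : realType) (W s m n z ell K : nat) (key : nat -> nat) (a p : nat -> R).
Hypothesis inst : instance m n z ell K key.
Hypothesis bigW : (2 ^ (20 + 4 * (ell + K)) <= W)%N.
Hypothesis sE : s.+1 = (n + m + z)%N.
Hypothesis a01 : forall e, (0 <= a e <= 1)%R.
Hypothesis p01 : forall j, (0 <= p j <= 1)%R.
Local Notation glob := (globals m n z ell K key a).
Local Notation lg := (ell + K)%N.
Local Notation col e := (key e %% 2 ^ K)%N.

(** The remainder may equal 1: for [p j = 1] all digits are 1 and the remainder stays 1, so that
    [q j < 2 ^ k] holds without a special case. *)
Definition bits_inv k (v : value R) := exists (q : nat -> nat) (r : nat -> R),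
  [/\ v = VVec (mkseq (fun j => VPair (VWord (q j)) (VReal (r j))) n),
      forall j, (q j < 2 ^ k)%N,
      forall j, (0 <= r j <= 1)%R
    & forall j, p j = (((q j)%:R + r j) / 2 ^+ k)%R].

Lemma evP_bits E : glob E -> lookup E Lp (arrR p n) ->
  evalsP W s E cbits (bits_inv K) (100 + K * 100).
Proof.
move=> G hp; have [w1 w2 w3 [w4 w4'] w5] := W_bounds inst bigW.
have W3 : (2 ^ lg * 3 <= W)%N by nia.
have W1000 : (1000 <= W)%N by nia.
have KW : (2 ^ K <= 2 ^ lg)%N by rewrite leq_exp2l// leq_addl.
apply: evP_cost.
apply: (evP_for (Inv := bits_inv) (qb := 50)).
- by jauto.
- apply: ev_evP; first by jauto.
  exists (fun=> 0%N), p; split => // j.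
  by rewrite add0r expr0 divr1.
- by lia.
- move=> k u E1 li lu kK [q [r [-> qk r01 pE]]] hx hi hu; jlift hx.
  have kK2 : (2 ^ k * 2 <= 2 ^ K)%N by rewrite -expnSr leq_exp2l.
  pose q' j := (if 1 <= 2 * r j then q j * 2 + 1 else q j * 2)%R%N.
  pose r' j := (if 1 <= 2 * r j then 2 * r j - 1 else 2 * r j)%R.
  apply: (@ev_evP _ _ _ _ _ (VVec (mkseq (fun j => VPair (VWord (q' j)) (VReal (r' j))) n))).
    eapply ev_eq; [jauto| |].
    - by have := qk i; lia.
    - by have := qk i; lia.
    - by congr VVec; apply: eq_mkseq => j; rewrite /q' /r'; case: ifP.
    - by [].
  exists q', r'; split => // j; rewrite /q' /r'; have := r01 j; have := qk j; rewrite ?expnSr.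
  + by case: ifP; lia.
  + move=> _ /andP[rj0 rj1]; case: ifPn => [?|]; first by apply/andP; split; lra.
    by rewrite -ltNge => ?; apply/andP; split; lra.
  + move=> _ _; rewrite pE exprS; case: ifP => _.
      by rewrite natrD natrM; field; rewrite expf_neq0.
    by rewrite natrM; field; rewrite expf_neq0.
by lia.
Qed.

Local Notation rowsum f i := (segsum z key f (2 ^ K)%N i).
Definition row_mu i : R := rowsum (fun e => a e * p (col e))%R i.
Definition row_val (q : nat -> nat) i : R := rowsum (fun e => a e * (q (col e))%:R)%R i.

Definition round_inv t (v : value R) := exists q : nat -> nat,
  [/\ v = arrW q n, forall j, (j < n)%N -> (q j <= 2 ^ (K - t))%N
    & forall i, (i < m)%N ->
      (`|row_val q i / 2 ^+ (K - t) - row_mu i| <= dev_bound (row_mu i) ell%:R (K - t))%R].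

Lemma row_mu_ge0 i : (0 <= row_mu i)%R.
Proof.
apply: sumr_ge0 => e _; have /andP[a0 _] := a01 e; have /andP[p0 _] := p01 (col e).
exact: mulr_ge0.
Qed.

(** Truncation costs at most [1 / 2^K] per entry, and a row has at most [2^K] entries. *)
Lemma row_val_init q r i : (forall j, (0 <= r j <= 1)%R) ->
  (forall j, p j = (((q j)%:R + r j) / 2 ^+ K)%R) ->
  (`|row_val q i / 2 ^+ K - row_mu i| <= 1)%R.
Proof.
move=> r01 pE; have p0 : (0 < 2 ^+ K :> R)%R by rewrite exprn_gt0.
have -> : (row_val q i / 2 ^+ K - row_mu i = - (rowsum (fun e => a e * r (col e)) i / 2 ^+ K))%R.
  rewrite /row_val /row_mu /segsum mulr_suml -sumrB mulr_suml -sumrN; apply: eq_bigr => e _.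
  by rewrite pE; field; rewrite lt0r_neq0.
rewrite normrN ger0_norm; last first.
  apply: divr_ge0; last exact: ltW.
  apply: sumr_ge0 => e _; have /andP[a0 _] := a01 e; have /andP[r0 _] := r01 (col e).
  exact: mulr_ge0.
rewrite ler_pdivrMr// mul1r; apply: le_trans (row_count _ _ (in_mono inst) i).
apply: ler_sum => e _; have /andP[a0 a1] := a01 e; have /andP[r0 r1] := r01 (col e).
by rewrite mulr_ile1.
Qed.

Lemma half_step (b : bool) (q : nat) (eps : R) : is_sign eps -> b = (0 <= eps)%R ->
  (((q + b) %/ 2)%N%:R * 2 = q%:R + (if odd q then eps else 0) :> R)%R.
Proof.
move=> epsS ->; rewrite -natrM.
have : ((q + (0 <= eps)%R) %/ 2 * 2 = if odd q then if (0 <= eps)%R then q.+1 else q.-1 else q)%N.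
  by case: (0 <= eps)%R; case: ifP; lia.
move=> ->; case: ifP => oq; last by rewrite addr0.
case: epsS => ->; rewrite ?ler01 ?ler0N1; first by rewrite natr1.
by rewrite -subn1 natrB//; case: q oq.
Qed.

Lemma evP_round E lgam lT lka : glob E -> lookup E Lp (arrR p n) ->
  lookup E lgam (VReal (step_size R ell)) ->
  lookup E lT (VWord (walk_len ell K)) -> lookup E lka (VReal (kappa0 R K)) ->
  evalsP W s E (cround lgam lT lka)
    (fun v => exists q : nat -> nat,
     [/\ v = arrW q n, forall j, (j < n)%N -> (q j <= 1)%N
       & forall i, (i < m)%N ->
         (`|row_val q i - row_mu i| <= 20 * 1000 * (Num.sqrt (row_mu i * ell%:R) + ell%:R))%R])
    (1000 + K * (2000 + 1000 * lg + K * (3000 + 1200 * lg +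
       walk_len ell K * (4000 + 1200 * lg + K * (1000 + 400 * lg))))).
Proof.
move=> G hp hgam hT hka; have [w1 w2 w3 [w4 w4'] w5] := W_bounds inst bigW.
have W3 : (2 ^ lg * 3 <= W)%N by nia.
have KW : (2 ^ K <= 2 ^ lg)%N by rewrite leq_exp2l// leq_addl.
have E1R : (1 <= ell%:R :> R)%R by rewrite ler1n (ell_gt0 inst).
apply: evP_cost.
eapply evP_let; first exact: evP_bits G hp.
move=> u E1 l [q0 [r0 [-> q0K r01 pE]]] hx hl; jlift hx.
pstep_as (@VVec R (mkseq (fun i => VWord (q0 i)) n)); [by []|].
apply: (@evP_le _ _ _ _ _ (round_inv K)); first apply: (evP_for (Inv := round_inv)).
- by jauto.
- apply: ev_evP; first by jauto.
  exists q0; split => //.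
  + by move=> j _; rewrite subn0 ltnW.
  + move=> i im; rewrite subn0; apply: le_trans (row_val_init i r01 pE) _.
    rewrite /dev_bound -addrA lerDl addr_ge0//.
    by rewrite !mulr_ge0 ?sqrtr_ge0// exprn_ge0// dev_ratio_ge0.
- by lia.
- move=> t u1 E' li lu tK [q [-> qK qD]] hx1 hi hu; jlift hx1.
  have eK : (K - t = (K - t.+1).+1)%N by lia.
  set k := (K - t.+1)%N in eK *.
  have qK' j : (j < n)%N -> (q j <= 2 ^ K)%N.
    by move=> jn; apply: leq_trans (qK j jn) _; rewrite leq_exp2l//; lia.
  apply: evP_le; first by apply: (evP_balance inst bigW sE a01 qK'); first eassumption; jlookup.
  + move=> v [eps [-> epsS epsD]].
    exists (fun j => (q j + (0 <= eps j)%R) %/ 2)%N; split => //.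
      by move=> j /qK; rewrite eK expnS -/k; case: (0 <= eps j)%R; lia.
    move=> i im; rewrite -/k.
    have D2 : (row_val (fun j => (q j + (0 <= eps j)%R) %/ 2)%N i / 2 ^+ k =
        row_val q i / 2 ^+ k.+1 + rowsum (fun e => odd_part K key a q e * eps (col e)) i / 2 ^+ k.+1)%R.
      rewrite -mulrDl /row_val /segsum -big_split /= exprS invfM mulrA; congr (_ / _)%R.
      apply: (mulIf (_ : 2 != 0)%R) => //; rewrite -mulrA mulVf// mulr1 mulr_suml.
      apply: eq_bigr => e _; rewrite -mulrA (half_step _ (epsS _) erefl) /odd_part.
      by case: ifP => _; ring.
    rewrite D2; apply: (dev_step (s := rowsum (odd_part K key a q) i) (row_mu_ge0 i) E1R).
    + by have := qD i im; rewrite eK.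
    + by apply: row_sum_ge0 a01 _ _.
    + rewrite mulrC divfK ?expf_neq0// . apply: ler_sum => e _.
      have /andP[a0 a1] := a01 e; rewrite /odd_part; case: ifP => oq; last by rewrite mulr_ge0.
      by rewrite ler_peMr// ler1n; case: (q _) oq.
    + exact: epsD.
  + exact: leqnn.
- move=> v [q [-> qK qD]]; exists q; split => //.
  + by move=> j /qK; rewrite subnn expn0.
  + move=> i im; have := qD i im; rewrite subnn expr0 divr1.
    exact: (dev_final (row_mu_ge0 i) E1R).
- exact: leqnn.
by lia.
Qed.

End RoundProgram.

(** * Binary logarithm and radix sort *)

(** A [While] of its own and not a [cfor], since the number of rounds is the result. It also returns
    the power of two reached. *)
Definition clog (x : lterm) : lterm := fun d =>
  Let (Pair (Word 0) (Word 1))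
    (While (WordOp WLe (Snd (Var 0)) (x d.+1))
       (Pair (WordOp WAdd (Fst (Var 0)) (Word 1)) (WordOp WMul (Snd (Var 0)) (Word 2)))).

Lemma ev_log (R : realType) W s (E : seq (value R)) e x q : (0 < x)%N -> (2 * x <= W)%N ->
  evals W s E e (VWord x) q ->
  evals W s E (clog e) (VPair (VWord (trunc_log 2 x).+1) (VWord (2 ^ (trunc_log 2 x).+1)))
    (20 + q + (trunc_log 2 x).+1 * (q + 20)).
Proof.
move=> x0 xW He E' EE'; set L := (trunc_log 2 x).+1.
have xL : (x < 2 ^ L)%N by apply: trunc_log_ltn.
have Lx : (2 ^ L <= 2 * x)%N by rewrite expnS leq_mul2l trunc_logP.
pose whl d := (While (WordOp WLe (Snd (Var 0)) (e d.+1))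
       (Pair (WordOp WAdd (Fst (Var 0)) (Word 1)) (WordOp WMul (Snd (Var 0)) (Word 2)))).
suff key k i : (i + k = L)%N -> exists w d,
      [/\ eval_wd W (VPair (VWord i) (VWord (2 ^ i)) :: E') (whl (size E'))
            (VPair (VWord L) (VWord (2 ^ L))) w d,
          (w <= s.+1 * (q + 10 + k * (q + 20)))%N & (d <= q + 10 + k * (q + 20))%N].
  have [w [d [ew ws ds]]] := key L 0 (add0n L).
  exists ((1 + 1).+1 + w).+1, ((1 + 1).+1 + d).+1; split; try nia.
  by apply: EvLet ew; apply: EvPair; apply: EvWord; lia.
move: k i.
have evc i : exists w1 d1, [/\ eval_wd W (VPair (VWord i) (VWord (2 ^ i)) :: E')
     (WordOp WLe (Snd (Var 0)) (e (size E').+1)) (VWord (2 ^ i <= x)%N) w1 d1,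
     (w1 <= s.+1 * (q + 4))%N & (d1 <= q + 4)%N].
  have [w1 [d1 [e1 ws1 ds1]]] := He _ (extends_cons (VPair (VWord i) (VWord (2 ^ i))) EE').
  exists (2 + w1).+1, (2 + d1).+1; split; try nia.
  apply: (@EvWordOp _ _ _ WLe _ _ (2 ^ i) x) e1 _; last by rewrite /=; case: leqP => //; lia.
  by apply: EvSnd; apply: EvVar.
elim=> [i ik|k IH i ik]; have [w1 [d1 [e1 ws1 ds1]]] := evc i.
  have {}ik : i = L by lia.
  exists w1.+1, d1.+1; split; try nia.
  by rewrite {}ik leqNgt xL in e1 *; apply: EvWhileStop.
have [|w3 [d3 [e3 ws3 ds3]]] := IH i.+1; first by lia.
have ix : (2 ^ i <= x)%N.
  by apply: leq_trans (_ : 2 ^ trunc_log 2 x <= _)%N; rewrite ?trunc_logP// leq_exp2l//; lia.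
exists (w1 + ((2 + 1).+1 + (2 + 1).+1).+1 + w3).+1, (d1 + ((2 + 1).+1 + (2 + 1).+1).+1 + d3).+1.
split; try nia.
apply: EvWhileStep e1 _ _ e3; first by rewrite ix.
have iW : (i < W)%N by have := ltn_expl i (ltnSn 1); lia.
apply: EvPair; [have -> : i.+1 = word_op_sem WAdd i 1 by rewrite /= addn1|rewrite expnSr].
  apply: (@EvWordOp _ _ _ WAdd _ _ i 1); last by rewrite /=; lia.
    by apply: EvFst; apply: EvVar.
  by apply: EvWord; lia.
apply: (@EvWordOp _ _ _ WMul _ _ (2 ^ i) 2); last by rewrite /=; lia.
  by apply: EvSnd; apply: EvVar.
by apply: EvWord; lia.
Qed.

Section Select.
Variables (z : nat) (P : nat -> bool).

Definition rank i := (\sum_(j < i.+1) P j)%N.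
(* The position of the [t]-th element of [P], found by binary search in the prefix counts. *)
Definition select t := below z rank t.+1.

Lemma rank_homo e e' : (e < e' < z)%N -> (rank e <= rank e')%N.
Proof.
move=> /andP[ee' _]; rewrite /rank -!(big_mkord predT (fun j => P j : nat)).
by rewrite (@big_cat_nat _ _ _ e.+1 0 e'.+1)//= ?leq_addr//; lia.
Qed.

Lemma selectP t : (t < \sum_(j < z) P j)%N ->
  [/\ (select t < z)%N, P (select t) & rank (select t) = t.+1].
Proof.
move=> tz; have lt e (ez : (e < z)%N) : (rank e <= t)%N = (e < select t)%N := below_lt rank_homo t.+1 ez.
have z0 : (0 < z)%N by case: z tz {lt} => //; rewrite big_ord0.
have sz : (select t < z)%N.
  have := below_le z rank t.+1; rewrite leq_eqVlt => /orP[/eqP sE|//].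
  by have := lt z.-1; rewrite /select sE /rank prednK// leqnn => /(_ isT); rewrite leqNgt tz.
have := lt _ sz; rewrite ltnn => /negbT; rewrite -ltnNge => rs.
have rt : (rank (select t) = (if select t is i.+1 then rank i else 0) + P (select t))%N.
  by rewrite /rank; case: (select t) => [|i]; rewrite big_ord_recr//= big_ord0.
have rp : ((if select t is i.+1 then rank i else 0) <= t)%N.
  case sE : (select t) => [//|i]; rewrite lt ?sE//; apply: ltn_trans sz; by rewrite sE.
by move: rs rt; case: (P _) => /= *; split => //; lia.
Qed.

Lemma select_lt t t' : (t < t' < \sum_(j < z) P j)%N -> (select t < select t')%N.
Proof.
move=> /andP[tt' tz]; have [s1 _ r1] := selectP (ltn_trans tt' tz); have [s2 _ r2] := selectP tz.
case: (ltngtP (select t) (select t')) => [//|lt|E]; last by move: r1; rewrite E r2; lia.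
by have := @rank_homo (select t') (select t); rewrite lt s1 => /(_ isT); lia.
Qed.

End Select.

Section Partition.
Variables (z : nat) (b : nat -> bool).

Definition zeros := (\sum_(j < z) ~~ b j)%N.
(** The source position of the element that lands at [t]: [Tab] can read from computed positions but
    not write to them, so the stable partition is done by gathering. *)
Definition partition_index t :=
  if (t < zeros)%N then select z (fun j => ~~ b j) t else select z b (t - zeros).

Lemma zeros_ones : (zeros + \sum_(j < z) b j = z)%N.
Proof.
rewrite /zeros -big_split /= -[RHS](card_ord z) -sum1_card; apply: eq_bigr => i _.
by case: (b i).
Qed.

Lemma partition_index_lt t : (t < z)%N -> (partition_index t < z)%N.
Proof.
move=> tz; have zo := zeros_ones; rewrite /partition_index; case: (ltnP t zeros) => h.
  by have [] := @selectP z (fun j => ~~ b j) t h.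
by case: (@selectP z b (t - zeros)) => //; lia.
Qed.

Lemma partition_index_bit t : (t < z)%N -> b (partition_index t) = (zeros <= t)%N.
Proof.
move=> tz; have zo := zeros_ones; rewrite /partition_index; case: (ltnP t zeros) => h.
  by have [_ /negbTE] := @selectP z (fun j => ~~ b j) t h.
by case: (@selectP z b (t - zeros)) => //; lia.
Qed.

Lemma partition_index_homo t t' : (t < t' < z)%N ->
  b (partition_index t) = b (partition_index t') ->
  (partition_index t < partition_index t')%N.
Proof.
move=> /andP[tt' tz]; have zo := zeros_ones.
rewrite !partition_index_bit ?(ltn_trans tt')// /partition_index.
case: (ltnP t zeros) => h; case: (ltnP t' zeros) => h' // _; first by apply: select_lt; rewrite tt'.
by apply: select_lt; lia.
Qed.

Lemma partition_index_inj t t' : (t < z)%N -> (t' < z)%N ->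
  partition_index t = partition_index t' -> t = t'.
Proof.
move=> tz tz' E; case: (ltngtP t t') => // lt.
  by have := @partition_index_homo t t'; rewrite lt tz' E ltnn => /(_ isT erefl).
by have := @partition_index_homo t' t; rewrite lt tz E ltnn => /(_ isT erefl).
Qed.

End Partition.

Section RadixInvariant.
Variables (z : nat) (raw : nat -> nat).

Definition sorted_mod h (idx : nat -> nat) := [/\
  forall t, (t < z)%N -> (idx t < z)%N,
  forall t t', (t < z)%N -> (t' < z)%N -> idx t = idx t' -> t = t'
  & forall t t', (t < t' < z)%N -> (raw (idx t) %% 2 ^ h <= raw (idx t') %% 2 ^ h)%N].

Definition radix_step h (idx : nat -> nat) t :=
  idx (partition_index z (fun j => odd (raw (idx j) %/ 2 ^ h)) t).

Lemma modn_pow_succ x h : (x %% 2 ^ h.+1 = x %% 2 ^ h + odd (x %/ 2 ^ h) * 2 ^ h)%N.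
Proof.
rewrite {1}(divn_eq x (2 ^ h)) {1}(divn_eq (x %/ 2 ^ h) 2) modn2.
rewrite mulnDl -mulnA -expnS -addnA modnMDl addnC modn_small//.
have := ltn_pmod x (_ : 0 < 2 ^ h)%N; rewrite expn_gt0 => /(_ isT).
by rewrite expnS; case: odd; lia.
Qed.

(** Keys with different bits [h] are ordered by that bit; keys with equal bits keep their previous
    order, which is the order modulo [2 ^ h]. *)
Lemma radix_step_sorted h idx : sorted_mod h idx -> sorted_mod h.+1 (radix_step h idx).
Proof.
move=> [iz ii im]; set b := fun j => odd (raw (idx j) %/ 2 ^ h).
have pz t : (t < z)%N -> (partition_index z b t < z)%N by apply: partition_index_lt.
split.
- by move=> t /pz/iz.
- move=> t t' tz tz' /ii E; apply: (@partition_index_inj z b) => //; apply: E; exact: pz.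
- move=> t t' /andP[tt' tz']; have tz := ltn_trans tt' tz'.
  rewrite !modn_pow_succ /radix_step -!/(b _) !partition_index_bit//.
  have M x : (raw x %% 2 ^ h < 2 ^ h)%N by rewrite ltn_pmod// expn_gt0.
  case E : (zeros z b <= t)%N; case E' : (zeros z b <= t')%N.
  + rewrite leq_add2r im// pz// andbT; apply: partition_index_homo; rewrite ?tt'//.
    by rewrite -!/(b _) !partition_index_bit// E E'.
  + by move: E E'; lia.
  + by rewrite mul0n addn0 mul1n ltnW// ltn_addl.
  + rewrite !mul0n !addn0 im// pz// andbT; apply: partition_index_homo; rewrite ?tt'//.
    by rewrite -!/(b _) !partition_index_bit// E E'.
Qed.

End RadixInvariant.

Definition cselect (ls lt : nat) : lterm :=
  cbsearch Lz Lpw Llg (fun i => cle (cgetW (cvar ls) (cvar i)) (cvar lt)).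
Definition crank (la : nat) : lterm := cscan Lz Llg (fun x y => cadd (cvar x) (cvar y)) la.

Definition cradix (lraw st : nat) : lterm :=
  clet (cfst (cvar st)) (fun pw =>
  clet (csnd (cvar st)) (fun idx =>
  clet (ctab (cvar Lz) (fun t =>
    cbit (cgetW (cvar lraw) (cgetW (cvar idx) (cvar t))) (cvar pw))) (fun ones =>
  clet (ctab (cvar Lz) (fun t => csub (cword 1) (cgetW (cvar ones) (cvar t)))) (fun zers =>
  clet (crank ones) (fun r1 =>
  clet (crank zers) (fun r0 =>
  clet (cpref (cword 0) r0 Lz) (fun n0 =>
  cpair (cadd (cvar pw) (cvar pw))
    (ctab (cvar Lz) (fun t =>
      cgetW (cvar idx) (cifW (cle (cadd (cvar t) (cword 1)) (cvar n0))
        (cselect r0 t)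
        (clet (csub (cvar t) (cvar n0)) (fun t1 => cselect r1 t1)))))))))))).

Definition csort (lraw : nat) : lterm :=
  clet (cfor (cvar Llg) (cpair (cword 1) (ctab (cvar Lz) (fun t => cvar t)))
    (fun _ st => cradix lraw st)) (fun r => csnd (cvar r)).

Section SortProgram.
Variables (R : realType) (W s z lg : nat) (raw : nat -> nat).
Hypothesis zs : (z <= s.+1)%N.
Hypothesis zlg : (z < 2 ^ lg)%N.
Hypothesis lgW : (2 ^ lg * 1000 <= W)%N.
Hypothesis raw_lg : forall e, (e < z)%N -> (raw e < 2 ^ lg)%N.

Lemma ev_select (E : seq (value R)) P ls lt t :
  lookup E Lz (VWord z) -> lookup E Llg (VWord lg) -> lookup E Lpw (VWord (2 ^ lg)) ->
  lookup E ls (arrW (rank P) z) -> lookup E lt (VWord t) ->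
  evals W 0 E (cselect ls lt) (VWord (select z P t)) (40 + lg * 70).
Proof.
clear zs raw_lg.
move=> hz hlg hpw hs ht; apply: ev_le.
  apply: (ev_bsearch (qt := 5) hz hpw hlg zlg); [by lia|exact: below_le|].
  move=> i E1 l iz h hl; jlift h; jrun; [|by lia].
  by congr VWord; congr nat_of_bool; rewrite -ltnS (below_lt (@rank_homo z P)).
by lia.
Qed.

Lemma ev_rank (E : seq (value R)) (f : nat -> nat) la : (forall e, f e <= 1)%N ->
  lookup E Lz (VWord z) -> lookup E Llg (VWord lg) ->
  lookup E la (arrW f z) ->
  evals W s E (crank la) (arrW (fun i => \sum_(j < i.+1) f j)%N z) (40 + lg * 90).
Proof.
clear raw_lg.
move=> f1 hz hlg ha; apply: ev_le.
  apply: (ev_scan (opT := addn) (inj := VWord) (qo := 5)) hz hlg ha _ zs _ _ _; [by lia..|].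
  move=> i1 i2 i3 E1 l1 l2 /andP[i12 i23] i3k h h1 h2; jrun; last by [].
    rewrite -big_cat_nat//; apply: leq_trans (_ : \sum_(i1 <= j < i3) 1 <= _)%N.
      by apply: leq_sum => j _; exact: f1.
    by rewrite sum_nat_const_nat muln1; lia.
  by congr VWord; rewrite -big_cat_nat.
by lia.
Qed.

End SortProgram.

Section Sort.
Variables (R : realType) (W s z lg : nat) (raw : nat -> nat).
Hypothesis zs : (z <= s.+1)%N.
Hypothesis zlg : (z < 2 ^ lg)%N.
Hypothesis lgW : (2 ^ lg * 1000 <= W)%N.
Hypothesis raw_lg : forall e, (e < z)%N -> (raw e < 2 ^ lg)%N.

Definition radix_inv h (v : value R) := exists idx,
  v = VPair (VWord (2 ^ h)) (arrW idx z) /\ sorted_mod z raw h idx.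

Lemma evP_radix E lraw st h u : (h < lg)%N ->
  lookup E Lz (VWord z) -> lookup E Llg (VWord lg) -> lookup E Lpw (VWord (2 ^ lg)) ->
  lookup E lraw (arrW raw z) -> lookup E st u -> radix_inv h u ->
  evalsP W s E (cradix lraw st) (radix_inv h.+1) (300 + lg * 400).
Proof.
move=> hlt hz hlg hpw hraw hst [idx [uE srt]]; rewrite {}uE in hst.
have [iz _ _] := srt.
have l2 : (2 ^ h.+1 <= 2 ^ lg)%N by rewrite leq_exp2l.
have e2 : (2 ^ h.+1 = 2 ^ h + 2 ^ h)%N by rewrite expnS mul2n addnn.
pose b t := odd (raw (idx t) %/ 2 ^ h).
have W0 : (0 < W)%N by lia.
apply: (@ev_evP _ _ _ _ _ (VPair (VWord (2 ^ h.+1)) (arrW (radix_step z raw h idx) z))); last first.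
  by exists (radix_step z raw h idx); split => //; exact: radix_step_sorted.
apply: (ev_le (q := (5 + (5 + (20 + (20 +
  (40 + lg * 90 + (40 + lg * 90 + (15 + (100 + lg * 140)).+1).+1).+1).+1).+1).+1).+1));
  last by lia.
apply: ev_let; first by eapply ev_eq; [jauto|reflexivity|].
move=> E1 l1 h1 hl1; jlift h1.
apply: ev_let; first by eapply ev_eq; [jauto|reflexivity|].
move=> E2 l2' h2 hl2; jlift h2.
apply: (ev_let (u := arrW (fun t => b t : nat) z)).
  eapply ev_eq; [jauto| |].
  - by match goal with H : is_true (leq (S ?e) z) |- _ =>
      have := raw_lg (iz _ H); have := leq_div (raw (idx e)) (2 ^ h) end; lia.
  - by apply: iz.
  - by [].
  - by [].
move=> E3 l3 h3 hl3; jlift h3.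
apply: (ev_let (u := arrW (fun t => ~~ b t : nat) z)).
  eapply ev_eq; [jauto| |].
  - by congr VVec; apply: eq_mkseq => t; case: (b t).
  - by [].
move=> E4 l4 h4 hl4; jlift h4.
apply: ev_let; first by
  eapply (@ev_rank R W s z lg zs zlg lgW _ (fun t => b t : nat)); [|jlookup..] => e; exact: leq_b1.
move=> E5 l5 h5 hl5; jlift h5.
apply: ev_let; first by
  eapply (@ev_rank R W s z lg zs zlg lgW _ (fun t => ~~ b t : nat)); [|jlookup..] => e; exact: leq_b1.
move=> E6 l6 h6 hl6; jlift h6.
apply: (ev_let (u := VWord (zeros z b))).
  apply: ev_scale.
  apply: (ev_pref (opT := addn) (inj := VWord) (f := fun t => ~~ b t : nat) W0 (leqnn z) _ hl6 _ _) => //.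
  - by lia.
  - by jrun.
move=> E7 l7 h7 hl7; jlift h7.
have zo := zeros_ones z b.
eapply ev_eq; [jauto| |].
- by eapply (@ev_select R W z lg zlg lgW _ (fun j => ~~ b j)); jlookup.
- by eapply (@ev_select R W z lg zlg lgW _ b); jlookup.
- by rewrite addn1; apply: partition_index_lt.
- by rewrite e2; congr (VPair _ (VVec _)); apply: eq_mkseq => t; rewrite addn1.
- by lia.
Qed.

Lemma radix_inv0 : radix_inv 0 (VPair (VWord 1) (arrW id z)).
Proof. by exists id; split => //; split => // t t' _; rewrite !modn1. Qed.

Definition sorted_index (idx : nat -> nat) := [/\
  forall t, (t < z)%N -> (idx t < z)%N,
  forall t t', (t < z)%N -> (t' < z)%N -> idx t = idx t' -> t = t'
  & forall t t', (t < t' < z)%N -> (raw (idx t) <= raw (idx t'))%N].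

Lemma evP_sort (E : seq (value R)) lraw :
  lookup E Lz (VWord z) -> lookup E Llg (VWord lg) -> lookup E Lpw (VWord (2 ^ lg)) ->
  lookup E lraw (arrW raw z) ->
  evalsP W s E (csort lraw) (fun v => exists2 idx, v = arrW idx z & sorted_index idx)
    (100 + lg * (400 + lg * 400)).
Proof.
move=> hz hlg hpw hraw; have := ltn_expl lg (ltnSn 1) => lgl.
apply: evP_cost; first eapply (evP_let (P := radix_inv lg)).
- apply: (evP_for (Inv := radix_inv) (qb := 300 + lg * 400)).
  + by jauto.
  + by apply: ev_evP radix_inv0; jauto.
  + by lia.
  + move=> h u E1 li lu hlt inv_u hx hi hu; jlift hx.
    exact: evP_radix hlt hz hlg hpw hraw hu inv_u.
- move=> u E1 l [idx [-> [iz ii im]]] hx hl; jlift hx.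
  apply: (@ev_evP _ _ _ _ _ (arrW idx z)); first by eapply ev_eq; [jauto|by []|exact: leqnn].
  exists idx => //; split => // t t' tt'; have := im t t' tt'.
  have /andP[tt'' tz'] := tt'.
  by rewrite !modn_small// raw_lg// iz//; apply: ltn_trans tz'.
- by lia.
Qed.

End Sort.

(** * The whole program *)

Definition cprog : lterm :=
  clet (clen (cvar Lmat)) (fun=>
  clet (cfst (clog (cvar Lm))) (fun=>
  clet (cfst (clog (cvar Ln))) (fun=>
  clet (csnd (clog (cvar Ln))) (fun=>
  clet (cadd (cvar Lell) (cvar LK)) (fun=>
  clet (cmul (csnd (clog (cvar Lm))) (cvar LN)) (fun=>
  clet (ctab (cvar Lz) (fun e => clet (cget (cvar Lmat) (cvar e)) (fun t =>
    cadd (cmul (cfst (cvar t)) (cvar LN)) (cfst (csnd (cvar t)))))) (fun raw =>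
  clet (csort raw) (fun idx =>
  clet (ctab (cvar Lz) (fun e => cgetW (cvar raw) (cgetW (cvar idx) (cvar e)))) (fun=>
  clet (ctab (cvar Lz) (fun e => clet (cget (cvar Lmat) (cgetW (cvar idx) (cvar e))) (fun t =>
    csnd (csnd (cvar t))))) (fun=>
  clet (rdiv (rnat 1) (creal (cmul (cword 4) (cvar Lell)))) (fun lgam =>
  clet (cmul (cmul (cmul (cword 4) (cvar Lell)) (cmul (cword 4) (cvar Lell)))
    (cadd (cadd (cmul (cword 2) (cvar LK)) (cmul (cword 2) (cvar Lell))) (cword 4))) (fun lT =>
  clet (rdiv (rnat 1) (rmul (creal (cvar LN)) (creal (cvar LN)))) (fun lka =>
  cround lgam lT lka))))))))))))).

Section ExactEnvironment.
Variables (R : realType) (W s : nat).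
Implicit Types (E : seq (value R)).

(** Global names are fixed levels such as [Lz = 4], so the first bindings of the program are run in
    an environment of known size and not in an arbitrary extension. *)
Definition runsP E t (Q : value R -> Prop) q := exists2 v, Q v & runs W s E t v q.

Lemma runsP_let E e f (P Q : value R -> Prop) q1 q2 : evalsP W s E e P q1 ->
  (forall u, P u -> runsP (u :: E) (f (size E)) Q q2) ->
  runsP E (clet e f) Q (q1 + q2).+1.
Proof.
move=> /(_ E (extends_refl _))[u Pu [w1 [d1 [e1 ws1 ds1]]]].
move=> /(_ u Pu)[v Qv [w2 [d2 [e2 ws2 ds2]]]]; exists v => //.
exists (w1 + w2).+1, (d1 + d2).+1; split; [exact: EvLet e1 e2|nia|lia].
Qed.

Lemma runsP_ev_let E e f u (Q : value R -> Prop) q1 q2 : evals W s E e u q1 ->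
  runsP (u :: E) (f (size E)) Q q2 -> runsP E (clet e f) Q (q1 + q2).+1.
Proof.
by move=> H1 H2; apply: runsP_let (ev_evP H1 (erefl u)) _ => _ <-.
Qed.

Lemma runsP_evP E t (Q : value R -> Prop) q : evalsP W s E t Q q -> runsP E t Q q.
Proof. by move=> /(_ E (extends_refl _))[v Qv r]; exists v. Qed.

Lemma runsP_cost E t (Q : value R -> Prop) q q' : runsP E t Q q -> (q <= q')%N ->
  runsP E t Q q'.
Proof.
move=> [v Qv [w [d [ev ws ds]]]] qq; exists v => //; exists w, d; split => //; last by lia.
by apply: leq_trans ws _; rewrite leq_mul2l qq.
Qed.

End ExactEnvironment.

Ltac jvar := eapply ev_var; split; [by []|reflexivity].

Section Program.
Variables (R : realType) (W s m n z : nat) (ri ci : nat -> nat) (av p : nat -> R).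
Local Notation ell := (trunc_log 2 m).+1.
Local Notation K := (trunc_log 2 n).+1.
Local Notation lg := (ell + K)%N.
Hypothesis m0 : (0 < m)%N.
Hypothesis n0 : (0 < n)%N.
Hypothesis zmn : (z <= m * n)%N.
Hypothesis bigW : (2 ^ (20 + 4 * lg) <= W)%N.
Hypothesis sE : s.+1 = (n + m + z)%N.
Hypothesis rim : forall e, (e < z)%N -> (ri e < m)%N.
Hypothesis cin : forall e, (e < z)%N -> (ci e < n)%N.
Hypothesis rc_inj : forall e e', (e < z)%N -> (e' < z)%N ->
  ri e = ri e' -> ci e = ci e' -> e = e'.
Hypothesis a01 : forall e, (0 <= av e <= 1)%R.
Hypothesis p01 : forall j, (0 <= p j <= 1)%R.

Definition raw_key e := (ri e * 2 ^ K + ci e)%N.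

Lemma pow_bounds x : (0 < x)%N ->
  (x < 2 ^ (trunc_log 2 x).+1)%N /\ (2 ^ (trunc_log 2 x).+1 <= 2 * x)%N.
Proof.
by move=> x0; split; [exact: trunc_log_ltn | rewrite expnS leq_mul2l trunc_logP].
Qed.

Lemma ci_lt e : (e < z)%N -> (ci e < 2 ^ K)%N.
Proof. by move=> /cin /ltn_trans; apply; case: (pow_bounds n0). Qed.

Lemma raw_row e : (e < z)%N -> (raw_key e %/ 2 ^ K = ri e)%N.
Proof. by move=> /ci_lt h; rewrite /raw_key divnMDl ?expn_gt0// divn_small// addn0. Qed.

Lemma raw_col e : (e < z)%N -> (raw_key e %% 2 ^ K = ci e)%N.
Proof. by move=> /ci_lt h; rewrite /raw_key modnMDl modn_small. Qed.

Lemma raw_key_lt e : (e < z)%N -> (raw_key e < m * 2 ^ K)%N.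
Proof.
move=> ez; apply: leq_trans (_ : (ri e).+1 * 2 ^ K <= _)%N; last by rewrite leq_mul2r rim// orbT.
by have := ci_lt ez; rewrite mulSn /raw_key; lia.
Qed.

(** Distinct entries differ in row or column and hence in key, so sorted keys are strictly
    increasing. *)
Lemma sorted_instance idx : sorted_index z raw_key idx ->
  instance m n z ell K (fun e => raw_key (idx e)).
Proof.
move=> [iz ii im]; have [m1 m2] := pow_bounds m0; have [n1 n2] := pow_bounds n0.
split => //; rewrite ?m0 ?n0//.
- by move=> e /iz/raw_key_lt.
- by move=> e /iz ez; rewrite raw_col// cin.
- move=> e e' ee'; have /andP[lt ez'] := ee'; have ez := ltn_trans lt ez'.
  rewrite ltn_neqAle im// andbT; apply/eqP => E.
  have : e = e'.
    apply: ii => //; apply: rc_inj; [exact: iz|exact: iz| |].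
      by rewrite -raw_row ?iz// E raw_row ?iz.
    by rewrite -raw_col ?iz// E raw_col ?iz.
  by move: lt => /[swap] ->; rewrite ltnn.
Qed.

Lemma segsum_sorted idx (g : nat -> R) i : sorted_index z raw_key idx ->
  segsum z (fun e => raw_key (idx e)) (fun e => g (idx e)) (2 ^ K) i =
  (\sum_(e < z | ri e == i) g e)%R.
Proof.
move=> [iz ii _]; pose h (e : 'I_z) := Ordinal (iz e (ltn_ord e)).
have h_inj : injective h by move=> e e' /(congr1 val)/= /ii E; apply/val_inj/E.
rewrite /segsum [RHS](reindex_inj h_inj) /=; apply: eq_bigl => e.
by rewrite raw_row// iz.
Qed.

Lemma runsP_prog :
  runsP W s [:: VWord m; VWord n; arr (fun e => VPair (VWord (ri e)) (VPair (VWord (ci e)) (VReal (av e)))) z; arrR p n]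
    cprog
    (fun v => exists q : nat -> nat,
     [/\ v = arrW q n, forall j, (j < n)%N -> (q j <= 1)%N
       & forall i, (i < m)%N ->
         let mu := (\sum_(e < z | ri e == i) av e * p (ci e))%R in
         (`|\sum_(e < z | ri e == i) av e * (q (ci e))%:R - mu| <=
           20 * 1000 * (Num.sqrt (mu * ell%:R) + ell%:R))%R])
    (2000 + lg * (600 + lg * 400) + K * (2000 + 1000 * lg + K * (3000 + 1200 * lg +
       walk_len ell K * (4000 + 1200 * lg + K * (1000 + 400 * lg))))).
Proof.
have [m1 m2] := pow_bounds m0; have [n1 n2] := pow_bounds n0.
have W1 : (2 ^ 20 * (2 ^ lg * 2 ^ lg * 2 ^ lg * 2 ^ lg) <= W)%N.
  by apply: leq_trans bigW; rewrite -!expnD leq_exp2l//; lia.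
have lgl : (lg < 2 ^ lg)%N by exact: ltn_expl.
have l0 : (0 < 2 ^ lg)%N by rewrite expn_gt0.
have lE : (2 ^ lg = 2 ^ ell * 2 ^ K)%N by rewrite expnD.
have KW : (2 ^ K <= 2 ^ lg)%N by rewrite leq_exp2l// leq_addl.
have eW : (2 ^ ell <= 2 ^ lg)%N by rewrite leq_exp2l// leq_addr.
have lgW : (2 ^ lg * 1000 <= W)%N.
  by apply: leq_trans W1; rewrite mulnC; apply: leq_mul => //; rewrite -!mulnA leq_pmulr// !muln_gt0 l0.
have zlg : (z < 2 ^ lg)%N.
  by apply: leq_ltn_trans zmn _; rewrite lE; apply: ltn_mul.
have raw_lg e : (e < z)%N -> (raw_key e < 2 ^ lg)%N.
  move=> /raw_key_lt /leq_trans; apply; rewrite lE leq_mul2r (ltnW m1) orbT //.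
have zs : (z <= s.+1)%N by lia.
set mat := arr _ z.
set E0 := [:: _; _; _; _].
apply: runsP_cost.
  apply: (runsP_ev_let (u := VWord z)).
    eapply ev_eq; [eapply ev_len; [jvar|]| |exact: leqnn].
      by rewrite size_mkseq; lia.
    by rewrite size_mkseq.
  set E1 := _ :: E0.
  apply: (runsP_ev_let (u := VWord ell)).
    apply: ev_fst; apply: ev_log m0 _ _; [by lia|jvar].
  set E2 := _ :: E1.
  apply: (runsP_ev_let (u := VWord K)).
    apply: ev_fst; apply: ev_log n0 _ _; [by lia|jvar].
  set E3 := _ :: E2.
  apply: (runsP_ev_let (u := VWord (2 ^ K))).
    apply: ev_snd; apply: ev_log n0 _ _; [by lia|jvar].
  set E4 := _ :: E3.
  apply: (runsP_ev_let (u := VWord lg)).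
    by apply: ev_add; [jvar|jvar|lia].
  set E5 := _ :: E4.
  apply: (runsP_ev_let (u := VWord (2 ^ lg))).
    rewrite lE; apply: ev_mul; [|jvar|by rewrite -lE; lia].
    apply: ev_snd; apply: ev_log m0 _ _; [by lia|jvar].
  set E6 := _ :: E5.
  have hz : lookup E6 Lz (VWord z) by split.
  have hN : lookup E6 LN (VWord (2 ^ K)) by split.
  have hmat : lookup E6 Lmat mat by split.
  apply: (runsP_ev_let (u := arrW raw_key z)).
    rewrite /mat in hmat; eapply ev_eq; [jauto| |exact: leqnn].
    - by match goal with H : is_true (leq (S ?e) z) |- _ => have := raw_lg e H end; rewrite /raw_key; lia.
    - by match goal with H : is_true (leq (S ?e) z) |- _ => have := raw_lg e H end; rewrite /raw_key; lia.
    - by [].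
  set E7 := _ :: E6.
  apply: (runsP_let (P := fun v => exists2 idx, v = arrW idx z & sorted_index z raw_key idx)).
    by apply: (evP_sort zs zlg lgW raw_lg); split.
  move=> _ [idx -> srt]; have inst := sorted_instance srt; have [iz _ _] := srt.
  set E8 := _ :: E7.
  have hz8 : lookup E8 Lz (VWord z) by split.
  have hraw : lookup E8 (size E6) (arrW raw_key z) by split.
  have hidx : lookup E8 (size E7) (arrW idx z) by split.
  have hmat8 : lookup E8 Lmat (arr (fun e => VPair (VWord (ri e)) (VPair (VWord (ci e)) (VReal (av e)))) z) by split.
  apply: (runsP_ev_let (u := arrW (fun e => raw_key (idx e)) z)).
    by eapply ev_eq; [jauto; by apply: iz|by []|exact: leqnn].
  set E9 := _ :: E8.
  have h9 : extends E8 E9 by apply: extends_cons; exact: extends_refl.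
  jlift h9.
  apply: (runsP_ev_let (u := arrR (fun e => av (idx e)) z)).
    by eapply ev_eq; [jauto; by apply: iz|by []|exact: leqnn].
  set E10 := _ :: E9.
  have hell : lookup E10 Lell (VWord ell) by split.
  have hK : lookup E10 LK (VWord K) by split.
  have hN10 : lookup E10 LN (VWord (2 ^ K)) by split.
  apply: (runsP_ev_let (u := VReal (step_size R ell))).
    by apply: ev_eq; [jauto; lia| |exact: leqnn].
  set E11 := _ :: E10.
  have h11 : extends E10 E11 by apply: extends_cons; exact: extends_refl.
  jlift h11.
  have TW := walk_len_W inst bigW sE.
  have WA : (4 * ell * (4 * ell) <= W)%N by apply: leq_trans _ (ltnW TW); rewrite leq_pmulr// addnS.
  apply: (runsP_ev_let (u := VWord (walk_len ell K))).
    by apply: ev_eq; [jauto; first [exact: WA|exact: ltnW TW|lia]| |exact: leqnn].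
  set E12 := _ :: E11.
  have h12 : extends E11 E12 by apply: extends_cons; exact: extends_refl.
  jlift h12.
  apply: (runsP_ev_let (u := VReal (kappa0 R K))).
    by apply: ev_eq; [jauto; lia| |exact: leqnn].
  set E13 := _ :: E12.
  apply: runsP_evP; apply: evP_le; first
    apply: (evP_round (a := fun e => av (idx e)) inst bigW sE (fun e => a01 (idx e)) p01) => //.
  - move=> v [q [-> q1 qD]]; exists q; split => // i im.
    have := qD i im; rewrite /row_val /row_mu.
    have E f : (segsum z (fun e => raw_key (idx e)) (fun e => av (idx e) * f (raw_key (idx e) %% 2 ^ K)%N) (2 ^ K) i
      = \sum_(e < z | ri e == i) av e * f (ci e))%R.
      rewrite -(segsum_sorted (fun e => av e * f (ci e))%R i srt); apply: eq_bigr => e _.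
      by rewrite raw_col// iz.
    by rewrite (E (fun j => (q j)%:R)%R) (E p).
  - exact: leqnn.
by lia.
Qed.

End Program.

(** * Bit lengths against natural logarithms *)

Section Logarithms.
Local Open Scope ring_scope.
Variable R : realType.

Lemma ln2_ge : 1 / 2 <= ln 2 :> R.
Proof.
have h : (-1 < - (1 / 2) :> R) by lra.
have := le_ln1Dx h; have -> : 1 + - (1 / 2) = 2^-1 :> R by lra.
by rewrite lnV ?posrE//; lra.
Qed.

Lemma bits_le_ln c x : (0 < c)%N -> (2 ^ c <= x)%N -> c%:R <= 2 * ln x%:R :> R.
Proof.
move=> c0 cx; have := ln2_ge => h2.
have : ln (2 ^ c)%:R <= ln x%:R :> R.
  by rewrite ler_ln ?posrE ?ltr0n ?expn_gt0 ?ler_nat// (leq_trans _ cx)// expn_gt0.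
rewrite natrX lnXn// -[X in X <= _]mulr_natl.
have : 0 <= c%:R :> R by [].
by nra.
Qed.

Lemma bits_le_ln4 c x : (0 < c)%N -> (0 < x)%N -> (2 ^ c <= 4 * x)%N ->
  c%:R <= 2 * (ln x%:R + 2) :> R.
Proof.
move=> c0 x0 cx; apply: le_trans (bits_le_ln c0 cx) _.
rewrite natrM lnM ?posrE ?ltr0n// -[4%N]/(2 ^ 2)%N natrX lnXn//.
by have := ln2_le1 R; rewrite -mulr_natl; lra.
Qed.

(** The power of two in question is at most [2 m], hence at most the square of [maxn m 2]; a further
    factor 2 comes from [ln 2 >= 1/2]. *)
Lemma log_rows_ge m : (0 < m)%N -> (trunc_log 2 m).+1%:R <= 4 * log_rows R m.
Proof.
move=> m0; have [_ m2] := pow_bounds m0.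
have M2 : (2 ^ (trunc_log 2 m).+1 <= maxn m 2 * maxn m 2)%N.
  by apply: leq_trans m2 _; rewrite mulnC leq_mul ?leq_maxl ?leq_maxr.
have := bits_le_ln (ltn0Sn _) M2; rewrite natrM lnM ?posrE ?ltr0n ?leq_max ?orbT//.
by rewrite /log_rows; lra.
Qed.

Lemma bound_log_rows m (mu : R) : (0 < m)%N -> 0 <= mu ->
  20 * 1000 * (Num.sqrt (mu * (trunc_log 2 m).+1%:R) + (trunc_log 2 m).+1%:R) <=
    80 * 1000 * (Num.sqrt (mu * log_rows R m) + log_rows R m).
Proof.
move=> m0 mu0; have := log_rows_ge m0; have : 0 <= (trunc_log 2 m).+1%:R :> R by [].
move: (_.+1%:R) => l l0 ellR.
have lr0 : 0 <= log_rows R m by lra.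
have : Num.sqrt (mu * l) <= 2 * Num.sqrt (mu * log_rows R m).
  have -> : 2 = Num.sqrt (2 ^+ 2) :> R by rewrite sqrtr_sqr ger0_norm.
  rewrite -sqrtrM// ler_sqrt ?mulr_ge0//.
  have -> : 2 ^+ 2 * (mu * log_rows R m) = mu * (4 * log_rows R m) :> R by ring.
  exact: ler_wpM2l.
have := sqrtr_ge0 (mu * log_rows R m); lra.
Qed.

End Logarithms.

(** The seventh power: [K] digits, [K] levels, a walk of length O(lg^3), at most [K] bits of the
    pair index per step, and O(lg) for each scan or search. *)
Lemma cost_bound : exists D, forall ell K, (0 < ell)%N -> (0 < K)%N ->
  let lg := (ell + K)%N in
  (2000 + lg * (600 + lg * 400) + K * (2000 + 1000 * lg + K * (3000 + 1200 * lg +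
       walk_len ell K * (4000 + 1200 * lg + K * (1000 + 400 * lg)))) <= D * lg ^ 7)%N.
Proof.
exists (170 * 1000)%N => ell K e0 K0 /=; set L := (ell + K)%N; have L2 : (2 <= L)%N by rewrite /L; lia.
have KL : (K <= L)%N by rewrite leq_addl.
have wl : (walk_len ell K <= 64 * L ^ 3)%N.
  have -> : (64 * L ^ 3 = (4 * L) * (4 * L) * (4 * L))%N by ring.
  by rewrite /walk_len; apply: leq_mul; [apply: leq_mul|]; rewrite /L in L2 *; lia.
clearbody L; have P k : (2 * L ^ k <= L ^ k.+1)%N by rewrite expnS leq_mul2r L2 orbT.
move: (walk_len ell K) wl (P 0) (P 1) (P 2) (P 3) (P 4) (P 5) (P 6) => T wl.
rewrite expn0 expn1 => P0 P1 P2 P3 P4 P5 P6.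
have KM c k x : (x <= c * L ^ k)%N -> (K * x <= c * L ^ k.+1)%N.
  by move=> xc; rewrite expnS mulnCA; exact: leq_mul.
have LL k : (L * L ^ k = L ^ k.+1)%N by rewrite expnS.
have q1 : (K * (1000 + 400 * L) <= 900 * L ^ 2)%N by apply: KM; rewrite expn1; lia.
move: q1; set X := (K * _)%N => q1; clearbody X.
have q2 : (4000 + 1200 * L + X <= 2500 * L ^ 2)%N by lia.
have q3 : (T * (4000 + 1200 * L + X) <= 160 * 1000 * L ^ 5)%N.
  have -> : (160 * 1000 * L ^ 5 = 64 * L ^ 3 * (2500 * L ^ 2))%N by ring.
  exact: leq_mul.
move: q3; set Y := (T * _)%N => q3; clearbody Y.
have q4 : (K * (3000 + 1200 * L + Y) <= 161 * 1000 * L ^ 6)%N.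
  by apply: KM; move: (L ^ 2)%N (L ^ 3)%N (L ^ 4)%N (L ^ 5)%N P1 P2 P3 P4 q3 => *; lia.
move: q4; set Z := (K * _)%N => q4; clearbody Z.
have q5 : (K * (2000 + 1000 * L + Z) <= 162 * 1000 * L ^ 7)%N.
  by apply: KM; move: (L ^ 2)%N (L ^ 3)%N (L ^ 4)%N (L ^ 5)%N (L ^ 6)%N P1 P2 P3 P4 P5 q4 => *; lia.
move: q5; set V := (K * _)%N => q5; clearbody V.
have q6 : (L * (600 + L * 400) <= 700 * L ^ 2)%N.
  have -> : (L * (600 + L * 400) = 600 * L + 400 * L ^ 2)%N by ring.
  by move: (L ^ 2)%N P1 => *; lia.
by move: (L ^ 2)%N (L ^ 3)%N (L ^ 4)%N (L ^ 5)%N (L ^ 6)%N (L ^ 7)%N P1 P2 P3 P4 P5 P6 q5 q6 => *; lia.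
Qed.

(** * The encoded input and sums over its entries *)

Section Encoding.
Local Open Scope ring_scope.
Variables (R : realType) (m n : nat) (A : 'M[R]_(m, n)) (s : seq ('I_m * 'I_n)).
Hypothesis ls : lists_support A s.
Variable x0 : 'I_m * 'I_n.

Lemma size_support : size s = nnz A.
Proof.
case: ls => us sA; rewrite -(card_uniqP us); apply: eq_card => ij.
by rewrite sA inE.
Qed.

Lemma size_support_le : (size s <= m * n)%N.
Proof.
case: ls => us _; rewrite -(card_uniqP us).
by apply: leq_trans (max_card _) _; rewrite card_prod !card_ord.
Qed.

Lemma encode_matrixE : encode_matrix A s =
  arr (fun e => VPair (VWord ((nth x0 s e).1 : nat))
     (VPair (VWord ((nth x0 s e).2 : nat)) (VReal (A (nth x0 s e).1 (nth x0 s e).2)))) (size s).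
Proof. by rewrite /encode_matrix -{1}(mkseq_nth x0 s) -map_comp. Qed.

(** The positions outside the support carry the entry 0, so they may be added to the sum. *)
Lemma sum_support (f : nat -> R) (i : 'I_m) :
  \sum_(e < size s | ((nth x0 s e).1 : nat) == i)
    A (nth x0 s e).1 (nth x0 s e).2 * f (nth x0 s e).2 = \sum_(j < n) A i j * f j.
Proof.
case: ls => us sA.
pose G (ij : 'I_m * 'I_n) : R := if ij.1 == i then A ij.1 ij.2 * f ij.2 else 0.
transitivity (\sum_(ij <- s) G ij).
  by rewrite big_mkcond (big_nth x0) big_mkord.
rewrite big_uniq//= big_mkcond /=.
transitivity (\sum_(ij | ij.1 == i) A ij.1 ij.2 * f ij.2).
  rewrite [RHS]big_mkcond; apply: eq_bigr => ij _; rewrite sA /G.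
  by have [->|] := eqVneq (A ij.1 ij.2) 0; rewrite ?mul0r /=; case: ifP.
transitivity (\sum_(k | k == i) \sum_j A k j * f j); last by rewrite big_pred1_eq.
by rewrite pair_big /=; apply: eq_bigl => -[k j]; rewrite andbT.
Qed.

End Encoding.

Lemma arr_enum (R : realType) n (F : 'I_n -> value R) (g : nat -> value R) :
  (forall j : 'I_n, F j = g j) -> [seq F j | j <- enum 'I_n] = mkseq g n.
Proof. by move=> Fg; rewrite /mkseq -val_enum_ord -map_comp; apply: eq_map. Qed.

Local Open Scope ring_scope.

Theorem theorem1p3 (R : realType) :
  exists (prog : term) (c : nat) (C : R) (depth_poly work_poly : {poly R}),
  forall (m n : nat) (A : 'M[R]_(m, n)) (p : 'rV[R]_n) (s : seq ('I_m * 'I_n)),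
    (0 < m)%N -> (0 < n)%N ->
    (forall i j, 0 <= A i j <= 1) ->
    (forall j, 0 <= p 0 j <= 1) ->
    lists_support A s ->
    exists (q : 'rV[bool]_n) (work depth : nat),
      [/\ eval_wd (word_bound c m n) (encode_input A s p) prog
            (encode_bits R q) work depth,
          depth%:R <= depth_poly.[ln (m * n)%:R],
          work%:R <= (n + m + nnz A)%:R * work_poly.[ln (m * n)%:R]
        & forall i : 'I_m,
            let mu := \sum_(j < n) A i j * p 0 j in
            `| \sum_(j < n) A i j * (q 0 j)%:R - mu |
              <= C * (Num.sqrt (mu * log_rows R m) + log_rows R m)].
Proof.
have [D costD] := cost_bound.
(* [lg <= 2 (ln (m n) + 2)] bounds the cost [D lg^7] by this polynomial, which serves for both depth
   and work. *)
pose P : {poly R} := ((D * 2 ^ 7)%N%:R *: ('X + 2%:P) ^+ 7)%R.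
exists (cprog 4%N), 32%N, (80 * 1000)%R, P, P => m n A p s m0 n0 A01 p01 ls.
pose x0 := (Ordinal m0, Ordinal n0).
pose p' (j : nat) : R := if insub j is Some j' then p 0%R j' else 0%R.
have pE (j : 'I_n) : p' j = p 0%R j by rewrite /p' valK.
have p'01 j : (0 <= p' j <= 1)%R by rewrite /p'; case: insubP => [j' _ _|_]; rewrite ?p01// lexx ler01.
have [m1 m2] := pow_bounds m0; have [n1 n2] := pow_bounds n0.
set ell := (trunc_log 2 m).+1%N in m1 m2; set K := (trunc_log 2 n).+1%N in n1 n2.
have mn0 : (0 < m * n)%N by rewrite muln_gt0 m0.
have lgmn : (2 ^ (ell + K) <= 4 * (m * n))%N.
  have -> : (4 * (m * n) = 2 * m * (2 * n))%N by ring.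
  by rewrite expnD leq_mul.
(* 32 = 20 + 12: twenty factors 2 are each at most [m n + 1], and [2^lg <= 4 m n <= (m n + 1)^3] is
   raised to the fourth power. *)
have bigW : (2 ^ (20 + 4 * (ell + K)) <= word_bound 32 m n)%N.
  rewrite /word_bound -[32%N]/(20 + 12)%N !expnD leq_mul//; first by rewrite leq_exp2r.
  rewrite mulnC expnM -[12%N]/(3 * 4)%N [leqRHS]expnM leq_exp2r//; apply: leq_trans lgmn _.
  rewrite 2!expnS expn1; nia.
have nmz : ((n + m + size s).-1.+1 = n + m + size s)%N by rewrite prednK// -addnA addn_gt0 n0.
have rc_inj e e' : (e < size s)%N -> (e' < size s)%N ->
    ((nth x0 s e).1 : nat) = (nth x0 s e').1 -> ((nth x0 s e).2 : nat) = (nth x0 s e').2 -> e = e'.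
  move=> es es' /val_inj E1 /val_inj E2; have [us _] := ls.
  apply/eqP; rewrite -(nth_uniq x0 es es' us); apply/eqP.
  by move: E1 E2; case: (nth x0 s e) => i j; case: (nth x0 s e') => i' j' /= -> ->.
have [v [q [vE q1 qD]] [w [d [ev ws ds]]]] := runsP_prog m0 n0 (size_support_le ls) bigW nmz
  (fun e _ => ltn_ord (nth x0 s e).1) (fun e _ => ltn_ord (nth x0 s e).2) rc_inj
  (fun e => A01 (nth x0 s e).1 (nth x0 s e).2) p'01.
have costE := costD _ _ (ltn0Sn (trunc_log 2 m)) (ltn0Sn (trunc_log 2 n)).
rewrite -/ell -/K in costE qD ws ds.
exists (\row_j (0 < q j)%N)%R, w, d.
have qE (j : 'I_n) : ((0 < q j)%N : nat) = q j by have := q1 j (ltn_ord j); case: (q j) => [|[|]].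
have PE : ((D * (ell + K) ^ 7)%N%:R <= P.[ln (m * n)%:R] :> R)%R.
  have lgR : ((ell + K)%N%:R <= 2 * (ln (m * n)%:R + 2) :> R)%R.
    by apply: bits_le_ln4 lgmn => //; rewrite /ell addSn.
  rewrite /P hornerZ horner_exp hornerD hornerX hornerC [in leLHS]natrM natrX.
  rewrite [X in (_ <= X * _)%R]natrM -mulrA natrX -exprMn ler_wpM2l// lerXn2r ?nnegrE//.
  exact: le_trans lgR.
split.
- suff -> : encode_bits R (\row_(j < n) (0 < q j)%N)%R = v.
    rewrite /encode_input (encode_matrixE A s x0).
    suff -> : encode_reals p = arrR p' n by exact: ev.
    by congr VVec; apply: arr_enum => j; rewrite pE.
  by rewrite vE; congr VVec; apply: arr_enum => j; rewrite mxE qE.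
- by apply: le_trans PE; rewrite ler_nat; exact: leq_trans costE.
- apply: le_trans (_ : ((n + m + nnz A) * (D * (ell + K) ^ 7))%N%:R <= _)%R.
    rewrite ler_nat; apply: leq_trans ws _; rewrite nmz (size_support ls) leq_mul2l.
    by apply/orP; right; exact: costE.
  by rewrite natrM ler_wpM2l.
- move=> i; cbv zeta; set mu := (\sum_(j < n) A i j * p 0 j)%R.
  have := qD i (ltn_ord i).
  rewrite /= (sum_support ls x0 p') (sum_support ls x0 (fun j => (q j)%:R)%R).
  have -> : (\sum_(j < n) A i j * p' j = mu)%R by apply: eq_bigr => j _; rewrite pE.
  have -> : (\sum_(j < n) A i j * (q j)%:R = \sum_(j < n) A i j * ((\row_j (0 < q j)%N)%R ord0 j)%:R)%R.
    by apply: eq_bigr => j _; rewrite mxE qE.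
  move=> /le_trans; apply.
  have mu0 : (0 <= mu)%R.
    apply: sumr_ge0 => j _; have /andP[? _] := A01 i j; have /andP[? _] := p01 j.
    exact: mulr_ge0.
  exact: bound_log_rows.
Qed.
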